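(* Let $2\le p<+\infty$ and let $f\in H^p\setminus\{0\}$. Let $M(y)=\int_{-\infty}^{+\infty}|f(x+iy)|^p\,dx$ for $y>0$. Assume the functions $\varphi:(0,+\infty)\to(-\infty,+\infty)$ and $h:(0,+\infty)\to(-\infty,+\infty)$ meet the conditions (i) $\varphi\in\mathcal{D}^3(0,+\infty)$ and $\varphi(y)=-\int_y^{+\infty}\varphi'(t)\,dt$ for all $y\in(0,+\infty)$; (ii) $\varphi'>0$ and $\varphi'^2\varphi''+\varphi\varphi'\varphi'''-2\varphi\varphi''^2\le 0$ on $(0,+\infty)$; (iii) $h(y)=-\int_y^{+\infty}\varphi'(t)M(t)\,dt$ for all $y\in(0,+\infty)$. Then $\frac{h}{\varphi}$ and $\log\frac{h}{\varphi}$ both belong to $\mathcal{D}^2(0,+\infty)$, and moreover $$\Bigl(\frac{h}{\varphi}\Bigr)'<0,\qquad \Bigl(\log\frac{h}{\varphi}\Bigr)''>0\qquad\text{on }(0,+\infty).$$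
   Context: For a non-empty open interval $I\subset\mathbb{R}$ and $n\ge 1$, $\mathcal{D}^n(I)$ denotes the class of all real-valued functions having a finite $n$-th derivative everywhere in $I$ (no continuity of the $n$-th derivative is required). $H^p$ is the Hardy space of the upper half-plane: the holomorphic functions $f$ on $\{z\in\mathbb{C}:\operatorname{Im}z>0\}$ with $\sup_{y>0}\int_{-\infty}^{+\infty}|f(x+iy)|^p\,dx<+\infty$. A prime denotes differentiation. *)

(* Defs.v *)
From mathcomp Require Import all_boot all_order all_algebra.
From mathcomp Require Import complex.
From mathcomp Require Import all_classical all_reals all_analysis.

Set Implicit Arguments.
Unset Strict Implicit.
Unset Printing Implicit Defensive.

Import Order.TTheory GRing.Theory Num.Theory.
Import numFieldNormedType.Exports.

Local Open Scope ring_scope.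
Local Open Scope complex_scope.
Local Open Scope classical_set_scope.

(* [f^`(k)] is total; at a point of an open set [I] it depends only on the
   values of [f] near that point, so the values of [f] outside [I] are
   irrelevant. *)
Definition Dclass (R : realType) (n : nat) (I : set R) (f : R -> R) : Prop :=
  forall k, (k < n)%N -> forall x, I x -> derivable f^`(k) x 1.

Definition upper_half_plane (R : realType) : set R[i] :=
  [set z | 0 < complex.Im z].

(* [R[i]^o] is [R[i]] as a normed space over itself, so differentiability in
   direction 1 with scalars in [R[i]] is complex differentiability. *)
Definition holomorphic_on (R : realType) (U : set R[i]) (f : R[i] -> R[i]) :
    Prop :=
  forall z, U z -> derivable (f : R[i]^o -> R[i]^o) z 1.

Definition hardy_mean (R : realType) (p : R) (f : R[i] -> R[i]) (y : R) :
    \bar R :=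
  (\int[lebesgue_measure]_x (Normc.normc (f (x +i* y)) `^ p)%:E)%E.

Definition hardy_space (R : realType) (p : R) : set (R[i] -> R[i]) :=
  [set f | holomorphic_on (@upper_half_plane R) f /\
           (ereal_sup [set hardy_mean p f y | y in `]0%R, +oo[] < +oo)%E].

(* Main.v *)
Require Import Defs.
From mathcomp Require Import all_boot all_order all_algebra.
From mathcomp Require Import complex.
From mathcomp Require Import all_classical all_reals all_analysis.
From mathcomp Require Import measurable_realfun ring lra.

(** Write [M y] for the integral of [|f|^p] over the line of height [y], and
    [A = - phi], [H = - h]: two positive functions decreasing to [0], with
    [A' = - phi'] and [H' = - phi' M].

    The mean [M] is differentiable with [M' = p V] and [M'' = p^2 E], where
    [E] is the line integral of [|f|^(p-2) |f'|^2] and [V] that of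
    [- Im (|f|^(p-2) conj(f) f')] ([is_derive_line_mass],
    [is_derive_line_flux]).  By the Cauchy-Schwarz inequality
    [V^2 < E M] ([cauchy_schwarz_strict]): equality would force
    [f' = - i l f] on the line, hence [|f|] constant there, which is not
    integrable unless [f] vanishes.  So [M'^2 < M M''].  Moreover [M > 0]
    everywhere ([line_mass_gt0]), because [ln (M + e)] is convex for all
    [e > 0], with a slope bounded independently of [e] where [M] is positive;
    and [M' < 0] ([line_flux_lt0]), because [M] is strictly convex and
    bounded.

    The derivatives of [M] come from Green's formula on long rectangles for
    two fields: [(0, |f|^p)], and [(Re W, - Im W)] with
    [W = |f|^(p-2) conj(f) f'], whose divergence is [p |f|^(p-2) |f'|^2].
    Since [f'] is only known to exist, Green's formula is proved by Goursat's
    bisection ([green]).  Applied to a compactly supported field it gives the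
    mean value property ([mean_value]), hence bounds of [f], [f'] and of the
    increments of [f'] by integrals of [|f|] over squares
    ([cderiv_estimate], [cderiv_lipschitz]).  The increments are what makes
    the formula hold for [W], as a limit of fields built on difference
    quotients ([defect_W]).  The pointwise bounds and Jensen's inequality give
    a single integrable majorant, vanishing at infinity, for the fields on a
    horizontal strip ([fields_dominated]); it kills the flux through the
    vertical sides and permits differentiation under the integral
    ([strip_derivative]).

    The rest is calculus on the half-line.  Put [v = A / phi'].  The
    differential inequality for [phi] says exactly that [v] is concave, and then [v' >= 0] as [v > 0].
    Let [G = A M - H]; [G' = A M' < 0] and [G] is asymptotically nonnegative,
    so [G > 0], and [(h / phi)' = - phi' G / phi^2 < 0].  Finally
    [K = H v^2 (ln (h / phi))''] equals [- v A M' - r G + G v'] with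
    [r = A M / H], and its derivative is [G v''] minus a quadratic form which
    is positive because [M'^2 < M M'']; so [K] is strictly decreasing.  If it
    were not positive, it would stay below some [- c < 0] far out, so that
    [c H <= (A M)^2], i.e. [sqrt H - (sqrt c / 2) ln A] is nonincreasing there,
    contradicting [A --> 0].  Hence [K > 0] ([ln_quotient_deriv2_gt0]). *)

Set Implicit Arguments.
Unset Strict Implicit.
Unset Printing Implicit Defensive.

Import Order.TTheory GRing.Theory Num.Theory.
Import numFieldNormedType.Exports.

Local Open Scope ring_scope.
Local Open Scope complex_scope.
Local Open Scope classical_set_scope.

(** * Rules of real differentiation *)

Section RealDerivatives.
Context {R : realType}.
Implicit Types (F G : R -> R) (x f g : R).

Lemma deriv_add F G x f g : is_derive x 1 F f -> is_derive x 1 G g ->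
  is_derive x 1 (fun t => F t + G t) (f + g).
Proof. by move=> h1 h2; exact: is_deriveD h1 h2. Qed.

Lemma deriv_sub F G x f g : is_derive x 1 F f -> is_derive x 1 G g ->
  is_derive x 1 (fun t => F t - G t) (f - g).
Proof. by move=> h1 h2; exact: is_deriveB h1 h2. Qed.

Lemma deriv_opp F x f : is_derive x 1 F f -> is_derive x 1 (fun t => - F t) (- f).
Proof. by move=> h1; exact: is_deriveN h1. Qed.

Lemma deriv_mul F G x f g : is_derive x 1 F f -> is_derive x 1 G g ->
  is_derive x 1 (fun t => F t * G t) (f * G x + F x * g).
Proof.
move=> h1 h2; apply: is_derive_eq (is_deriveM h1 h2) _.
by rewrite /GRing.scale /= addrC mulrC.
Qed.

Lemma deriv_cst (k x : R) : is_derive x 1 (fun=> k) 0.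
Proof. exact: is_derive_cst. Qed.

Lemma deriv_inv F x f : is_derive x 1 F f -> F x != 0 ->
  is_derive x 1 (fun t => (F t)^-1) (- f / F x ^+ 2).
Proof.
move=> h1 nz; have := is_deriveV nz h1.
by move=> h; apply: is_derive_eq h _; rewrite /GRing.scale /= !mulNr mulrC.
Qed.

Lemma deriv_div F G x f g : is_derive x 1 F f -> is_derive x 1 G g -> G x != 0 ->
  is_derive x 1 (fun t => F t / G t) ((f * G x - F x * g) / G x ^+ 2).
Proof.
move=> h1 h2 nz; apply: is_derive_eq (deriv_mul h1 (deriv_inv h2 nz)) _.
by field.
Qed.

Lemma deriv_ln F x f : is_derive x 1 F f -> 0 < F x ->
  is_derive x 1 (fun t => ln (F t)) (f / F x).
Proof.
move=> h1 F0; apply: is_derive_eq (is_derive1_comp (is_derive1_ln F0) h1) _.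
by rewrite mulrC.
Qed.

Lemma deriv_continuous F x f : is_derive x 1 F f -> {for x, continuous F}.
Proof.
move=> h; apply: differentiable_continuous; apply/derivable1_diffP.
exact: (@ex_derive _ _ _ _ _ _ _ h).
Qed.

Lemma mvt_pos F (dF : R -> R) (a b : R) : 0 < a -> a < b ->
  (forall t : R, 0 < t -> is_derive t 1 F (dF t)) ->
  exists c, [/\ a < c, c < b & F b - F a = dF c * (b - a)].
Proof.
move=> a0 ab H.
have dv x : x \in `]a, b[%R -> is_derive x 1 F (dF x).
  by rewrite in_itv/= => /andP[ax _]; apply: H; exact: lt_trans ax.
have cF : {within `[a, b], continuous F}.
  apply: continuous_in_subspaceT => x; rewrite inE/= in_itv/= => /andP[ax _].
  exact: deriv_continuous (H x (lt_le_trans a0 ax)).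
have [c] := MVT ab dv cF.
by rewrite in_itv/= => /andP[ac cb] e; exists c.
Qed.

End RealDerivatives.

(** * Integrals of continuous functions over intervals and rectangles *)

Section CompactIntegrals.
Context {R : realType}.
Local Notation mu := (@lebesgue_measure R).
Implicit Types (a b c d x y : R).

Definition cts_on a b (g : R -> R) := forall x, a <= x <= b -> {for x, continuous g}.

Lemma cts_on_integrable a b (g : R -> R) : cts_on a b g -> mu.-integrable `[a, b] (EFin \o g).
Proof.
move=> H; apply: continuous_compact_integrable; first exact: segment_compact.
apply: continuous_in_subspaceT => x; rewrite inE/= in_itv/= => ?; exact: H.
Qed.

Lemma itv_int_split a m b (g : R -> R) : a <= m -> m <= b -> cts_on a b g ->
  \int[mu]_(x in `[a, b]) g x =
  \int[mu]_(x in `[a, m]) g x + \int[mu]_(x in `[m, b]) g x.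
Proof.
move=> am mb H; have ig := cts_on_integrable H.
apply/eqP; rewrite addrC -subr_eq; apply/eqP.
rewrite Rintegral_itvB ?bnd_simp// Rintegral_itv_obnd_cbnd//.
by apply: integrableS ig => //; apply: subset_itvr; rewrite bnd_simp.
Qed.

Lemma itv_int_cst a b (C : R) : a <= b -> \int[mu]_(x in `[a, b]) C = C * (b - a).
Proof.
move=> ab; rewrite Rintegral_cst//= lebesgue_measure_itv/= lte_fin.
by case: ltgtP ab => //= <-; rewrite subrr.
Qed.

Lemma itv_int_bound a b C (g : R -> R) : a <= b -> cts_on a b g ->
  (forall x, a <= x <= b -> `|g x| <= C) ->
  `|\int[mu]_(x in `[a, b]) g x| <= C * (b - a).
Proof.
move=> ab H gC; apply: (le_trans (le_normr_Rintegral _ _)) => //.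
  exact: cts_on_integrable.
rewrite -(itv_int_cst C ab); apply: le_Rintegral => //.
- by apply: cts_on_integrable => x /H gx; apply: cvg_norm.
- by apply: cts_on_integrable => x _; apply: cvg_cst.
Qed.

Lemma itv_intD a b (g h : R -> R) : cts_on a b g -> cts_on a b h ->
  \int[mu]_(x in `[a, b]) (g x + h x) =
  \int[mu]_(x in `[a, b]) g x + \int[mu]_(x in `[a, b]) h x.
Proof. by move=> ? ?; rewrite RintegralD//; exact: cts_on_integrable. Qed.

Lemma itv_intB a b (g h : R -> R) : cts_on a b g -> cts_on a b h ->
  \int[mu]_(x in `[a, b]) (g x - h x) =
  \int[mu]_(x in `[a, b]) g x - \int[mu]_(x in `[a, b]) h x.
Proof. by move=> ? ?; rewrite RintegralB//; exact: cts_on_integrable. Qed.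

(** Continuity on the open upper half-plane only: the fields below are
    uncontrolled elsewhere. *)
Definition cont2 (g : R -> R -> R) := forall x y, 0 < y ->
  {for (x, y), continuous (fun p : R * R => g p.1 p.2)}.

Lemma cont2_y (g : R -> R -> R) x y : 0 < y -> cont2 g -> {for y, continuous (g x)}.
Proof.
move=> y0 /(_ x y y0) H.
have h : (x, z) @[z --> y] --> (x, y) by apply: (@cvg_pair _ _ _ _ (nbhs x) (nbhs y)) => /=; [exact: cvg_cst|exact: cvg_id].
exact: (cvg_comp _ _ h H).
Qed.

Lemma cont2_x (g : R -> R -> R) x y : 0 < y -> cont2 g -> {for x, continuous (g ^~ y)}.
Proof.
move=> y0 /(_ x y y0) H.
have h : (z, y) @[z --> x] --> (x, y) by apply: (@cvg_pair _ _ _ _ (nbhs x) (nbhs y)) => /=; [exact: cvg_id|exact: cvg_cst].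
exact: (cvg_comp _ _ h H).
Qed.

Lemma cont2_cts_y (g : R -> R -> R) x c d : 0 < c -> cont2 g -> cts_on c d (g x).
Proof. by move=> c0 H y /andP[cy _]; apply: cont2_y => //; exact: lt_le_trans cy. Qed.

Lemma cont2_cts_x (g : R -> R -> R) y a b : 0 < y -> cont2 g -> cts_on a b (g ^~ y).
Proof. by move=> c0 H x _; apply: cont2_x. Qed.

(** By compactness of the segment the neighbourhood of [x] can be chosen
    independently of [y]; this is what makes the integral over the segment
    continuous in [x]. *)
Lemma cont2_unif (g : R -> R -> R) x c d e : 0 < c -> 0 < e -> cont2 g ->
  \forall x' \near x, forall y, c <= y <= d -> `|g x' y - g x y| < e.
Proof.
move=> c0 e0 H.
have /compact_near_coveringP := @segment_compact R c d.
move/(_ R (nbhs x) (fun x' y => `|g x' y - g x y| < e) _) => K.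
have /K : forall y : R, `[c, d] y ->
    \forall y' \near y & x' \near x, `|g x' y' - g x y'| < e.
  move=> y; rewrite /= in_itv/= => /andP[cy _].
  have y0 : 0 < y by exact: lt_le_trans cy.
  have e20 : 0 < e / 2 by rewrite divr_gt0.
  have /cvgrPdist_lt/(_ _ e20) [[U V] /= [xU yV] UV] := H x y y0.
  exists (V, U) => //= -[y' x'] /= [Vy' Ux'].
  have /= h1 := UV (x', y') (conj Ux' Vy').
  have /= h2 := UV (x, y') (conj (nbhs_singleton xU) Vy').
  have -> : g x' y' - g x y' = (g x y - g x y') - (g x y - g x' y') by ring.
  by rewrite (le_lt_trans (ler_normB _ _))// [e]splitr ltrD.
apply: filterS => x' /= Kx y /andP[cy yd]; apply: Kx.
by rewrite /= in_itv/= cy.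
Qed.

Lemma cont2_int_continuous (g : R -> R -> R) x c d : 0 < c -> cont2 g ->
  {for x, continuous (fun x => \int[mu]_(y in `[c, d]) g x y)}.
Proof.
move=> c0 H; apply/cvgrPdist_lt => e e0.
have [cd|dc] := leP c d; last first.
  rewrite set_itv_ge ?bnd_simp -?ltNge//.
  by apply: nearW => z; rewrite !Rintegral_set0 subrr normr0.
have d0 : 0 < d - c + 1 by lra.
have e10 : 0 < e / (d - c + 1) by rewrite divr_gt0.
have := @cont2_unif g x c d _ c0 e10 H.
apply: filterS => x' K; rewrite -itv_intB; [|exact: cont2_cts_y..].
have /le_lt_trans H0 : `|\int[mu]_(y in `[c, d]) (g x y - g x' y)| <= e / (d - c + 1) * (d - c).
  apply: itv_int_bound => //.
    by move=> y cy; apply: cvgB; apply: cont2_cts_y cy.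
  by move=> y cy; rewrite distrC ltW// K.
apply: H0; rewrite -mulrA gtr_pMr// mulrC ltr_pdivrMr//; lra.
Qed.

Lemma cont2_int_cts (g : R -> R -> R) a b c d : 0 < c -> cont2 g ->
  cts_on a b (fun x => \int[mu]_(y in `[c, d]) g x y).
Proof. by move=> ? ? x _; exact: cont2_int_continuous. Qed.

Definition dint a b c d (g : R -> R -> R) :=
  \int[mu]_(x in `[a, b]) \int[mu]_(y in `[c, d]) g x y.

Lemma dint_splitx m a b c d (g : R -> R -> R) : a <= m -> m <= b -> 0 < c -> cont2 g ->
  dint a b c d g = dint a m c d g + dint m b c d g.
Proof. by move=> am mb c0 H; apply: itv_int_split => //; exact: cont2_int_cts. Qed.

Lemma dint_splity m a b c d (g : R -> R -> R) : c <= m -> m <= d -> 0 < c -> cont2 g ->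
  dint a b c d g = dint a b c m g + dint a b m d g.
Proof.
move=> cm md c0 H; rewrite /dint -itv_intD; last 2 first.
- exact: cont2_int_cts.
- by apply: cont2_int_cts => //; exact: lt_le_trans cm.
apply: eq_Rintegral => x _; apply: itv_int_split => //; exact: cont2_cts_y.
Qed.

Lemma dint_bound C a b c d (g : R -> R -> R) : a <= b -> c <= d -> 0 < c -> cont2 g ->
  (forall x y, a <= x <= b -> c <= y <= d -> `|g x y| <= C) ->
  `|dint a b c d g| <= C * (d - c) * (b - a).
Proof.
move=> ab cd c0 H gC; apply: itv_int_bound => //; first exact: cont2_int_cts.
by move=> x axb; apply: itv_int_bound => //; [exact: cont2_cts_y|move=> y; exact: gC].
Qed.

Lemma dintB a b c d (g h: R -> R -> R) : 0 < c -> cont2 g -> cont2 h ->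
  dint a b c d (fun x y => g x y - h x y) = dint a b c d g - dint a b c d h.
Proof.
move=> c0 H1 H2; rewrite /dint -itv_intB; [|exact: cont2_int_cts..].
by apply: eq_Rintegral => x _; apply: itv_intB; exact: cont2_cts_y.
Qed.

Lemma le_dint a b c d (g h: R -> R -> R) : 0 < c -> cont2 g -> cont2 h ->
  (forall x y, a <= x <= b -> c <= y <= d -> g x y <= h x y) ->
  dint a b c d g <= dint a b c d h.
Proof.
move=> c0 H1 H2 gh; apply: le_Rintegral => //.
- exact/cts_on_integrable/cont2_int_cts.
- exact/cts_on_integrable/cont2_int_cts.
- move=> x /=; rewrite in_itv/= => ax; apply: le_Rintegral => //.
  + exact/cts_on_integrable/cont2_cts_y.
  + exact/cts_on_integrable/cont2_cts_y.
  + by move=> y /=; rewrite in_itv/= => ?; exact: gh.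
Qed.

End CompactIntegrals.

(** * Green's formula without continuity of the partial derivatives *)

Section Green.
Context {R : realType}.
Local Notation mu := (@lebesgue_measure R).
Implicit Types (a b c d x y : R) (P Q D : R -> R -> R).

Let addr_regroup (p1 p2 q1 q2 d1 d2 : R) :
  p1 + p2 + (q1 + q2) - (d1 + d2) = p1 + q1 - d1 + (p2 + q2 - d2).
Proof. ring. Qed.

Let addr_recenter (p q d p0 q0 : R) :
  p + q - d = p - p0 + (q - q0) - (d - (p0 + q0)).
Proof. ring. Qed.

(** Outward flux of the field [(P, Q)] through the boundary of the
    rectangle with opposite corners [(a, c)] and [(b, d)]. *)
Definition flux P Q a b c d : R :=
  \int[mu]_(y in `[c, d]) (P b y - P a y) + \int[mu]_(x in `[a, b]) (Q x d - Q x c).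

(** Real differentiability at a point, where only the sum of the diagonal
    partial derivatives is recorded: the affine part of a field contributes
    to the flux through its divergence alone. *)
Definition has_divergence P Q D x0 y0 := exists p1 p2 q1 q2, p1 + q2 = D x0 y0 /\
  forall e, 0 < e -> exists2 r, 0 < r &
  forall x y, `|x - x0| < r -> `|y - y0| < r ->
   `|P x y - P x0 y0 - (p1 * (x - x0) + p2 * (y - y0))| <= e * (`|x - x0| + `|y - y0|) /\
   `|Q x y - Q x0 y0 - (q1 * (x - x0) + q2 * (y - y0))| <= e * (`|x - x0| + `|y - y0|).

Lemma nested_point (u v : nat -> R) :
  (forall n, u n <= u n.+1) -> (forall n, v n.+1 <= v n) -> (forall n, u n <= v n) ->
  exists x, forall n, u n <= x <= v n.
Proof.
move=> u1 v1 uv.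
have uM : {homo u : n m / (n <= m)%N >-> n <= m} by apply/nondecreasing_seqP.
have vM : {homo v : n m / (n <= m)%N >-> n >= m} by apply/nonincreasing_seqP.
have uv' n m : u n <= v m.
  by rewrite (le_trans (uM _ _ (leq_maxl n m)))// (le_trans (uv _))// vM// leq_maxr.
exists (sup (range u)) => n; apply/andP; split.
  by apply: ub_le_sup; [exists (v 0) => _ [m _ <-]|exists n].
by apply: ge_sup; [exists (u 0); exists 0%N|move=> _ [m _ <-]].
Qed.

(** Goursat's bisection. If [F] were nonzero on the rectangle, one of its
    four quarters would carry at least a fourth of [`|F|], and so on; the
    quarters shrink to a point, near which [F] is small compared with the
    square of the side, so [4 ^ n] times its value tends to zero. *)
Lemma additive_rect_eq0 (F : R -> R -> R -> R -> R) a b c d :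
  (forall m a b c d, a <= m -> m <= b -> 0 < c -> c <= d -> F a b c d = F a m c d + F m b c d) ->
  (forall m a b c d, c <= m -> m <= d -> 0 < c -> F a b c d = F a b c m + F a b m d) ->
  a <= b -> c <= d -> 0 < c ->
  (forall x0 y0, a <= x0 <= b -> c <= y0 <= d -> forall e, 0 < e ->
    exists2 r, 0 < r & forall a b c d, a <= x0 <= b -> c <= y0 <= d -> 0 < c ->
     b - a < r -> d - c < r -> `|F a b c d| <= e * ((b - a) + (d - c)) ^+ 2) ->
  F a b c d = 0.
Proof.
move=> splitx splity ab cd c0 H; apply/eqP; rewrite -normr_eq0; apply/negPn/negP => E0.
have {}E0 : 0 < `|F a b c d| by rewrite lt_def E0/=.
set L := b - a; set K := d - c.
have L0 : 0 <= L by rewrite subr_ge0.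
have K0 : 0 <= K by rewrite subr_ge0.
pose E n (p : R * R) := `|F p.1 (p.1 + L / 2 ^+ n) p.2 (p.2 + K / 2 ^+ n)|.
have ne0 n : (2 : R) ^+ n != 0 by rewrite expf_neq0.
have Ln0 n : 0 <= L / 2 ^+ n by rewrite divr_ge0// exprn_ge0.
have Kn0 n : 0 <= K / 2 ^+ n by rewrite divr_ge0// exprn_ge0.
have halfL (M : R) n : M / 2 ^+ n = M / 2 ^+ n.+1 + M / 2 ^+ n.+1.
  by rewrite exprS; field; rewrite ?ne0.
(* The rectangle at stage n is represented by its lower left corner;
   outside the half-plane any value will do. *)
have step (np : nat * (R * R)) : exists q : R * R, 0 < np.2.2 ->
  [/\ (q.1 = np.2.1) \/ (q.1 = np.2.1 + L / 2 ^+ np.1.+1),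
      (q.2 = np.2.2) \/ (q.2 = np.2.2 + K / 2 ^+ np.1.+1) &
      E np.1 np.2 / 4 <= E np.1.+1 q].
  case: np => n [x y] /=.
  have [y0|_] := boolP (0 < y); last by exists (x, y).
  have := Ln0 n.+1; have := Kn0 n.+1.
  have : E n (x, y) <= E n.+1 (x, y) + E n.+1 (x + L / 2 ^+ n.+1, y) +
     (E n.+1 (x, y + K / 2 ^+ n.+1) + E n.+1 (x + L / 2 ^+ n.+1, y + K / 2 ^+ n.+1)).
    rewrite /E /= (halfL L) (halfL K) !addrA; have := Ln0 n.+1; have := Kn0 n.+1.
    set l := L / _; set k := K / _ => k0 l0.
    have xl : x <= x + l by rewrite lerDl.
    have xl2 : x + l <= x + l + l by rewrite lerDl.
    have yk : y <= y + k by rewrite lerDl.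
    have yk2 : y + k <= y + k + k by rewrite lerDl.
    rewrite (splity (y + k))// (splitx (x + l) _ _ y)// (splitx (x + l) _ _ (y + k))//; last first.
      exact: lt_le_trans yk.
    by apply: le_trans (ler_normD _ _) _; rewrite -[leRHS]addrA; apply: lerD; exact: ler_normD.
  set l := L / _; set k := K / _ => H4 k0 l0.
  have [h1|h1] := leP (E n (x, y) / 4) (E n.+1 (x, y)).
    by exists (x, y) => _; split => //; left.
  have [h2|h2] := leP (E n (x, y) / 4) (E n.+1 (x + l, y)).
    by exists (x + l, y) => _; split => //; [right|left].
  have [h3|h3] := leP (E n (x, y) / 4) (E n.+1 (x, y + k)).
    by exists (x, y + k) => _; split => //; [left|right].
  exists (x + l, y + k) => _; split; [by right|by right|].
  move: H4 h1 h2 h3; lra.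
have [nxt Hn] := choice step.
pose p := fix p n : R * R := if n is m.+1 then nxt (m, p m) else (a, c).
have pos n : c <= (p n).2.
  elim: n => [|n IH] //=; have /= [] := Hn (n, p n) (lt_le_trans c0 IH).
  move=> _ [->//|->] _; by rewrite (le_trans IH)// lerDl.
have pS n : [/\ ((p n.+1).1 = (p n).1) \/ ((p n.+1).1 = (p n).1 + L / 2 ^+ n.+1),
      ((p n.+1).2 = (p n).2) \/ ((p n.+1).2 = (p n).2 + K / 2 ^+ n.+1) &
      E n (p n) / 4 <= E n.+1 (p n.+1)].
  exact: (Hn (n, p n) (lt_le_trans c0 (pos n))).
have [x0 Hx0] : exists x0, forall n, (p n).1 <= x0 <= (p n).1 + L / 2 ^+ n.
  apply: nested_point => n; last by rewrite lerDl.
  - by have [[->|->] _ _] := pS n => //; rewrite lerDl.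
  - by have := Ln0 n.+1; rewrite (halfL L n); have [[->|->] _ _] := pS n; lra.
have [y0 Hy0] : exists y0, forall n, (p n).2 <= y0 <= (p n).2 + K / 2 ^+ n.
  apply: nested_point => n; last by rewrite lerDl.
  - by have [_ [->|->] _] := pS n => //; rewrite lerDl.
  - by have := Kn0 n.+1; rewrite (halfL K n); have [_ [->|->] _] := pS n; lra.
have x0ab : a <= x0 <= b.
  by have := Hx0 0%N; rewrite /= expr0 divr1 /L addrC subrK.
have y0cd : c <= y0 <= d.
  by have := Hy0 0%N; rewrite /= expr0 divr1 /K addrC subrK.
have y00 : 0 < y0 by case/andP: y0cd => + _; exact: lt_le_trans.
have EE n : `|F a b c d| / 4 ^+ n <= E n (p n).
  elim: n => [|n IH].
    by rewrite expr0 divr1 /E /= !expr0 !divr1 /L /K ![_ + (_ - _)]addrC !subrK.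
  have [_ _] := pS n; apply: le_trans.
  by rewrite exprSr invfM mulrA ler_pM2r.
pose S := (L + K) ^+ 2 + 1; have S0 : 0 < S by rewrite ltr_wpDl// sqr_ge0.
pose e := `|F a b c d| / S.
have e0 : 0 < e by rewrite divr_gt0.
have [r r0 Hr] := H _ _ x0ab y0cd _ e0.
have [n Hln] : exists n, L / 2 ^+ n < r /\ K / 2 ^+ n < r.
  have /cvgrPdist_lt/(_ _ r0) : (fun n => (L + K) * (2^-1) ^+ n) @ \oo --> 0.
    rewrite -[X in _ --> X](mulr0 (L + K)); apply: cvgMr.
    by apply: cvg_expr; rewrite gtr0_norm// invf_lt1// ltr1n.
  case=> n _ /(_ n (leqnn n)) /=; rewrite sub0r normrN normrM exprVn => h; exists n.
  split; apply: le_lt_trans h.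
  1,2: rewrite (ger0_norm (addr_ge0 L0 K0)).
  1,2: by rewrite ger0_norm ?invr_ge0 ?exprn_ge0//
     ler_pM2r ?invr_gt0 ?exprn_gt0// ?lerDl ?lerDr.
have := Hr (p n).1 ((p n).1 + L / 2 ^+ n) (p n).2 ((p n).2 + K / 2 ^+ n) (Hx0 n) (Hy0 n)
  (lt_le_trans c0 (pos n)).
rewrite ![_ + _ / _ - _]addrC !addKr => /(_ Hln.1 Hln.2) /(le_trans (EE n)).
have -> : L / 2 ^+ n + K / 2 ^+ n = (L + K) / 2 ^+ n by ring.
have -> : (4 : R) = 2 * 2 by ring.
rewrite expr_div_n mulrA exprAC -expr2 exprAC ler_pM2r ?invr_gt0 ?exprn_gt0//.
rewrite /e mulrAC ler_pdivlMr// ler_pM2l// /S; lra.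
Qed.

Variables (P Q D : R -> R -> R).
Hypotheses (cP : cont2 P) (cQ : cont2 Q) (cD : cont2 D).

(** Green's formula for the field [(P, Q)] of divergence [D] says that this
    vanishes. It is additive under subdivision, so it can be studied
    locally. *)
Definition defect a b c d := flux P Q a b c d - dint a b c d D.

Lemma flux_cts_y a b c d : 0 < c -> cts_on c d (fun y => P b y - P a y).
Proof. by move=> c0 y h; apply: cvgB; apply: cont2_cts_y h. Qed.

Lemma flux_cts_x a b c d : 0 < c -> 0 < d -> cts_on a b (fun x => Q x d - Q x c).
Proof. by move=> c0 d0 x h; apply: cvgB; apply: cont2_cts_x h. Qed.

Lemma defect_splitx m a b c d : a <= m -> m <= b -> 0 < c -> c <= d ->
  defect a b c d = defect a m c d + defect m b c d.
Proof.
move=> am mb c0 cd; have d0 : 0 < d by exact: lt_le_trans cd.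
rewrite /defect /flux (dint_splitx _ am mb)// (itv_int_split am mb); last exact: flux_cts_x.
have -> : \int[mu]_(y in `[c, d]) (P b y - P a y) =
   \int[mu]_(y in `[c, d]) (P m y - P a y) + \int[mu]_(y in `[c, d]) (P b y - P m y).
  rewrite -itv_intD; [|exact: flux_cts_y..].
  by apply: eq_Rintegral => y _; ring.
exact: addr_regroup.
Qed.

Lemma defect_splity m a b c d : c <= m -> m <= d -> 0 < c ->
  defect a b c d = defect a b c m + defect a b m d.
Proof.
move=> cm md c0; have m0 : 0 < m by exact: lt_le_trans cm.
have d0 : 0 < d by exact: lt_le_trans md.
rewrite /defect /flux (dint_splity _ _ cm md)// (itv_int_split cm md); last exact: flux_cts_y.
have -> : \int[mu]_(x in `[a, b]) (Q x d - Q x c) =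
   \int[mu]_(x in `[a, b]) (Q x m - Q x c) + \int[mu]_(x in `[a, b]) (Q x d - Q x m).
  rewrite -itv_intD; [|exact: flux_cts_x..].
  by apply: eq_Rintegral => y _; ring.
exact: addr_regroup.
Qed.

(** The affine part of the field and the value of [D] at the point
    contribute amounts that cancel exactly; the flux and the integral of
    the remainders are small compared with the square of the side. *)
Lemma defect_local x0 y0 e : 0 < y0 -> has_divergence P Q D x0 y0 -> 0 < e ->
  exists2 r, 0 < r & forall a b c d, a <= x0 <= b -> c <= y0 <= d -> 0 < c ->
   b - a < r -> d - c < r -> `|defect a b c d| <= e * ((b - a) + (d - c)) ^+ 2.
Proof.
move=> y00 [p1 [p2 [q1 [q2 [pq H]]]]] e0.
(* The flux remainders add up to 2 (l + k)^2 and that of the integral to l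
   k, in units of e / 5. *)
have e50 : 0 < e / 5 by rewrite divr_gt0.
have [r r0 {}H] := H _ e50.
have /cvgrPdist_lt/(_ _ e50)/nbhs_ballP[s /= s0 Hs] := @cD x0 y0 y00.
exists (Order.min r s); first by rewrite lt_min r0.
move=> a b c d /andP[ax xb] /andP[cy yd] c0; rewrite !lt_min => /andP[abr abs] /andP[cdr cds].
have ab : a <= b by exact: le_trans xb.
have cd : c <= d by exact: le_trans yd.
have d0 : 0 < d by exact: lt_le_trans cd.
set l := b - a; set k := d - c; have l0 : 0 <= l by rewrite subr_ge0.
have k0 : 0 <= k by rewrite subr_ge0.
have dx x : a <= x <= b -> `|x - x0| <= l.
  by move=> /andP[? ?]; rewrite ler_norml /l; apply/andP; split; lra.
have dy y : c <= y <= d -> `|y - y0| <= k.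
  by move=> /andP[? ?]; rewrite ler_norml /k; apply/andP; split; lra.
have aab : a <= a <= b by rewrite lexx.
have bab : a <= b <= b by rewrite lexx ab.
have ccd : c <= c <= d by rewrite lexx.
have dcd : c <= d <= d by rewrite lexx cd.
have HH x y : a <= x <= b -> c <= y <= d ->
   `|P x y - P x0 y0 - (p1 * (x - x0) + p2 * (y - y0))| <= e / 5 * (l + k) /\
   `|Q x y - Q x0 y0 - (q1 * (x - x0) + q2 * (y - y0))| <= e / 5 * (l + k).
  move=> hx hy; have [] := H x y (le_lt_trans (dx _ hx) abr) (le_lt_trans (dy _ hy) cdr).
  have h : e / 5 * (`|x - x0| + `|y - y0|) <= e / 5 * (l + k).
    by rewrite ler_pM2l// lerD// ?dx// dy.
  by move=> h1 h2; split; apply: le_trans h.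
have FP : `|\int[mu]_(y in `[c, d]) (P b y - P a y) - p1 * l * k| <= 2 * (e / 5) * (l + k) * k.
  rewrite -[p1 * l * k](itv_int_cst _ cd) -itv_intB; last 2 first.
  - exact: flux_cts_y.
  - by move=> y _; apply: cvg_cst.
  apply: itv_int_bound => //.
    by move=> y hy; apply: cvgB; [apply: flux_cts_y hy|apply: cvg_cst].
  move=> y hy; have [h1 _] := HH b y bab hy; have [h2 _] := HH a y aab hy.
  have -> : P b y - P a y - p1 * l = (P b y - P x0 y0 - (p1 * (b - x0) + p2 * (y - y0)))
     - (P a y - P x0 y0 - (p1 * (a - x0) + p2 * (y - y0))) by rewrite /l; ring.
  apply: le_trans (ler_normB _ _) _.
  have -> : 2 * (e / 5) * (l + k) = e / 5 * (l + k) + e / 5 * (l + k) by ring.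
  exact: lerD.
have FQ : `|\int[mu]_(x in `[a, b]) (Q x d - Q x c) - q2 * k * l| <= 2 * (e / 5) * (l + k) * l.
  rewrite -[q2 * k * l](itv_int_cst _ ab) -itv_intB; last 2 first.
  - exact: flux_cts_x.
  - by move=> y _; apply: cvg_cst.
  apply: itv_int_bound => //.
    by move=> y hy; apply: cvgB; [apply: flux_cts_x hy|apply: cvg_cst].
  move=> x hx; have [_ h1] := HH x d hx dcd; have [_ h2] := HH x c hx ccd.
  have -> : Q x d - Q x c - q2 * k = (Q x d - Q x0 y0 - (q1 * (x - x0) + q2 * (d - y0)))
     - (Q x c - Q x0 y0 - (q1 * (x - x0) + q2 * (c - y0))) by rewrite /k; ring.
  apply: le_trans (ler_normB _ _) _.
  have -> : 2 * (e / 5) * (l + k) = e / 5 * (l + k) + e / 5 * (l + k) by ring.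
  exact: lerD.
have FD : `|dint a b c d D - D x0 y0 * k * l| <= e / 5 * k * l.
  have -> : D x0 y0 * k * l = dint a b c d (fun _ _ => D x0 y0).
    rewrite /dint; under eq_Rintegral do rewrite (itv_int_cst _ cd).
    by rewrite (itv_int_cst _ ab).
  have cc : cont2 (fun _ _ => D x0 y0) by move=> x y _; apply: cvg_cst.
  rewrite -dintB//; apply: dint_bound => //.
    by move=> x y hy; apply: cvgB; [exact: cD|exact: cc].
  move=> x y hx hy; rewrite distrC ltW//; apply: (Hs (x, y)).
  by split => /=; rewrite -ball_normE /ball_ /= distrC; [exact: le_lt_trans (dx _ hx) _|exact: le_lt_trans (dy _ hy) _].
have -> : defect a b c d = (\int[mu]_(y in `[c, d]) (P b y - P a y) - p1 * l * k) +
  (\int[mu]_(x in `[a, b]) (Q x d - Q x c) - q2 * k * l) - (dint a b c d D - D x0 y0 * k * l).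
  by rewrite /defect /flux [LHS](addr_recenter _ _ _ (p1 * l * k) (q2 * k * l)) -pq; congr (_ - (_ - _)); ring.
apply: le_trans (ler_normB _ _) _.
apply: le_trans (lerD (ler_normD _ _) (lexx _)) _.
apply: le_trans (lerD (lerD FP FQ) FD) _.
have lk0 : 0 <= l * k by rewrite mulr_ge0.
have -> : 2 * (e / 5) * (l + k) * k + 2 * (e / 5) * (l + k) * l + e / 5 * k * l =
  e / 5 * (2 * (l + k) ^+ 2 + l * k) by ring.
rewrite -mulrA ler_pM2l// mulrC -ler_pdivlMr ?invr_gt0// invrK.
have := sqr_ge0 (l - k); nra.
Qed.

(** Since only a pointwise expansion of the field is used, its partial
    derivatives need not be continuous. *)
Lemma green a b c d : a <= b -> c <= d -> 0 < c ->
  (forall x y, a <= x <= b -> c <= y <= d -> has_divergence P Q D x y) ->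
  defect a b c d = 0.
Proof.
move=> ab cd c0 H; apply: additive_rect_eq0 => //.
- by move=> *; exact: defect_splitx.
- by move=> *; exact: defect_splity.
move=> x0 y0 hx hy e e0; apply: defect_local => //; last exact: H.
by case/andP: hy => + _; exact: lt_le_trans.
Qed.

Lemma itv_int_small x0 (g : R -> R) e : (forall x, {for x, continuous g}) -> 0 < e ->
  exists2 r, 0 < r & forall a b, x0 - r < a -> a <= b -> b < x0 + r ->
    `|\int[mu]_(x in `[a, b]) g x| <= e.
Proof.
move=> cg e0; have /cvgrPdist_lt/(_ _ ltr01)/nbhs_ballP[s /= s0 Hs] := cg x0.
pose C := `|g x0| + 1; have C0 : 0 < C by rewrite ltr_wpDl.
exists (Order.min s (e / (2 * C))); first by rewrite lt_min s0/= divr_gt0// mulr_gt0.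
set r := Order.min _ _; move=> a b ar ab br.
have rs : r <= s by rewrite ge_min lexx.
have re : r <= e / (2 * C) by rewrite ge_min lexx orbT.
have /le_trans : `|\int[mu]_(x in `[a, b]) g x| <= C * (b - a).
  apply: itv_int_bound => // x /andP[ax xb].
  have xs : `|x - x0| < s by rewrite ltr_norml; apply/andP; split; lra.
  have := Hs x; rewrite -ball_normE /ball_ /= distrC => /(_ xs) h.
  have -> : g x = g x0 - (g x0 - g x) by ring.
  by apply: le_trans (ler_normB _ _) _; rewrite lerD// ltW.
apply; rewrite mulrC -ler_pdivlMr//.
have -> : e / C = e / (2 * C) + e / (2 * C) by field; rewrite gt_eqF.
lra.
Qed.

(** The fluxes through the two long sides of a thin strip nearly cancel, by
    continuity of the field; the rest is an integral over a short interval. *)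
Lemma defect_thin x0 c d e : 0 < c -> c <= d -> 0 < e ->
  exists2 r, 0 < r & forall a b, x0 - r < a -> a <= b -> b < x0 + r ->
    `|defect a b c d| <= e.
Proof.
move=> c0 cd e0; have d0 : 0 < d by exact: lt_le_trans cd.
have e30 : 0 < e / 4 by rewrite divr_gt0.
have ek0 : 0 < e / 4 / (d - c + 1) by rewrite divr_gt0//; lra.
have /nbhs_ballP[r1 /= r10 H1] := cont2_unif x0 d c0 ek0 cP.
have [r2 r20 H2] : exists2 r, 0 < r & forall a b, x0 - r < a -> a <= b -> b < x0 + r ->
    `|\int[mu]_(x in `[a, b]) (Q x d - Q x c)| <= e / 4.
  apply: itv_int_small => // x; apply: (@flux_cts_x x x) => //; exact/andP.
have [r3 r30 H3] : exists2 r, 0 < r & forall a b, x0 - r < a -> a <= b -> b < x0 + r ->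
    `|\int[mu]_(x in `[a, b]) \int[mu]_(y in `[c, d]) D x y| <= e / 4.
  by apply: itv_int_small => // x; exact: cont2_int_continuous.
exists (Order.min r1 (Order.min r2 r3)); first by rewrite !lt_min r10 r20.
set r := Order.min _ _; move=> a b ar ab br.
have rr1 : r <= r1 by rewrite ge_min lexx.
have rr2 : r <= r2 by rewrite !ge_min lexx ?orbT.
have rr3 : r <= r3 by rewrite !ge_min lexx ?orbT.
have h2 : `|\int[mu]_(x in `[a, b]) (Q x d - Q x c)| <= e / 4 by apply: H2 => //; lra.
have h3 : `|dint a b c d D| <= e / 4 by apply: H3 => //; lra.
have h1 : `|\int[mu]_(y in `[c, d]) (P b y - P a y)| <= e / 2.
  have /le_trans : `|\int[mu]_(y in `[c, d]) (P b y - P a y)| <=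
       2 * (e / 4 / (d - c + 1)) * (d - c).
    apply: itv_int_bound => //; first exact: flux_cts_y.
    move=> y hy.
    have ha : `|P a y - P x0 y| < e / 4 / (d - c + 1).
      by apply: H1 => //; rewrite -ball_normE /ball_ /= ltr_norml; apply/andP; split; lra.
    have hb : `|P b y - P x0 y| < e / 4 / (d - c + 1).
      by apply: H1 => //; rewrite -ball_normE /ball_ /= ltr_norml; apply/andP; split; lra.
    have -> : P b y - P a y = (P b y - P x0 y) - (P a y - P x0 y) by ring.
    apply: le_trans (ler_normB _ _) _; lra.
  apply; move: ek0; set t := e / 4 / _ => t0.
  have : t * (d - c + 1) = e / 4 by rewrite /t divfK// gt_eqF//; lra.
  by rewrite mulrDr mulr1; lra.
rewrite /defect /flux; apply: le_trans (ler_normB _ _) _.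
apply: le_trans (lerD (ler_normD _ _) (lexx _)) _.
apply: le_trans (lerD (lerD h1 h2) h3) _; lra.
Qed.

Lemma defect_degenerate a c d : 0 < c -> c <= d -> defect a a c d = 0.
Proof.
move=> c0 cd; have := @defect_splitx a a a c d (lexx _) (lexx _) c0 cd; lra.
Qed.

(** On one vertical line the field may be merely continuous: that line lies
    in a strip of arbitrarily small defect. The mean value property needs
    this at the pole of a difference quotient. *)
Lemma green_except x0 a b c d : a <= b -> c <= d -> 0 < c ->
  (forall x y, a <= x <= b -> c <= y <= d -> x != x0 -> has_divergence P Q D x y) ->
  defect a b c d = 0.
Proof.
move=> ab cd c0 H.
have [xa|ax] := ltP x0 a.
  by apply: green => // x y hx hy; apply: H => //; case/andP: hx => h _; rewrite gt_eqF// (lt_le_trans xa).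
have [bx|xb] := ltP b x0.
  by apply: green => // x y hx hy; apply: H => //; case/andP: hx => _ h; rewrite lt_eqF// (le_lt_trans h).
apply/eqP; rewrite -normr_le0; apply/ler_addgt0Pl => e e0; rewrite addr0.
have [r r0 Hr] := defect_thin x0 c0 cd e0.
pose a' := Order.max a (x0 - r / 2); pose b' := Order.min b (x0 + r / 2).
have aa' : a <= a' by rewrite le_max lexx.
have b'b : b' <= b by rewrite ge_min lexx.
have a'x : a' <= x0 by rewrite ge_max ax/=; lra.
have xb' : x0 <= b' by rewrite le_min xb/=; lra.
have a'r : x0 - r < a' by rewrite lt_max; apply/orP; right; lra.
have b'r : b' < x0 + r by rewrite gt_min; apply/orP; right; lra.
have a'b' : a' <= b' by exact: le_trans xb'.
rewrite (@defect_splitx a')// ?(le_trans a'b')// (@defect_splitx b' a')//.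
have -> : defect a a' c d = 0.
  rewrite /a'; case: (leP a (x0 - r / 2)) => h; last exact: defect_degenerate.
  by apply: green => // x y /andP[h1 h2] hy; apply: H => //; [apply/andP; split => //|rewrite lt_eqF//]; lra.
have -> : defect b' b c d = 0.
  rewrite /b'; case: (leP b (x0 + r / 2)) => h; first exact: defect_degenerate.
  by apply: green => //; [exact: ltW|] => x y /andP[h1 h2] hy; apply: H => //; [apply/andP; split => //|rewrite gt_eqF//]; lra.
by rewrite add0r addr0; exact: Hr.
Qed.

End Green.

(** * Wirtinger derivatives *)

Section ComplexCalculus.
Context {R : realType}.
Local Notation N := (@Normc.normc R).
Implicit Types (z w al be : R[i]) (V : R[i] -> R[i]).

Lemma norm_normc z : `|z| = (N z)%:C. Proof. by []. Qed.

Lemma normc_ge0 z : 0 <= N z. Proof. by case: z => a b; exact: sqrtr_ge0. Qed.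

Lemma normcD z w : N (z + w) <= N z + N w. Proof. exact: le_normcD. Qed.

Lemma normc_opp z : N (- z) = N z. Proof. exact: normcN. Qed.

Lemma normcB z w : N (z - w) <= N z + N w. Proof. by rewrite -(normc_opp w); exact: normcD. Qed.

Lemma normc_distC z w : N (z - w) = N (w - z). Proof. by rewrite -normc_opp opprB. Qed.

Lemma normc_real (x : R) : N x%:C = `|x|.
Proof. by rewrite /= expr0n /= addr0 sqrtr_sqr. Qed.

Lemma normc_conj z : N (z^*)%C = N z.
Proof. by case: z => a b /=; rewrite sqrrN. Qed.

Lemma normc_eq0 z : (N z == 0) = (z == 0).
Proof. by apply/eqP/eqP => [/Normc.eq0_normc//|->]; rewrite Normc.normc0. Qed.

Lemma normc_gt0 z : (0 < N z) = (z != 0).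
Proof. by rewrite lt_def normc_eq0 normc_ge0 andbT. Qed.

Lemma ler_normc_Re z : `|complex.Re z| <= N z.
Proof. by case: z => a b /=; rewrite -sqrtr_sqr ler_sqrt ?addr_ge0 ?sqr_ge0// lerDl sqr_ge0. Qed.

Lemma ler_normc_Im z : `|complex.Im z| <= N z.
Proof. by case: z => a b /=; rewrite -sqrtr_sqr ler_sqrt ?addr_ge0 ?sqr_ge0// lerDr sqr_ge0. Qed.

Lemma normc_le_ReIm z : N z <= `|complex.Re z| + `|complex.Im z|.
Proof.
case: z => a b /=; rewrite -[leRHS]ger0_norm ?addr_ge0//.
rewrite -sqrtr_sqr ler_sqrt ?sqr_ge0// sqrrD !real_normK ?num_real//.
by have := mulr_ge0 (normr_ge0 a) (normr_ge0 b); lra.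
Qed.

Lemma complex_ReB z w : complex.Re (z - w) = complex.Re z - complex.Re w.
Proof. by case: z; case: w. Qed.

Lemma complex_ImB z w : complex.Im (z - w) = complex.Im z - complex.Im w.
Proof. by case: z; case: w. Qed.

(** Real differentiability of a complex function, written in complex form:
    [al] and [be] are its derivatives with respect to [z] and to the
    conjugate of [z], and [be = 0] is complex differentiability. Functions
    such as [|f|^p] thus get the same product and chain rules as
    holomorphic ones. *)
Definition wirtinger V z al be := forall e, 0 < e -> exists2 r, 0 < r & forall w, N w < r ->
  N (V (z + w) - V z - (al * w + be * (w^*)%C)) <= e * N w.

Definition ccont V z := forall e, 0 < e -> exists2 r, 0 < r & forall w, N w < r ->
  N (V (z + w) - V z) < e.

Lemma lin_bound al be w : N (al * w + be * (w^*)%C) <= (N al + N be) * N w.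
Proof. by rewrite (le_trans (normcD _ _))// !Normc.normcM normc_conj mulrDl. Qed.

Lemma wirtinger_lip V z al be : wirtinger V z al be -> exists2 r, 0 < r & forall w, N w < r ->
  N (V (z + w) - V z) <= (N al + N be + 1) * N w.
Proof.
move=> /(_ _ ltr01)[r r0 H]; exists r => // w /H h.
have -> : V (z + w) - V z = (V (z + w) - V z - (al * w + be * (w^*)%C)) + (al * w + be * (w^*)%C) by ring.
apply: le_trans (normcD _ _) _; rewrite mul1r in h.
by rewrite mulrDl mul1r addrC; apply: lerD => //; exact: lin_bound.
Qed.

Lemma wirtinger_ccont V z al be : wirtinger V z al be -> ccont V z.
Proof.
move=> /wirtinger_lip[r r0 H] e e0; set A := N al + N be + 1 in H.
have A0 : 0 < A by rewrite /A ltr_wpDl// addr_ge0 ?normc_ge0.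
exists (Order.min r (e / A)); first by rewrite lt_min r0 divr_gt0.
move=> w; rewrite lt_min => /andP[/H h1]; rewrite ltr_pdivlMr// mulrC => h2.
exact: le_lt_trans h2.
Qed.

Lemma wirtinger_ext V U z al be al' be' : wirtinger V z al be -> al = al' -> be = be' ->
  (exists2 r, 0 < r & forall w, N w < r -> U (z + w) = V (z + w)) ->
  wirtinger U z al' be'.
Proof.
move=> H <- <- [s s0 Hs] e /H[r r0 Hr]; exists (Order.min r s); first by rewrite lt_min r0.
move=> w; rewrite lt_min => /andP[/Hr + /Hs ->].
by have := Hs 0; rewrite addr0 Normc.normc0 => /(_ s0) ->.
Qed.

Lemma wirtinger_eq V U z al be al' be' : wirtinger V z al be -> U =1 V -> al = al' -> be = be' ->
  wirtinger U z al' be'.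
Proof. by move=> H e ? ?; apply: wirtinger_ext H _ _ _ => //; exists 1. Qed.

Lemma wirtinger_cst (c : R[i]) z : wirtinger (fun=> c) z 0 0.
Proof.
by move=> e e0; exists 1 => // w _; rewrite subrr !mul0r addr0 subrr Normc.normc0 mulr_ge0 ?normc_ge0 ?ltW.
Qed.

Lemma wirtinger_id z : wirtinger id z 1 0.
Proof.
move=> e e0; exists 1 => // w _ /=; rewrite mul1r mul0r addr0.
by rewrite [X in N X](_ : _ = 0) ?Normc.normc0 ?mulr_ge0 ?normc_ge0 ?ltW//; ring.
Qed.

Lemma wirtinger_conj V z al be : wirtinger V z al be -> wirtinger (fun z => (V z)^*)%C z (be^*)%C (al^*)%C.
Proof.
move=> H e /H[r r0 Hr]; exists r => // w /Hr; rewrite -normc_conj.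
rewrite (_ : conjc _ = (V (z + w))^*%C - (V z)^*%C - (be^*%C * w + al^*%C * w^*%C))//.
by rewrite !rmorphB rmorphD !rmorphM /= conjcK; ring.
Qed.

Lemma wirtingerD V1 V2 z a1 b1 a2 b2 : wirtinger V1 z a1 b1 -> wirtinger V2 z a2 b2 ->
  wirtinger (fun z => V1 z + V2 z) z (a1 + a2) (b1 + b2).
Proof.
move=> H1 H2 e e0; have e20 : 0 < e / 2 by rewrite divr_gt0.
have [r1 r10 h1] := H1 _ e20; have [r2 r20 h2] := H2 _ e20.
exists (Order.min r1 r2); first by rewrite lt_min r10.
move=> w; rewrite lt_min => /andP[/h1 {}h1 /h2 {}h2].
rewrite [X in N X](_ : _ = (V1 (z + w) - V1 z - (a1 * w + b1 * w^*%C)) +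
  (V2 (z + w) - V2 z - (a2 * w + b2 * w^*%C))); last by ring.
by apply: le_trans (normcD _ _) _; rewrite [e]splitr mulrDl lerD.
Qed.

Lemma wirtingerM V1 V2 z a1 b1 a2 b2 : wirtinger V1 z a1 b1 -> wirtinger V2 z a2 b2 ->
  wirtinger (fun z => V1 z * V2 z) z (a1 * V2 z + V1 z * a2) (b1 * V2 z + V1 z * b2).
Proof.
move=> H1 H2 e e0.
(* C bounds the cofactors of the two remainders; the product of the
   increments is controlled by the Lipschitz constants A and B. *)
pose C := N (V1 z) + (N (V2 z) + 1) + 1.
have [n1 n2] : 0 <= N (V1 z) /\ 0 <= N (V2 z) by rewrite !normc_ge0.
have C0 : 0 < C by rewrite /C; lra.
have e' : 0 < e / (2 * C) by rewrite divr_gt0// mulr_gt0.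
have [r1 r10 h1] := H1 _ e'; have [r2 r20 h2] := H2 _ e'.
have [s1 s10 c1] := wirtinger_lip H1.
pose A := (N a1 + N b1 + 1).
pose B := (N a2 + N b2 + 1).
have A0 : 0 < A by rewrite /A ltr_wpDl// addr_ge0 ?normc_ge0.
have B0 : 0 < B by rewrite /B ltr_wpDl// addr_ge0 ?normc_ge0.
have [s2 s20 c2] := wirtinger_lip H2.
pose r := Order.min (Order.min r1 r2) (Order.min (Order.min s1 s2) (e / (2 * A * B))).
exists r; first by rewrite !lt_min r10 r20 s10 s20 divr_gt0// !mulr_gt0.
move=> w; rewrite !lt_min => /andP[/andP[/h1 {}h1 /h2 {}h2] /andP[/andP[/c1 {}c1 /c2 {}c2]]].
rewrite ltr_pdivlMr ?mulr_gt0// => wAB.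
set L1 := a1 * w + b1 * _ in h1 *; set L2 := a2 * w + b2 * _ in h2 *.
rewrite [X in N X](_ : _ = (V1 (z + w) - V1 z - L1) * V2 z + V1 z * (V2 (z + w) - V2 z - L2)
  + (V1 (z + w) - V1 z) * (V2 (z + w) - V2 z)); last by rewrite /L1 /L2; ring.
apply: le_trans (normcD _ _) _; apply: le_trans (lerD (normcD _ _) (lexx _)) _.
rewrite !Normc.normcM -/A -/B in c1 c2 *.
have n0 := normc_ge0 w.
have t1 : N (V1 (z + w) - V1 z - L1) * N (V2 z) <= e / (2 * C) * N w * N (V2 z).
  by rewrite ler_wpM2r.
have t2 : N (V1 z) * N (V2 (z + w) - V2 z - L2) <= N (V1 z) * (e / (2 * C) * N w).
  by rewrite ler_wpM2l.
have t3 : N (V1 (z + w) - V1 z) * N (V2 (z + w) - V2 z) <= A * N w * (B * N w).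
  by apply: ler_pM => //; exact: normc_ge0.
have t4 : A * N w * (B * N w) <= e / 2 * N w.
  by rewrite mulrA ler_wpM2r// ler_pdivlMr//; lra.
have t5 : e / (2 * C) * (N (V1 z) + N (V2 z)) * N w <= e / 2 * N w.
  rewrite ler_wpM2r// invfM mulrA -[leRHS]mulr1 -mulrA ler_pM2l ?divr_gt0//.
  by rewrite mulrC ler_pdivrMr// mul1r /C; lra.
lra.
Qed.

Lemma wirtingerB V1 V2 z a1 b1 a2 b2 : wirtinger V1 z a1 b1 -> wirtinger V2 z a2 b2 ->
  wirtinger (fun z => V1 z - V2 z) z (a1 - a2) (b1 - b2).
Proof.
move=> H1 H2; have := wirtingerD H1 (wirtingerM (wirtinger_cst (-1) z) H2).
by move=> H; apply: wirtinger_eq H _ _ _ => [u||] /=; ring.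
Qed.

Lemma wirtinger_inv z : z != 0 -> wirtinger (fun w => w^-1) z (- z ^- 2) 0.
Proof.
move=> z0 e e0; have nz : 0 < N z by rewrite normc_gt0.
exists (Order.min (N z / 2) (e * N z ^+ 3 / 2)).
  by rewrite lt_min !divr_gt0// mulr_gt0// exprn_gt0.
move=> w; rewrite lt_min => /andP[w1 w2].
have zw : N z / 2 < N (z + w).
  have := normcB (z + w) w; rewrite addrK; lra.
have zw0 : z + w != 0 by rewrite -normc_gt0; lra.
rewrite [X in N X](_ : _ = w * w * (z^-1 * z^-1 * (z + w)^-1)); last by field; rewrite zw0 z0.
rewrite !Normc.normcM !Normc.normcV mulrAC; apply: ler_wpM2r; first exact: normc_ge0.
rewrite -!invfM ler_pdivrMr; last by rewrite !mulr_gt0//; lra.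
have : e * (N z * N z * (N z / 2)) <= e * (N z * N z * N (z + w)).
  by rewrite ler_pM2l// ler_pM2l ?mulr_gt0// ltW.
by apply: le_trans; move: w2; rewrite !exprS expr0; lra.
Qed.

Lemma wirtinger_shift V z z0 al be : wirtinger V (z - z0) al be -> wirtinger (fun z => V (z - z0)) z al be.
Proof.
move=> H e /H[r r0 Hr]; exists r => // w /Hr.
by rewrite (_ : z + w - z0 = z - z0 + w)//; ring.
Qed.

(** The real derivative, in the increment form that composes with
    [wirtinger]. *)
Definition rdiff (rho : R -> R) (s d : R) := forall e, 0 < e -> exists2 r, 0 < r & forall t, `|t| < r ->
   `|rho (s + t) - rho s - d * t| <= e * `|t|.

Lemma is_derive_rdiff (rho : R -> R) (s d : R) : is_derive s 1 rho d -> rdiff rho s d.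
Proof.
move=> [dr dE] e e0.
have /cvgrPdist_le/(_ _ e0)/nbhs_ballP[r /= r0 Hr] := dr.
exists r => // t tr; have [->|t0] := eqVneq t 0.
  by rewrite addr0 subrr mulr0 subrr normr0 mulr0.
have := Hr t; rewrite -ball_normE /ball_ /= sub0r normrN => /(_ tr t0).
rewrite -[lim _]/('D_1 rho s) dE /GRing.scale /= mulr1 (addrC t) => h.
rewrite -ler_pdivrMr ?normr_gt0// -normrV ?unitfE// -normrM -normrN.
by apply: le_trans h; rewrite le_eqVlt; apply/orP; left; apply/eqP; congr `|_|; field.
Qed.

Lemma wirtinger_real_comp (S rho : R[i] -> R) (r : R -> R) d z al be :
  wirtinger (fun z => (S z)%:C) z al be -> rdiff r (S z) d ->
  (forall z, rho z = r (S z)) ->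
  wirtinger (fun z => (rho z)%:C) z (d%:C * al) (d%:C * be).
Proof.
move=> HS Hr rhoE e e0; pose A := N al + N be + 1.
have A0 : 0 < A by rewrite /A ltr_wpDl// addr_ge0 ?normc_ge0.
have eA : 0 < e / (2 * A) by rewrite divr_gt0// mulr_gt0.
have D0 : 0 < `|d| + 1 by rewrite ltr_wpDl.
have eD : 0 < e / (2 * (`|d| + 1)) by rewrite divr_gt0// mulr_gt0.
have [r1 r10 h1] := Hr _ eA.
have [r2 r20 h2] := HS _ eD.
have [r3 r30 h3] := wirtinger_lip HS.
exists (Order.min r2 (Order.min r3 (r1 / A))); first by rewrite !lt_min r20 r30 divr_gt0.
move=> w; rewrite !lt_min => /andP[/h2 {}h2 /andP[/h3 {}h3]]; rewrite ltr_pdivlMr// => wA.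
rewrite -/A -rmorphB normc_real in h3.
have {}h1 := h1 _ (le_lt_trans h3 (eq_ind _ (fun x => x < r1) wA _ (mulrC _ _))).
rewrite !rhoE; rewrite (_ : S z + (S (z + w) - S z) = S (z + w)) in h1; last by ring.
rewrite [X in N X](_ : _ = (r (S (z + w)) - r (S z) - d * (S (z + w) - S z))%:C +
   d%:C * ((S (z + w))%:C - (S z)%:C - (al * w + be * w^*%C))); last first.
  by rewrite !rmorphB !rmorphM !rmorphB /=; ring.
apply: le_trans (normcD _ _) _; rewrite Normc.normcM !normc_real.
have n0 := normc_ge0 w.
have t1 : e / (2 * A) * `|S (z + w) - S z| <= e / 2 * N w.
  apply: le_trans (ler_wpM2l (ltW eA) h3) _.
  by rewrite le_eqVlt; apply/orP; left; apply/eqP; field; rewrite gt_eqF.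
have t2 : `|d| * (e / (2 * (`|d| + 1)) * N w) <= e / 2 * N w.
  rewrite mulrA ler_wpM2r//.
  have -> : e / 2 = e / (2 * (`|d| + 1)) * (`|d| + 1) by field; rewrite gt_eqF.
  by rewrite mulrC ler_wpM2l ?ltW// ltrDl.
have t3 : `|d| * N ((S (z + w))%:C - (S z)%:C - (al * w + be * w^*%C)) <=
  `|d| * (e / (2 * (`|d| + 1)) * N w) by exact: ler_wpM2l.
lra.
Qed.

(** The Cauchy-Riemann operator read as a divergence; this is how a
    Wirtinger derivative enters Green's formula. *)
Lemma wirtinger_divergence V (D : R -> R -> R) x y al be : wirtinger V (x +i* y) al be ->
  D x y = 2 * complex.Re be ->
  has_divergence (fun x y => complex.Re (V (x +i* y))) (fun x y => - complex.Im (V (x +i* y))) D x y.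
Proof.
case: al be => [a1 a2] [b1 b2] H DE /=.
exists (a1 + b1), (b2 - a2), (- (a2 + b2)), (b1 - a1); split.
  by rewrite DE /=; ring.
move=> e e0; have [r r0 Hr] := H e e0; exists (r / 2); first by rewrite divr_gt0.
move=> x' y' hx hy; pose w := (x' - x) +i* (y' - y).
have wle := normc_le_ReIm w; rewrite /= in wle.
have wr : N w < r by apply: le_lt_trans wle _; lra.
have e0' : e * N w <= e * (`|x' - x| + `|y' - y|).
  exact: ler_wpM2l (ltW e0) _ _ wle.
have {Hr}h := le_trans (Hr _ wr) e0'.
have wE : x +i* y + w = x' +i* y' by apply/eqP; rewrite eq_complex /= ![_ + (_ - _)]addrC !subrK !eqxx.
rewrite wE in h.
split.
  apply: le_trans (le_trans (ler_normc_Re _) h).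
  rewrite le_eqVlt; apply/orP; left; apply/eqP; congr `|_|.
  by case: (V _) => u1 u2; case: (V _) => v1 v2 /=; ring.
apply: le_trans (le_trans (ler_normc_Im _) h).
rewrite le_eqVlt; apply/orP; left; rewrite -normrN; apply/eqP; congr `|_|.
by case: (V _) => u1 u2; case: (V _) => v1 v2 /=; ring.
Qed.

Definition rcont (S : R[i] -> R) z := forall e, 0 < e -> exists2 r, 0 < r & forall w, N w < r ->
  `|S (z + w) - S z| < e.

Lemma ccont_Re V z : ccont V z -> rcont (fun z => complex.Re (V z)) z.
Proof.
move=> H e /H[r r0 Hr]; exists r => // w /Hr; apply: le_lt_trans.
by apply: le_trans (ler_normc_Re _); case: (V (_ + _)) => ? ?; case: (V z).
Qed.

Lemma ccont_Im V z : ccont V z -> rcont (fun z => complex.Im (V z)) z.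
Proof.
move=> H e /H[r r0 Hr]; exists r => // w /Hr; apply: le_lt_trans.
by apply: le_trans (ler_normc_Im _); case: (V (_ + _)) => ? ?; case: (V z).
Qed.

Lemma ccont_norm V z : ccont V z -> rcont (fun z => N (V z)) z.
Proof.
move=> H e /H[r r0 Hr]; exists r => // w /Hr; apply: le_lt_trans.
rewrite ler_norml; apply/andP; split.
  by have := normcB (V (z + w)) (V (z + w) - V z); rewrite subKr; lra.
by have := normcD (V (z + w) - V z) (V z); rewrite subrK; lra.
Qed.

Lemma rcont_cont2 (S : R[i] -> R) : (forall z, 0 < complex.Im z -> rcont S z) ->
  cont2 (fun x y => S (x +i* y)).
Proof.
move=> H x y y0; apply/cvgrPdist_lt => e e0.
have [r r0 Hr] := H (x +i* y) y0 _ e0.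
have r2 : 0 < r / 2 by rewrite divr_gt0.
exists (ball x (r / 2), ball y (r / 2)) => [|[x' y'] [/=]].
  by split; exact: nbhsx_ballx.
rewrite -!ball_normE /ball_ /= => hx hy; rewrite distrC.
pose w := (x' - x) +i* (y' - y).
have wE : x +i* y + w = x' +i* y' by apply/eqP; rewrite eq_complex /= ![_ + (_ - _)]addrC !subrK !eqxx.
have := Hr w; rewrite wE; apply; apply: le_lt_trans (normc_le_ReIm _) _.
by rewrite /= distrC (distrC y'); lra.
Qed.

Lemma rcont_comp (S : R[i] -> R) (r : R -> R) z : rcont S z -> {for S z, continuous r} ->
  rcont (fun z => r (S z)) z.
Proof.
move=> HS Hr e e0; have /cvgrPdist_lt/(_ _ e0)/nbhs_ballP[s /= s0 Hs] := Hr.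
have [t t0 Ht] := HS _ s0; exists t => // w /Ht h; rewrite distrC; apply: Hs.
by rewrite -ball_normE /ball_ /= distrC.
Qed.

Lemma rcontM (S T : R[i] -> R) z : rcont S z -> rcont T z -> rcont (fun z => S z * T z) z.
Proof.
move=> HS HT e e0.
pose C := `|S z| + `|T z| + 1; have n1 := normr_ge0 (S z); have n2 := normr_ge0 (T z).
have C0 : 0 < C by rewrite /C; lra.
pose d := Order.min 1 (e / (2 * C)).
have d0 : 0 < d by rewrite lt_min ltr01 divr_gt0// mulr_gt0.
have d1 : d <= 1 by rewrite ge_min lexx.
have dC : d <= e / (2 * C) by rewrite ge_min lexx orbT.
have [r r0 Hr] := HS _ d0; have [s s0 Hs] := HT _ d0.
exists (Order.min r s); first by rewrite lt_min r0.
move=> w; rewrite lt_min => /andP[/Hr h1 /Hs h2].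
have -> : S (z + w) * T (z + w) - S z * T z = (S (z + w) - S z) * (T (z + w) - T z) +
   (S (z + w) - S z) * T z + S z * (T (z + w) - T z) by ring.
have b1 : `|(S (z + w) - S z) * (T (z + w) - T z)| <= d * 1.
  by rewrite normrM ler_pM// ltW// (lt_le_trans h2).
have b2 : `|(S (z + w) - S z) * T z| <= d * `|T z| by rewrite normrM ler_wpM2r// ltW.
have b3 : `|S z * (T (z + w) - T z)| <= d * `|S z| by rewrite normrM mulrC ler_wpM2r// ltW.
apply: le_lt_trans (ler_normD _ _) _.
have := ler_normD ((S (z + w) - S z) * (T (z + w) - T z)) ((S (z + w) - S z) * T z).
have : d * C <= e / 2.
  apply: le_trans (ler_wpM2r (ltW C0) dC) _; rewrite invfM mulrA divfK ?gt_eqF//.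
rewrite /C; lra.
Qed.

Lemma ccontM V U z : ccont V z -> ccont U z -> ccont (fun z => V z * U z) z.
Proof.
move=> HS HT e e0.
pose C := N (V z) + N (U z) + 1; have n1 := normc_ge0 (V z); have n2 := normc_ge0 (U z).
have C0 : 0 < C by rewrite /C; lra.
pose d := Order.min 1 (e / (2 * C)).
have d0 : 0 < d by rewrite lt_min ltr01 divr_gt0// mulr_gt0.
have d1 : d <= 1 by rewrite ge_min lexx.
have dC : d <= e / (2 * C) by rewrite ge_min lexx orbT.
have [r r0 Hr] := HS _ d0; have [s s0 Hs] := HT _ d0.
exists (Order.min r s); first by rewrite lt_min r0.
move=> w; rewrite lt_min => /andP[/Hr h1 /Hs h2].
have -> : V (z + w) * U (z + w) - V z * U z = (V (z + w) - V z) * (U (z + w) - U z) +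
   (V (z + w) - V z) * U z + V z * (U (z + w) - U z) by ring.
have b1 : N ((V (z + w) - V z) * (U (z + w) - U z)) <= d * 1.
  by rewrite Normc.normcM ler_pM ?normc_ge0// ltW// (lt_le_trans h2).
have b2 : N ((V (z + w) - V z) * U z) <= d * N (U z) by rewrite Normc.normcM ler_wpM2r// ltW.
have b3 : N (V z * (U (z + w) - U z)) <= d * N (V z) by rewrite Normc.normcM mulrC ler_wpM2r// ltW.
apply: le_lt_trans (normcD _ _) _.
have := normcD ((V (z + w) - V z) * (U (z + w) - U z)) ((V (z + w) - V z) * U z).
have : d * C <= e / 2.
  apply: le_trans (ler_wpM2r (ltW C0) dC) _; rewrite invfM mulrA divfK ?gt_eqF//.
rewrite /C; lra.
Qed.

Lemma rcont_eq (S T : R[i] -> R) z : rcont S z -> S =1 T -> rcont T z.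
Proof. by move=> H e; move/funext: e => <-. Qed.

Lemma rcont_wirtinger (S : R[i] -> R) z al be : wirtinger (fun z => (S z)%:C) z al be -> rcont S z.
Proof. by move=> /wirtinger_ccont/ccont_Re. Qed.

Lemma holomorphic_wirtinger (f : R[i] -> R[i]) z : derivable (f : R[i]^o -> R[i]^o) z 1 ->
  exists l, wirtinger f z l 0.
Proof.
move=> /cvg_ex[l df]; exists l => e e0.
have eC : 0 < (e%:C : R[i]) by rewrite ltcR.
have /cvgrPdist_le/(_ _ eC)/nbhs_ballP[r /= r0 Hr] := df.
have [r' r'0 rE] : exists2 r' : R, 0 < r' & r = r'%:C.
  by move: r0; case: r {Hr} => a b; rewrite ltcE /= => /andP[/eqP -> a0]; exists a.
exists r' => // w wr; have [->|w0] := eqVneq w 0.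
  by rewrite conjc0 !mulr0 !addr0 subrr subr0 Normc.normc0 mulr0.
have := Hr w; rewrite -ball_normE /ball_ /= sub0r normrN rE norm_normc ltcR => /(_ wr w0).
rewrite norm_normc lecR /GRing.scale /= mulr1 (addrC w) => h.
rewrite mul0r addr0 -ler_pdivrMr ?normc_gt0// -Normc.normcV -Normc.normcM -normc_opp.
by apply: le_trans h; rewrite le_eqVlt; apply/orP; left; apply/eqP; congr (N _); field.
Qed.

End ComplexCalculus.

(** * Estimates for double integrals *)

Section DoubleIntegrals.
Context {R : realType}.
Local Notation mu := (@lebesgue_measure R).
Implicit Types (a b c d x y : R) (g h : R -> R -> R).

Lemma cont2M g h : cont2 g -> cont2 h -> cont2 (fun x y => g x y * h x y).
Proof. by move=> cg ch x y y0; apply: cvgM; [exact: cg|exact: ch]. Qed.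

Lemma cont2B g h : cont2 g -> cont2 h -> cont2 (fun x y => g x y - h x y).
Proof. by move=> cg ch x y y0; apply: cvgB; [exact: cg|exact: ch]. Qed.

Lemma cont2_cst (k : R) : cont2 (fun _ _ => k).
Proof. by move=> x y _; apply: cvg_cst. Qed.

Lemma cont2_norm g : cont2 g -> cont2 (fun x y => `|g x y|).
Proof. by move=> cg x y y0; apply: cvg_norm; exact: cg. Qed.

Lemma dintZ k a b c d g : 0 < c -> cont2 g ->
  dint a b c d (fun x y => k * g x y) = k * dint a b c d g.
Proof.
move=> c0 cg; rewrite /dint -RintegralZl//; last exact/cts_on_integrable/cont2_int_cts.
apply: eq_Rintegral => x _; rewrite RintegralZl//; exact/cts_on_integrable/cont2_cts_y.
Qed.

Lemma dint_cst k a b c d : a <= b -> c <= d ->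
  dint a b c d (fun _ _ => k) = k * (d - c) * (b - a).
Proof.
move=> ab cd; rewrite /dint; under eq_Rintegral do rewrite (itv_int_cst _ cd).
by rewrite (itv_int_cst _ ab).
Qed.

Lemma eq_dint a b c d g h : (forall x y, a <= x <= b -> c <= y <= d -> g x y = h x y) ->
  dint a b c d g = dint a b c d h.
Proof.
move=> gh; apply: eq_Rintegral => x; rewrite inE/= in_itv/= => hx.
by apply: eq_Rintegral => y; rewrite inE/= in_itv/= => hy; exact: gh.
Qed.

Lemma dint_ge0 a b c d g : (forall x y, a <= x <= b -> c <= y <= d -> 0 <= g x y) ->
  0 <= dint a b c d g.
Proof.
move=> g0; apply: Rintegral_ge0 => x; rewrite /= in_itv/= => hx.
by apply: Rintegral_ge0 => y; rewrite /= in_itv/= => hy; exact: g0.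
Qed.

Lemma dint_weighted C a b c d g h : 0 < c -> cont2 g -> cont2 h ->
  (forall x y, a <= x <= b -> c <= y <= d -> `|g x y| <= C) ->
  `|dint a b c d (fun x y => g x y * h x y)| <= C * dint a b c d (fun x y => `|h x y|).
Proof.
move=> c0 cg ch gC; rewrite ler_norml -mulNr -!dintZ//; try exact: cont2_norm.
have cgh := cont2M cg ch; have cah := cont2_norm ch.
apply/andP; split; apply: le_dint => //; try by apply: cont2M => //; exact: cont2_cst.
- move=> x y hx hy; rewrite mulNr lerNl (le_trans (ler_norm _))// normrN normrM.
  by rewrite ler_wpM2r ?gC.
- by move=> x y hx hy; rewrite (le_trans (ler_norm _))// normrM ler_wpM2r ?gC.
Qed.

Lemma dint_sub a b c d a' b' c' d' g : a <= a' -> a' <= b' -> b' <= b ->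
  c <= c' -> c' <= d' -> d' <= d -> 0 < c -> cont2 g ->
  (forall x y, a <= x <= b -> c <= y <= d -> 0 <= g x y) ->
  dint a' b' c' d' g <= dint a b c d g.
Proof.
move=> aa' ab' bb' cc' cd' dd' c0 cg g0.
have c'0 : 0 < c' by exact: lt_le_trans cc'.
have d'0 : 0 < d' by exact: lt_le_trans cd'.
have a'b : a' <= b by exact: le_trans bb'.
have c'd : c' <= d by exact: le_trans dd'.
have P (u v s t : R) : a <= u -> v <= b -> c <= s -> t <= d -> 0 <= dint u v s t g.
  move=> au vb cs td; apply: dint_ge0 => x y /andP[? ?] /andP[? ?].
  by apply: g0; apply/andP; split; [exact: le_trans au _|exact: le_trans vb|exact: le_trans cs _|exact: le_trans td].
rewrite (dint_splitx _ aa' a'b)// (dint_splitx _ ab' bb')// (dint_splity a' b' cc' c'd)//.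
rewrite (dint_splity a' b' cd' dd')//.
have q1 : 0 <= dint a a' c d g by apply: P.
have q2 : 0 <= dint a' b' c c' g by apply: P.
have q3 : 0 <= dint a' b' d' d g by apply: P => //; exact: le_trans cd'.
have q4 : 0 <= dint b' b c d g by apply: P => //; exact: le_trans ab'.
move: q1 q2 q3 q4; move: (dint a a' c d g) (dint a' b' c c' g) (dint a' b' d' d g) (dint b' b c d g) (dint _ _ _ _ _).
by move=> *; lra.
Qed.
End DoubleIntegrals.

(** * A mean value property of holomorphic functions *)

Section MeanValue.
Context {R : realType}.
Local Notation N := (@Normc.normc R).
Implicit Types (z w : R[i]) (f : R[i] -> R[i]).

Definition holo_uhp f := forall z, 0 < complex.Im z -> exists l, wirtinger f z l 0.

(** A truncated paraboloid, supported in the disc of radius [r] around [z];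
    it serves as averaging weight because it is Lipschitz in the centre
    [z]. *)
Definition cap (r : R) z w : R := Order.max 0 (r ^+ 2 - N (w - z) ^+ 2).

Lemma sqr_normc_conj z : (N z ^+ 2)%:C = z * (z^*)%C.
Proof. by rewrite -sqr_normc norm_normc rmorphXn. Qed.

Lemma sqr_normcE z : N z ^+ 2 = complex.Re z ^+ 2 + complex.Im z ^+ 2.
Proof. by case: z => a b /=; rewrite sqr_sqrtr// addr_ge0// sqr_ge0. Qed.

Lemma wirtinger_sqnorm r z w : wirtinger (fun w => (r ^+ 2 - N (w - z) ^+ 2)%:C) w (- (w - z)^*%C) (- (w - z)).
Proof.
have h1 : wirtinger (fun u => u - z) w (1 - 0) (0 - 0) by exact: wirtingerB (wirtinger_id w) (wirtinger_cst z w).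
have h2 := wirtingerB (wirtinger_cst (r ^+ 2)%:C w) (wirtingerM h1 (wirtinger_conj h1)).
refine (wirtinger_eq h2 _ _ _) => [u||].
- by rewrite rmorphB -sqr_normc_conj.
- by rewrite !subr0 conjc0; ring.
- by rewrite !subr0 conjc1; ring.
Qed.

(** Squaring removes the kink of the hinge [max 0]. *)
Lemma rdiff_hinge (t : R) : rdiff (fun t => - (Order.max 0 t ^+ 2) / 4) t (- Order.max 0 t / 2).
Proof.
move=> e e0; exists e => // h he.
apply: (@le_trans _ _ (`|h| * `|h|)); last by rewrite ler_wpM2r// ltW.
rewrite -expr2 real_normK ?num_real// ler_norml; apply/andP.
by case: (leP 0 t) => t0; case: (leP 0 (t + h)) => th0; split; nra.
Qed.

Lemma cap_rcont r z w : rcont (cap r z) w.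
Proof.
apply: (@rcont_comp _ (fun w => r ^+ 2 - N (w - z) ^+ 2) (Order.max 0)).
  exact: rcont_wirtinger (wirtinger_sqnorm r z w).
by apply: continuous_max; [exact: cvg_cst|exact: cvg_id].
Qed.

Lemma holo_rcont_Re f z : holo_uhp f -> 0 < complex.Im z -> rcont (fun z => complex.Re (f z)) z.
Proof. by move=> H /H[l Hl]; exact/ccont_Re/(wirtinger_ccont Hl). Qed.

(** With [T = - cap ^ 2 / 4], the derivative of [T] with respect to the
    conjugate of [w] is [(cap / 2) (w - z)]. Hence the field attached to [T
    w (f w - f z) / (w - z)] has divergence [cap (Re (f w) - Re (f z))],
    and it vanishes outside the disc, so its flux through the rectangle is
    zero. It is continuous at [z], but possibly not differentiable there. *)
Lemma mean_value f z r a b c d : holo_uhp f -> 0 < r -> 0 < c ->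
  a <= complex.Re z - r -> complex.Re z + r <= b ->
  c <= complex.Im z - r -> complex.Im z + r <= d ->
  dint a b c d (fun x y => cap r z (x +i* y) * (complex.Re (f (x +i* y)) - complex.Re (f z))) = 0.
Proof.
move=> hf r0 c0 az zb cz zd.
have ab : a <= b by lra.
have cd : c <= d by lra.
have z0 : 0 < complex.Im z by lra.
have [l0 Hl0] := hf z z0.
pose S w : R := r ^+ 2 - N (w - z) ^+ 2.
pose T w : R := - (Order.max 0 (S w) ^+ 2) / 4.
pose g w := if w == z then l0 else (f w - f z) * (w - z)^-1.
pose V w := (T w)%:C * g w.
have WT w : wirtinger (fun w => (T w)%:C) w ((- Order.max 0 (S w) / 2)%:C * - (w - z)^*%C)
     ((- Order.max 0 (S w) / 2)%:C * - (w - z)).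
  by apply: wirtinger_real_comp (wirtinger_sqnorm r z w) (rdiff_hinge _) _.
have Wg w : 0 < complex.Im w -> w != z -> exists al, wirtinger g w al 0.
  move=> w0 wz; have [l Hl] := hf w w0.
  have wz0 : w - z != 0 by rewrite subr_eq0.
  have h := wirtingerM (wirtingerB Hl (wirtinger_cst (f z) w)) (wirtinger_shift (wirtinger_inv wz0)).
  eexists; apply: wirtinger_ext h _ _ _ => [||]; [reflexivity|ring|].
  exists (N (w - z)); first by rewrite normc_gt0.
  move=> u uw; rewrite /g; case: eqP => // uz; exfalso; move: uw.
  by rewrite -uz opprD addNKr normc_opp ltxx.
have WV w : 0 < complex.Im w -> w != z -> exists al,
   wirtinger V w al ((cap r z w / 2)%:C * (f w - f z)).
  move=> w0 wz; have [l Hl] := Wg w w0 wz; eexists.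
  apply: wirtinger_eq (wirtingerM (WT w) Hl) _ _ _ => //; rewrite /g (negbTE wz) -/(cap r z w).
  set m := cap r z w; rewrite (_ : (- m / 2)%:C = - (m / 2)%:C); last by rewrite mulNr rmorphN.
  by field; rewrite subr_eq0.
have cV w : 0 < complex.Im w -> ccont V w.
  move=> w0; have [->|wz] := eqVneq w z; last by have [al /wirtinger_ccont] := WV w w0 wz.
  apply: ccontM; first exact: wirtinger_ccont (WT z).
  move=> e e0; have e20 : 0 < e / 2 by rewrite divr_gt0.
  have [s s0 Hs] := Hl0 _ e20; exists s => // u us; rewrite /g eqxx.
  case: eqP => [_|/eqP uz]; first by rewrite subrr Normc.normc0.
  have u0 : u != 0 by apply: contraNneq uz => ->; rewrite addr0.
  have -> : (f (z + u) - f z) * (z + u - z)^-1 - l0 = (f (z + u) - f z - (l0 * u + 0 * u^*%C)) / u.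
    rewrite (_ : z + u - z = u); last by ring.
    by field.
  rewrite Normc.normcM Normc.normcV ltr_pdivrMr ?normc_gt0//.
  by apply: le_lt_trans (Hs _ us) _; rewrite ltr_pM2r ?normc_gt0//; lra.
pose P x y := complex.Re (V (x +i* y)).
pose Q x y := - complex.Im (V (x +i* y)).
pose D x y := cap r z (x +i* y) * (complex.Re (f (x +i* y)) - complex.Re (f z)).
have cP : cont2 P.
  by apply: (@rcont_cont2 _ (fun w => complex.Re (V w))) => w /cV/ccont_Re.
have cQ : cont2 Q.
  have /= h : cont2 (fun x y => complex.Im (V (x +i* y))).
    by apply: (@rcont_cont2 _ (fun w => complex.Im (V w))) => w /cV/ccont_Im.
  by move=> x y y0; apply: cvgN; exact: h.
have cD : cont2 D.
  apply: cont2M; first by apply: (@rcont_cont2 _ (cap r z)) => w _; exact: cap_rcont.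
  apply: cont2B; last exact: cont2_cst.
  by apply: (@rcont_cont2 _ (fun w => complex.Re (f w))) => w w0; exact: holo_rcont_Re.
have V0 w : r <= `|complex.Re (w - z)| \/ r <= `|complex.Im (w - z)| -> V w = 0.
  move=> h; rewrite /V /T; suff -> : Order.max 0 (S w) = 0 by rewrite expr0n/= oppr0 mul0r mul0r.
  apply/max_idPl; rewrite /S subr_le0 ler_sqr ?nnegrE ?normc_ge0 ?(ltW r0)//.
  by case: h => /le_trans; apply; [exact: ler_normc_Re|exact: ler_normc_Im].
have /eqP : defect P Q D a b c d = 0.
  apply: (@green_except _ _ _ _ cP cQ cD (complex.Re z)) => // x y hx /andP[cy yd] xz.
  have y0 : 0 < y by exact: lt_le_trans cy.
  have wz : x +i* y != z by apply: contra_neq xz => <-.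
  have [al Hal] := WV (x +i* y) y0 wz.
  apply: wirtinger_divergence Hal _; rewrite /D.
  by case: (f (x +i* y)) => ? ?; case: (f z) => ? ? /=; field.
rewrite subr_eq0 => /eqP fl.
rewrite -/D -fl /flux.
rewrite (@eq_Rintegral _ _ _ _ _ (cst 0)) ?Rintegral_cst// ?mul0r ?add0r; last first.
    move=> y _; rewrite /P !V0 ?subrr//=; left.
      by rewrite complex_ReB ler_normr /=; apply/orP; right; lra.
    by rewrite complex_ReB ler_normr /=; apply/orP; left; lra.
rewrite (@eq_Rintegral _ _ _ _ _ (cst 0)) ?Rintegral_cst// ?mul0r//.
  move=> x _; rewrite /Q !V0 ?subrr//=; right.
    by rewrite complex_ImB ler_normr /=; apply/orP; right; lra.
  by rewrite complex_ImB ler_normr /=; apply/orP; left; lra.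
Qed.

End MeanValue.

(** * Local estimates for holomorphic functions and their derivatives *)

Section Estimates.
Context {R : realType}.
Local Notation N := (@Normc.normc R).
Implicit Types (z w h : R[i]) (f : R[i] -> R[i]).

Lemma cap_ge0 r z w : 0 <= cap r z w.
Proof. by rewrite le_max lexx. Qed.

Lemma cap_le r z w : cap r z w <= r ^+ 2.
Proof. by rewrite ge_max sqr_ge0/= gerBl sqr_ge0. Qed.

(** The hinge is a contraction, and a difference of squares factors. *)
Lemma cap_lip r z z' w :
  `|cap r z' w - cap r z w| <= N (z' - z) * (N (w - z') + N (w - z)).
Proof.
have h : `|(r ^+ 2 - N (w - z') ^+ 2) - (r ^+ 2 - N (w - z) ^+ 2)| <= N (z' - z) * (N (w - z') + N (w - z)).
  have -> : (r ^+ 2 - N (w - z') ^+ 2) - (r ^+ 2 - N (w - z) ^+ 2) =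
    (N (w - z) - N (w - z')) * (N (w - z') + N (w - z)) by ring.
  rewrite normrM [X in _ * X <= _]ger0_norm ?addr_ge0 ?normc_ge0//.
  rewrite ler_wpM2r ?addr_ge0 ?normc_ge0// ler_norml; apply/andP; split.
    have := normcB (w - z) (z' - z); rewrite (_ : w - z - (z' - z) = w - z'); last by ring.
    lra.
  have := normcD (w - z') (z' - z); rewrite (_ : w - z' + (z' - z) = w - z); last by ring.
  lra.
apply: le_trans h; rewrite /cap.
move: (r ^+ 2 - N (w - z') ^+ 2) (r ^+ 2 - N (w - z) ^+ 2) => a b.
case: (leP 0 a) => a0; case: (leP 0 b) => b0; rewrite ?subr0 ?sub0r ?normrN ?normr0 ?subrr//.
  by rewrite !ger0_norm //; lra.
by rewrite distrC !ger0_norm //; lra.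
Qed.

(** Integral over the square of half-side [2 r], which contains the discs
    of radius [r] around all points within [r] of [z]. *)
Definition box (r : R) z (g : R[i] -> R) :=
  dint (complex.Re z - 2 * r) (complex.Re z + 2 * r)
       (complex.Im z - 2 * r) (complex.Im z + 2 * r) (fun x y => g (x +i* y)).

Lemma box_dist r z x y : complex.Re z - 2 * r <= x <= complex.Re z + 2 * r ->
  complex.Im z - 2 * r <= y <= complex.Im z + 2 * r -> N (x +i* y - z) <= 4 * r.
Proof.
move=> /andP[h1 h2] /andP[h3 h4]; apply: le_trans (normc_le_ReIm _) _.
rewrite complex_ReB complex_ImB /=.
have t1 : `|x - complex.Re z| <= 2 * r by rewrite ler_norml; apply/andP; split; lra.
have t2 : `|y - complex.Im z| <= 2 * r by rewrite ler_norml; apply/andP; split; lra.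
lra.
Qed.

(** On the concentric square of side [r] the weight is at least [r ^ 2 /
    2]. *)
Lemma cap_mass r z a b c d : 0 < r -> 0 < c ->
  a <= complex.Re z - r -> complex.Re z + r <= b ->
  c <= complex.Im z - r -> complex.Im z + r <= d ->
  r ^+ 4 / 2 <= dint a b c d (fun x y => cap r z (x +i* y)).
Proof.
move=> r0 c0 az zb cz zd; set g := fun x y => _.
have cg : cont2 g by apply: (@rcont_cont2 _ (cap r z)) => w _; exact: cap_rcont.
pose a' := complex.Re z - r / 2; pose b' := complex.Re z + r / 2.
pose c' := complex.Im z - r / 2; pose d' := complex.Im z + r / 2.
have h : dint a' b' c' d' g <= dint a b c d g.
  by apply: dint_sub => //; rewrite /a' /b' /c' /d'; try lra; move=> x y _ _; exact: cap_ge0.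
apply: le_trans h.
have -> : r ^+ 4 / 2 = dint a' b' c' d' (fun _ _ => r ^+ 2 / 2).
  by rewrite dint_cst /a' /b' /c' /d'; [field|lra|lra].
apply: le_dint => //; [by rewrite /c'; lra|exact: cont2_cst|].
move=> x y /andP[h1 h2] /andP[h3 h4]; rewrite /g le_max; apply/orP; right.
rewrite sqr_normcE complex_ReB complex_ImB /=.
have t1 : (x - complex.Re z) ^+ 2 <= (r / 2) ^+ 2.
  by rewrite -ler_sqrt ?sqr_ge0// !sqrtr_sqr [leRHS]ger0_norm ?ler_norml; [apply/andP; split|]; rewrite /a' /b' in h1 h2 *; lra.
have t2 : (y - complex.Im z) ^+ 2 <= (r / 2) ^+ 2.
  by rewrite -ler_sqrt ?sqr_ge0// !sqrtr_sqr [leRHS]ger0_norm ?ler_norml; [apply/andP; split|]; rewrite /c' /d' in h3 h4 *; lra.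
rewrite expr_div_n in t1 t2; lra.
Qed.

(** If [v] is a quotient with denominator [A] bounded below, and if
    numerator and denominator are bounded and Lipschitz, so is [v]; [J] is
    the scale of the numerators and [n] the size of the displacement. *)
Lemma quotient_lipschitz (A0 A A' v v' K L M J n : R) : 0 < A0 -> A0 <= A -> A0 <= A' ->
  0 <= K -> 0 <= L -> 0 <= M -> 0 <= J -> 0 <= n ->
  `|v * A| <= K * J -> `|v' * A' - v * A| <= L * n * J -> `|A' - A| <= M * n ->
  `|v| <= (K / A0 + (L + K / A0 * M) / A0) * J /\
  `|v' - v| <= (K / A0 + (L + K / A0 * M) / A0) * n * J.
Proof.
move=> A00 hA hA' K0 L0 M0 J0 n0 h1 h2 h3.
have KA : 0 <= K / A0 by rewrite divr_ge0// ltW.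
have LA : 0 <= (L + K / A0 * M) / A0.
  by apply: divr_ge0 (ltW A00); apply: addr_ge0 => //; exact: mulr_ge0.
have hv : `|v| <= K / A0 * J.
  rewrite mulrAC ler_pdivlMr//; apply: le_trans h1; rewrite normrM ler_wpM2l//.
  by rewrite (le_trans hA)// ler_norm.
split; first by rewrite mulrDl (le_trans hv)// lerDl mulr_ge0.
have h4 : `|(v' - v) * A'| <= (L + K / A0 * M) * n * J.
  have -> : (v' - v) * A' = (v' * A' - v * A) - v * (A' - A) by ring.
  apply: le_trans (ler_normB _ _) _; rewrite normrM.
  have -> : (L + K / A0 * M) * n * J = L * n * J + K / A0 * J * (M * n) by ring.
  by apply: lerD => //; apply: ler_pM.
suff h5 : `|v' - v| <= (L + K / A0 * M) / A0 * n * J.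
  by rewrite 2!mulrDl (le_trans h5)// lerDr; exact: mulr_ge0 (mulr_ge0 KA n0) J0.
have -> : (L + K / A0 * M) / A0 * n * J = (L + K / A0 * M) * n * J / A0 by ring.
rewrite ler_pdivlMr//; apply: le_trans h4; rewrite normrM ler_wpM2l//.
by rewrite (le_trans hA')// ler_norm.
Qed.

(** By the mean value property [Re (f z)] and [Re (f (z + h))] are averages
    of [Re f] over the same square, with weights that differ by at most a
    multiple of [N h]. *)
Lemma holo_Re_estimate (r : R) : 0 < r -> exists2 C, 0 < C & forall f z h, holo_uhp f ->
  2 * r < complex.Im z -> N h <= r ->
  let J := box r z (fun w => `|complex.Re (f w)|) in
  `|complex.Re (f z)| <= C * J /\
  `|complex.Re (f (z + h)) - complex.Re (f z)| <= C * N h * J.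
Proof.
move=> r0; pose A0 := r ^+ 4 / 2; have A00 : 0 < A0 by rewrite divr_gt0// exprn_gt0.
exists (r ^+ 2 / A0 + (9 * r + r ^+ 2 / A0 * (144 * r ^+ 3)) / A0).
  have r2 : 0 < r ^+ 2 by exact: exprn_gt0.
  have r3 : 0 < r ^+ 3 by exact: exprn_gt0.
  have q0 : 0 < r ^+ 2 / A0 by exact: divr_gt0.
  apply: (addr_gt0 q0); apply: (divr_gt0 _ A00); apply: addr_gt0; first exact: mulr_gt0.
  by apply: (mulr_gt0 q0); exact: mulr_gt0.
move=> f z h hf rz hr J.
pose a := complex.Re z - 2 * r; pose b := complex.Re z + 2 * r.
pose c := complex.Im z - 2 * r; pose d := complex.Im z + 2 * r.
have c0 : 0 < c by rewrite /c; lra.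
have ab : a <= b by rewrite /a /b; lra.
have cd : c <= d by rewrite /c /d; lra.
pose u w := complex.Re (f w).
pose g x y := u (x +i* y).
have cg : cont2 g by apply: (@rcont_cont2 _ u) => w w0; exact: holo_rcont_Re.
pose k z' x y := cap r z' (x +i* y).
have ck z' : cont2 (k z') by apply: (@rcont_cont2 _ (cap r z')) => w _; exact: cap_rcont.
(* The value at z' as a weighted average over the square around z. *)
have near z' : N (z' - z) <= r -> u z' * dint a b c d (k z') = dint a b c d (fun x y => k z' x y * g x y)
     /\ A0 <= dint a b c d (k z').
  move=> zr.
  have := le_trans (ler_normc_Re _) zr; have := le_trans (ler_normc_Im _) zr.
  rewrite complex_ReB complex_ImB !ler_norml => /andP[h1 h2] /andP[h3 h4].
  have := @mean_value _ f z' r a b c d hf r0 c0.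
  rewrite /a /b /c /d => /(_ ltac:(lra) ltac:(lra) ltac:(lra) ltac:(lra)) => mv.
  split; last by apply: cap_mass => //; rewrite /a /b /c /d; lra.
  rewrite -(dintZ (u z') a b d c0 (ck z')); apply/esym/eqP; rewrite -subr_eq0 -(dintB _ _ _ c0); last 2 first.
  - exact: cont2M.
  - by apply: cont2M => //; exact: cont2_cst.
  apply/eqP; rewrite -[RHS]mv; apply: eq_dint => x y _ _; rewrite /k /g /u; ring.
have [] := near z; first by rewrite subrr Normc.normc0 ltW.
have [] := near (z + h); first by rewrite addrAC subrr add0r.
have JE : J = dint a b c d (fun x y => `|g x y|) by [].
have B1 : `|dint a b c d (fun x y => k z x y * g x y)| <= r ^+ 2 * J.
  rewrite JE; apply: dint_weighted => // x y _ _.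
  by rewrite ger0_norm ?cap_ge0// cap_le.
(* 9 r = 4 r + (4 r + r): the distances to z and to z + h. *)
have kl x y : a <= x <= b -> c <= y <= d -> `|k (z + h) x y - k z x y| <= 9 * r * N h.
  move=> hx hy; apply: le_trans (cap_lip _ _ _ _) _.
  rewrite (_ : z + h - z = h); last by ring.
  rewrite mulrC ler_wpM2r ?normc_ge0//.
  have d1 := box_dist hx hy.
  have : N (x +i* y - (z + h)) <= N (x +i* y - z) + N h.
    by rewrite opprD addrA; exact: normcB.
  lra.
have J0 : 0 <= J by rewrite JE; apply: dint_ge0.
have B2 : `|dint a b c d (fun x y => k (z + h) x y * g x y) - dint a b c d (fun x y => k z x y * g x y)|
    <= 9 * r * N h * J.
  rewrite -dintB//; [|exact: cont2M..].
  rewrite (@eq_dint _ _ _ _ _ _ (fun x y => (k (z + h) x y - k z x y) * g x y)); last first.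
    by move=> x y _ _; rewrite mulrBl.
  by rewrite JE; apply: dint_weighted => //; exact: cont2B.
have B3 : `|dint a b c d (k (z + h)) - dint a b c d (k z)| <= 144 * r ^+ 3 * N h.
  rewrite -dintB//; have -> : 144 * r ^+ 3 * N h = 9 * r * N h * (d - c) * (b - a).
    by rewrite /a /b /c /d; ring.
  by apply: dint_bound => //; exact: cont2B.
move=> e1 A0A' e2 A0A; rewrite -e1 -e2 in B2; rewrite -e2 in B1.
apply: quotient_lipschitz A00 A0A A0A' _ _ _ J0 (normc_ge0 h) B1 B2 B3.
- exact: exprn_ge0 (ltW r0).
- by rewrite mulr_ge0// ltW.
- by rewrite mulr_ge0// exprn_ge0// ltW.
Qed.

Lemma holo_rcont_norm f z : holo_uhp f -> 0 < complex.Im z -> rcont (fun z => N (f z)) z.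
Proof. by move=> H /H[l Hl]; exact/ccont_norm/(wirtinger_ccont Hl). Qed.

Lemma box_cont2 f : holo_uhp f -> cont2 (fun x y => N (f (x +i* y))).
Proof. by move=> hf; apply: (@rcont_cont2 _ (fun w => N (f w))) => w; exact: holo_rcont_norm. Qed.

Lemma box_Re_le (r : R) z f : holo_uhp f -> 2 * r < complex.Im z ->
  box r z (fun w => `|complex.Re (f w)|) <= box r z (fun w => N (f w)).
Proof.
move=> hf rz; apply: le_dint; first by lra.
- apply: cont2_norm.
  by apply: (@rcont_cont2 _ (fun w => complex.Re (f w))) => w; exact: holo_rcont_Re.
- exact: box_cont2.
- by move=> x y _ _; exact: ler_normc_Re.
Qed.

Lemma holo_scale f (k : R[i]) : holo_uhp f -> holo_uhp (fun z => k * f z).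
Proof.
move=> hf z z0; have [l Hl] := hf z z0; exists (k * l).
by refine (wirtinger_eq (wirtingerM (wirtinger_cst k z) Hl) _ _ _) => //; ring.
Qed.

Lemma Re_rot z : complex.Re (- 'i%C * z) = complex.Im z.
Proof. by case: z => a b /=; ring. Qed.

Lemma normc_rot z : N (- 'i%C * z) = N z.
Proof. by rewrite Normc.normcM normc_opp /= expr0n expr1n /= add0r sqrtr1 mul1r. Qed.

(** The real part of [- i f] is the imaginary part of [f]. *)
Lemma holo_estimate (r : R) : 0 < r -> exists2 C, 0 < C & forall f z h, holo_uhp f ->
  2 * r < complex.Im z -> N h <= r ->
  N (f z) <= C * box r z (fun w => N (f w)) /\
  N (f (z + h) - f z) <= C * N h * box r z (fun w => N (f w)).
Proof.
move=> r0; have [C C0 H] := holo_Re_estimate r0.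
exists (2 * C); first by rewrite mulr_gt0.
move=> f z h hf rz hr.
have hf' := holo_scale (- 'i%C) hf.
have J1 := box_Re_le hf rz.
have J2 := box_Re_le hf' rz.
have e2 : (fun w => N (- 'i%C * f w)) = (fun w => N (f w)).
  by apply/funext => w; rewrite normc_rot.
rewrite e2 in J2.
have [a1 a2] := H f z h hf rz hr.
have [b1 b2] := H _ z h hf' rz hr.
rewrite !Re_rot in b1 b2.
have n0 := normc_ge0 h.
have Cn : 0 <= C * N h by rewrite mulr_ge0// ltW.
split.
  apply: le_trans (normc_le_ReIm _) _.
  have t1 := le_trans a1 (ler_wpM2l (ltW C0) J1).
  have t2 := le_trans b1 (ler_wpM2l (ltW C0) J2).
  rewrite [2 * C]mulrDl mul1r mulrDl; exact: lerD.
apply: le_trans (normc_le_ReIm _) _; rewrite complex_ReB complex_ImB.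
have t1 := le_trans a2 (ler_wpM2l Cn J1).
have t2 := le_trans b2 (ler_wpM2l Cn J2).
rewrite -mulrA [2 * C]mulrDl mul1r mulrDl mulrA; exact: lerD.
Qed.

Definition cderiv f f' := forall z, 0 < complex.Im z -> wirtinger f z (f' z) 0.

Lemma cderiv_holo f f' : cderiv f f' -> holo_uhp f.
Proof. by move=> H z /H ?; exists (f' z). Qed.

Lemma holo_cderiv f : holo_uhp f -> exists f', cderiv f f'.
Proof.
move=> hf; have h z : exists l, 0 < complex.Im z -> wirtinger f z l 0.
  by case: (boolP (0 < complex.Im z)) => [/hf[l Hl]|_]; [exists l|exists 0].
by have [f' Hf'] := choice h; exists f'.
Qed.

Lemma wirtinger_deriv_bound f z l K r : 0 < r -> wirtinger f z l 0 ->
  (forall h, N h < r -> N (f (z + h) - f z) <= K * N h) -> N l <= K.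
Proof.
move=> r0 Hl HK; apply/ler_addgt0Pr => e e0.
have [s s0 Hs] := Hl _ e0.
pose t := Order.min r s / 2; have t0 : 0 < t by rewrite divr_gt0// lt_min r0.
have tm : t < Order.min r s.
  have m0 : 0 < Order.min r s by rewrite lt_min r0.
  by rewrite /t ltr_pdivrMr//; lra.
have nt : N t%:C = t by rewrite normc_real gtr0_norm.
move: tm; rewrite lt_min -nt => /andP[/HK h1 /Hs]; rewrite mul0r addr0 => h2.
rewrite nt in h1 h2; rewrite -(ler_pM2r t0).
rewrite -{1}nt -Normc.normcM.
have -> : l * t%:C = (f (z + t%:C) - f z) - (f (z + t%:C) - f z - l * t%:C) by ring.
by apply: le_trans (normcB _ _) _; rewrite mulrDl lerD.
Qed.

Lemma cderiv_estimate (r : R) : 0 < r -> exists2 C, 0 < C & forall f f' z, cderiv f f' ->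
  2 * r < complex.Im z ->
  N (f z) <= C * box r z (fun w => N (f w)) /\
  N (f' z) <= C * box r z (fun w => N (f w)).
Proof.
move=> r0; have [C C0 H] := holo_estimate r0; exists C => // f f' z hf rz.
have z0 : 0 < complex.Im z by lra.
have [h1 _] := H f z 0 (cderiv_holo hf) rz (eq_ind_r (fun x => x <= r) (ltW r0) (@Normc.normc0 R)).
split => //; apply: (wirtinger_deriv_bound r0 (hf z z0)) => h /ltW hr.
by have [_] := H f z h (cderiv_holo hf) rz hr; rewrite mulrAC.
Qed.

Definition in_rect a b c d z := (a <= complex.Re z <= b) && (c <= complex.Im z <= d).

Lemma rect_sup_bound (r : R) f a b c d : 0 < r -> 2 * r < c -> holo_uhp f ->
  exists2 S, 0 <= S & forall z, in_rect a b c d z -> N (f z) <= S.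
Proof.
move=> r0 rc hf; have [C C0 H] := holo_estimate r0.
pose J := dint (a - 2 * r) (b + 2 * r) (c - 2 * r) (d + 2 * r) (fun x y => N (f (x +i* y))).
have J0 : 0 <= J by apply: dint_ge0 => *; exact: normc_ge0.
exists (C * J); first by rewrite mulr_ge0// ltW.
move=> z /andP[/andP[az zb] /andP[cz zd]].
have rz : 2 * r < complex.Im z by lra.
have [h1 _] := H f z 0 hf rz (eq_ind_r (fun x => x <= r) (ltW r0) (@Normc.normc0 R)).
apply: le_trans h1 _; apply: ler_wpM2l (ltW C0) _ _ _.
by apply: dint_sub; try lra; [exact: box_cont2|move=> *; exact: normc_ge0].
Qed.

Lemma rect_lipschitz (r : R) : 0 < r -> exists2 C, 0 < C & forall f a b c d S,
  holo_uhp f -> 2 * r < c ->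
  (forall z, in_rect (a - 2 * r) (b + 2 * r) (c - 2 * r) (d + 2 * r) z -> N (f z) <= S) ->
  forall z h, in_rect a b c d z -> N h <= r -> N (f (z + h) - f z) <= C * S * N h.
Proof.
move=> r0; have [C C0 H] := holo_estimate r0.
exists (C * (4 * r * (4 * r))); first by rewrite !mulr_gt0.
move=> f a b c d S hf rc HS z h /andP[/andP[az zb] /andP[cz zd]] hr.
have rz : 2 * r < complex.Im z by lra.
have [_ h2] := H f z h hf rz hr; apply: le_trans h2 _.
have -> : C * (4 * r * (4 * r)) * S * N h = C * N h * (S * (4 * r) * (4 * r)) by ring.
apply: ler_wpM2l; first by rewrite mulr_ge0 ?normc_ge0// ltW.
have -> : S * (4 * r) * (4 * r) = dint (complex.Re z - 2 * r) (complex.Re z + 2 * r)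
       (complex.Im z - 2 * r) (complex.Im z + 2 * r) (fun x y => S).
  by rewrite dint_cst; [ring|lra|lra].
apply: le_dint; [lra|exact: box_cont2|exact: cont2_cst|].
move=> x y /andP[h1 h3] /andP[h4 h5]; apply: HS.
by rewrite /in_rect /=; apply/andP; split; apply/andP; split; lra.
Qed.

Lemma diff_quotient_holo f (t : R) : holo_uhp f -> holo_uhp (fun z => (f (z + t%:C) - f z) * (t%:C)^-1).
Proof.
move=> hf z z0; have [l Hl] := hf z z0.
have zt : 0 < complex.Im (z + t%:C) by case: z z0 {Hl} => a b /=; rewrite addr0.
have [l' Hl'] := hf _ zt.
exists ((l' - l) * (t%:C)^-1).
have h : wirtinger (fun z => f (z + t%:C)) z l' 0.
  rewrite (_ : (fun z => _) = (fun z => f (z - (- t%:C)))); last by apply/funext => u; rewrite opprK.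
  by apply: wirtinger_shift; rewrite opprK.
by refine (wirtinger_eq (wirtingerM (wirtingerB h Hl) (wirtinger_cst ((t%:C)^-1) z)) _ _ _) => //; ring.
Qed.

Lemma wirtinger_dq_limit f z l : wirtinger f z l 0 -> forall e, 0 < e -> exists2 s, 0 < s &
  forall t, 0 < t -> t < s -> N ((f (z + t%:C) - f z) * (t%:C)^-1 - l) <= e.
Proof.
move=> Hl e e0; have [s s0 Hs] := Hl _ e0; exists s => // t t0 ts.
have nt : N t%:C = t by rewrite normc_real gtr0_norm.
have tn : (t%:C : R[i]) != 0 by rewrite -normc_gt0 nt.
have -> : (f (z + t%:C) - f z) * (t%:C)^-1 - l = (f (z + t%:C) - f z - (l * t%:C + 0 * (t%:C)^*%C)) / t%:C.
  by field.
rewrite Normc.normcM Normc.normcV nt ler_pdivrMr//.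
by have := Hs t%:C; rewrite nt; apply.
Qed.

(** Second order information without a second derivative: the difference
    quotients of [f] are holomorphic and, by the Lipschitz bound for [f],
    bounded independently of the step; the same bound applied to them gives
    a Lipschitz constant that survives in the limit. *)
Lemma cderiv_lipschitz f f' a b c d : cderiv f f' -> 0 < c ->
  exists2 L, 0 <= L & exists2 r, 0 < r & forall z h, in_rect a b c d z -> N h <= r ->
    N (f' (z + h) - f' z) <= L * N h.
Proof.
move=> hf c0; pose r := c / 8; have r0 : 0 < r by rewrite divr_gt0.
have cr : c = 8 * r by rewrite /r; lra.
have hh := cderiv_holo hf.
have [S S0 HS] := @rect_sup_bound r f (a - 4 * r) (b + 4 * r) (c - 4 * r) (d + 4 * r) r0 ltac:(lra) hh.
have [C C0 HC] := rect_lipschitz r0.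
have L1 : forall z h, in_rect (a - 2 * r) (b + 2 * r) (c - 2 * r) (d + 2 * r) z -> N h <= r ->
   N (f (z + h) - f z) <= C * S * N h.
  apply: HC => //; first by lra.
  move=> z /andP[/andP[? ?] /andP[? ?]]; apply: HS.
  by apply/andP; split; apply/andP; split; lra.
exists (C * (C * S)); first by rewrite !mulr_ge0// ltW.
exists r => // z h zR hr.
have z0 : 0 < complex.Im z by case/andP: zR => _ /andP[? _]; lra.
have zh0 : 0 < complex.Im (z + h).
  have := le_trans (ler_normc_Im h) hr; case/andP: zR => _ /andP[? _].
  by rewrite -[h]opprK complex_ImB ler_norml opprK => /andP[]; case: (h) => ? ? /=; lra.
apply/ler_addgt0Pr => e e0; have e20 : 0 < e / 2 by rewrite divr_gt0.
have [s1 s10 H1] := wirtinger_dq_limit (hf _ z0) e20.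
have [s2 s20 H2] := wirtinger_dq_limit (hf _ zh0) e20.
pose t := Order.min r (Order.min s1 s2) / 2.
have m0 : 0 < Order.min r (Order.min s1 s2) by rewrite !lt_min r0 s10.
have t0 : 0 < t by rewrite divr_gt0.
have : t < Order.min r (Order.min s1 s2) by rewrite /t ltr_pdivrMr//; lra.
rewrite !lt_min => /andP[tr /andP[ts1 ts2]].
pose g z := (f (z + t%:C) - f z) * (t%:C)^-1.
have nt : N t%:C = t by rewrite normc_real gtr0_norm.
have gL : N (g (z + h) - g z) <= C * (C * S) * N h.
  apply: (HC g a b c d) => //; [exact: diff_quotient_holo|lra|].
  move=> w wR; rewrite /g Normc.normcM Normc.normcV nt ler_pdivrMr//.
  by have := L1 w t%:C wR; rewrite nt; apply; exact: ltW.
have := H1 t t0 ts1; have := H2 t t0 ts2; rewrite -/(g z) -/(g (z + h)) => k1 k2.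
have -> : f' (z + h) - f' z = (g (z + h) - g z) - (g (z + h) - f' (z + h)) + (g z - f' z) by ring.
apply: le_trans (normcD _ _) _; apply: le_trans (lerD (normcB _ _) (lexx _)) _.
by lra.
Qed.

End Estimates.

(** * Powers of the modulus of a holomorphic function *)

Section Fields.
Context {R : realType}.
Local Notation mu := (@lebesgue_measure R).
Local Notation N := (@Normc.normc R).
Implicit Types (z w : R[i]) (f : R[i] -> R[i]).

Lemma rdiff_is_derive (rho : R -> R) (s d : R) : rdiff rho s d -> is_derive s 1 rho d.
Proof.
move=> H; have K : (fun h => h^-1 *: (rho (h *: 1 + s) - rho s)) @ 0^' --> d.
  apply/cvgrPdist_le => e e0; have [r r0 Hr] := H _ e0.
  apply/nbhs_ballP; exists r => // t /=; rewrite -ball_normE /ball_ /= sub0r normrN => tr t0.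
  have := Hr t tr; rewrite /GRing.scale /= mulr1 (addrC t) => h.
  rewrite -ler_pdivrMr ?normr_gt0// -normrV ?unitfE// -normrM -normrN in h.
  by apply: le_trans h; rewrite le_eqVlt; apply/orP; left; apply/eqP; congr `|_|; field.
by split; [apply/cvg_ex; exists d|apply/cvg_lim].
Qed.

(** The defect is continuous for uniform convergence of the field and of
    its divergence, with no control of derivatives. *)
Lemma defect_close (P Q D P' Q' D' : R -> R -> R) (a b c d e : R) :
  cont2 P -> cont2 Q -> cont2 D -> cont2 P' -> cont2 Q' -> cont2 D' ->
  0 < c -> a <= b -> c <= d -> 0 <= e ->
  (forall x y, a <= x <= b -> c <= y <= d ->
     [/\ `|P x y - P' x y| <= e, `|Q x y - Q' x y| <= e & `|D x y - D' x y| <= e]) ->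
  `|defect P Q D a b c d - defect P' Q' D' a b c d| <=
     e * (2 * (d - c) + 2 * (b - a) + (d - c) * (b - a)).
Proof.
move=> cP cQ cD cP' cQ' cD' c0 ab cd e0 H; rewrite /defect /flux.
have d0 : 0 < d by exact: lt_le_trans cd.
have aab : a <= a <= b by rewrite lexx.
have bab : a <= b <= b by rewrite lexx ab.
have ccd : c <= c <= d by rewrite lexx.
have dcd : c <= d <= d by rewrite lexx cd.
have h1 : `|\int[mu]_(y in `[c, d]) (P b y - P a y) - \int[mu]_(y in `[c, d]) (P' b y - P' a y)|
    <= e * 2 * (d - c).
  rewrite -itv_intB; [|exact: flux_cts_y..].
  apply: itv_int_bound => //.
    by move=> y hy; apply: cvgB; apply: flux_cts_y hy.
  move=> y hy; have [k1 _ _] := H b y bab hy; have [k2 _ _] := H a y aab hy.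
  have -> : P b y - P a y - (P' b y - P' a y) = (P b y - P' b y) - (P a y - P' a y) by ring.
  by apply: le_trans (ler_normB _ _) _; lra.
have h2 : `|\int[mu]_(x in `[a, b]) (Q x d - Q x c) - \int[mu]_(x in `[a, b]) (Q' x d - Q' x c)|
    <= e * 2 * (b - a).
  rewrite -itv_intB; [|exact: flux_cts_x..].
  apply: itv_int_bound => //.
    by move=> y hy; apply: cvgB; apply: flux_cts_x hy.
  move=> x hx; have [_ k1 _] := H x d hx dcd; have [_ k2 _] := H x c hx ccd.
  have -> : Q x d - Q x c - (Q' x d - Q' x c) = (Q x d - Q' x d) - (Q x c - Q' x c) by ring.
  by apply: le_trans (ler_normB _ _) _; lra.
have h3 : `|dint a b c d D - dint a b c d D'| <= e * (d - c) * (b - a).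
  by rewrite -dintB//; apply: dint_bound => //; [exact: cont2B|move=> x y hx hy; have [] := H x y hx hy].
have regroup (x1 x2 x3 x4 x5 x6 : R) :
  x3 + x4 - x1 - (x5 + x6 - x2) = (x3 - x5) + (x4 - x6) - (x1 - x2) by ring.
rewrite regroup.
apply: le_trans (ler_normB _ _) _; apply: le_trans (lerD (ler_normD _ _) (lexx _)) _.
apply: le_trans (lerD (lerD h1 h2) h3) _; clear; lra.
Qed.

(** Mean value theorem along a horizontal segment, for the real part of [k
    f] with [k = 1] and [k = - i], combined with the Lipschitz bound for
    [f']. *)
Lemma dq_uniform f f' a b c d : cderiv f f' -> 0 < c ->
  exists2 K, 0 <= K & exists2 r, 0 < r & forall z t, in_rect a b c d z -> 0 < t -> t <= r ->
    N ((f (z + t%:C) - f z) * (t%:C)^-1 - f' z) <= K * t.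
Proof.
move=> hf c0; have [L L0 [r r0 HL]] := cderiv_lipschitz a b d hf c0.
exists (2 * L); first by rewrite mulr_ge0.
exists r => // z t zR t0 tr.
have z0 : 0 < complex.Im z by case/andP: zR => _ /andP[? _]; exact: lt_le_trans c0 _.
have zs s : 0 < complex.Im (z + s%:C).
  by move: z0; case: (z) => u v /=; rewrite addr0.
have nt s : 0 <= s -> N s%:C = s by move=> ?; rewrite normc_real ger0_norm.
have tn : (t%:C : R[i]) != 0 by rewrite -normc_gt0 nt// ltW.
have dRe (k : R[i]) (s : R) : is_derive s 1 (fun s : R => complex.Re (k * f (z + s%:C))) (complex.Re (k * f' (z + s%:C))).
  apply: rdiff_is_derive => e e0.
  have := wirtingerM (wirtinger_cst k _) (hf _ (zs s)) e0.
  case=> q q0 Hq; exists q => // h hq.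
  have := Hq h%:C; rewrite normc_real => /(_ hq) hh; apply: le_trans hh.
  apply: le_trans (ler_normc_Re _); rewrite le_eqVlt; apply/orP; left; apply/eqP; congr `|_|.
  have zE : z + (s + h)%:C = z + s%:C + h%:C by rewrite rmorphD addrA.
  cbv beta; rewrite zE.
  case: (k) => ? ?; case: (f (z + s%:C + h%:C)) => ? ?; case: (f (z + s%:C)) => ? ?; case: (f' _) => ? ? /=; ring.
have mvt (k : R[i]) : `|complex.Re (k * ((f (z + t%:C) - f z) * (t%:C)^-1 - f' z))| <= N k * (L * t).
  have cRe : continuous (fun s : R => complex.Re (k * f (z + s%:C))).
    move=> s; apply: differentiable_continuous; apply/derivable1_diffP.
    exact: (@ex_derive _ _ _ _ _ _ _ (dRe k s)).
  have [] := @MVT R (fun s : R => complex.Re (k * f (z + s%:C))) (fun s : R => complex.Re (k * f' (z + s%:C))) 0 t t0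
    (fun s _ => dRe k s) (continuous_subspaceT cRe).
  move=> s; rewrite in_itv/= => /andP[s0 st]; rewrite addr0 subr0 => e.
  have -> : complex.Re (k * ((f (z + t%:C) - f z) * (t%:C)^-1 - f' z)) = complex.Re (k * (f' (z + s%:C) - f' z)).
    have e1 : complex.Re (k * (f (z + t%:C) - f z)) = complex.Re (k * f' (z + s%:C)) * t.
      by rewrite -e mulrBr complex_ReB.
    have e2 : complex.Re (k * ((f (z + t%:C) - f z) * (t%:C)^-1)) = complex.Re (k * f' (z + s%:C)).
      apply: (mulIf (lt0r_neq0 t0)); rewrite -e1.
      have -> : k * (f (z + t%:C) - f z) = k * ((f (z + t%:C) - f z) * (t%:C)^-1) * t%:C by field.
      by case: (k * (_ * _)) => ? ? /=; ring.
    by rewrite mulrBr complex_ReB e2 mulrBr complex_ReB.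
  apply: le_trans (ler_normc_Re _) _; rewrite Normc.normcM ler_wpM2l ?normc_ge0//.
  apply: le_trans (HL _ _ zR _) _; rewrite nt ?(ltW s0)//; first exact/ltW/(lt_le_trans st).
  by rewrite ler_wpM2l// ltW.
apply: le_trans (normc_le_ReIm _) _.
have := mvt 1; have := mvt (- 'i%C); rewrite Re_rot mul1r Normc.normc1 !mul1r.
have -> : N (- 'i%C) = 1 by rewrite -[- _]mulr1 normc_rot Normc.normc1.
by lra.
Qed.

(** Takes care of the zeros of [f], where the chain rule for a power of the
    modulus does not apply. *)
Lemma wirtinger_superlinear (F : R[i] -> R[i]) z K q r : 1 < q -> 0 < r -> 0 <= K -> F z = 0 ->
  (forall w, N w < r -> N (F (z + w)) <= K * N w `^ q) -> wirtinger F z 0 0.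
Proof.
move=> q1 r0 K0 Fz H e e0.
have q10 : 0 < q - 1 by lra.
have eK : 0 < e / (K + 1) by rewrite divr_gt0// ltr_wpDl.
have /cvgrPdist_lt/(_ _ eK)/nbhs_ballP[s /= s0 Hs] := powR_cvg0 q10.
exists (Order.min r s); first by rewrite lt_min r0.
move=> w; rewrite lt_min => /andP[/H h ws]; rewrite Fz !mul0r addr0 !subr0.
have n0 := normc_ge0 w.
apply: le_trans h _; have [w0|w0] := eqVneq (N w) 0.
  by rewrite w0 powR0 ?mulr0// gt_eqF//; lra.
have wp : 0 < N w by rewrite lt_def w0.
have := Hs (N w); rewrite -ball_normE /ball_ /= sub0r normrN ger0_norm// => /(_ ws wp).
rewrite sub0r normrN ger0_norm ?powR_ge0// => /ltW h.
rewrite -(mulr_powRB1 n0); last by lra.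
rewrite mulrCA mulrC ler_wpM2r//.
apply: le_trans (ler_wpM2l K0 h) _; rewrite mulrCA ger_pMr// ler_pdivrMr ?mul1r//; last by rewrite ltr_wpDl.
by rewrite lerDl.
Qed.

Lemma powR_mul_sqr (x p : R) : 0 <= x -> 0 < p -> x `^ (p - 2) * x ^+ 2 = x `^ p.
Proof.
move=> x0 p0; rewrite -powR_mulrn//; case: (eqVneq x 0) => [->|n0].
  by rewrite (@powR0 _ 2%:R) ?pnatr_eq0// mulr0 powR0// gt_eqF.
by rewrite -powRD ?n0 ?implybT//; congr (_ `^ _); ring.
Qed.

Variables (f f' : R[i] -> R[i]) (p : R).
Hypotheses (hf : cderiv f f') (p2 : 2 <= p).

Let fholo : holo_uhp f.
Proof. exact: cderiv_holo hf. Qed.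

Lemma wirtinger_norm_powR s z : 0 < complex.Im z -> f z != 0 ->
  wirtinger (fun z => (N (f z) `^ s)%:C) z ((s / 2 * N (f z) `^ (s - 2))%:C * (f' z * (f z)^*%C))
    ((s / 2 * N (f z) `^ (s - 2))%:C * (f z * (f' z)^*%C)).
Proof.
move=> z0 fz; have nf : 0 < N (f z) by rewrite normc_gt0.
have e2 w : (N (f w) ^+ 2) `^ (s / 2) = N (f w) `^ s.
  by rewrite -powR_mulrn ?normc_ge0// -powRrM; congr (_ `^ _); field.
have h := wirtingerM (hf z0) (wirtinger_conj (hf z0)).
have h2 : wirtinger (fun z => (N (f z) ^+ 2)%:C) z (f' z * (f z)^*%C) (f z * (f' z)^*%C).
  by apply: wirtinger_eq h _ _ _ => [w||]; rewrite ?sqr_normc_conj ?conjc0 ?mulr0 ?mul0r ?addr0 ?add0r.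
have d : rdiff (fun x => x `^ (s / 2)) (N (f z) ^+ 2) (s / 2 * (N (f z) ^+ 2) `^ (s / 2 - 1)).
  by apply: is_derive_rdiff; apply: is_derive1_powR; exact: exprn_gt0.
have e3 : (N (f z) ^+ 2) `^ (s / 2 - 1) = N (f z) `^ (s - 2).
  by rewrite -powR_mulrn ?normc_ge0// -powRrM; congr (_ `^ _); field.
by rewrite -e3; apply: wirtinger_real_comp h2 d _ => w; rewrite e2.
Qed.

(** The weight [|f|^(p-2)]; for [p = 2] it is [1] also at the zeros of [f]. *)
Definition psi z : R := N (f z) `^ (p - 2).

Lemma psi_ge0 z : 0 <= psi z. Proof. exact: powR_ge0. Qed.

Lemma psi_norm z : psi z * N (f z) = N (f z) `^ (p - 1).
Proof.
rewrite /psi mulrC; have -> : p - 2 = p - 1 - 1 by ring.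
by apply: mulr_powRB1; [exact: normc_ge0|move: p2; lra].
Qed.

Lemma f_zero_bound z : 0 < complex.Im z -> f z = 0 ->
  exists2 r, 0 < r & exists2 K, 0 <= K & forall w, N w < r -> N (f (z + w)) <= K * N w.
Proof.
move=> z0 fz; have [r r0 Hr] := wirtinger_lip (hf z0); exists r => //.
exists (N (f' z) + N 0 + 1); first by rewrite !addr_ge0 ?normc_ge0.
by move=> w /Hr; rewrite fz subr0.
Qed.

(** Chain rule where [f] does not vanish; at a zero [|f|^p] is flat because
    [p > 1]. *)
Lemma wirtinger_mass z : 0 < complex.Im z -> exists al,
  wirtinger (fun z => (N (f z) `^ p)%:C) z al ((p / 2 * psi z)%:C * (f z * (f' z)^*%C)).
Proof.
move=> z0; have [fz|fz] := eqVneq (f z) 0; last by eexists; exact: wirtinger_norm_powR.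
have [r r0 [K K0 H]] := f_zero_bound z0 fz.
exists 0; rewrite fz mul0r mulr0.
apply: (@wirtinger_superlinear _ _ (K `^ p) p r) => //; [move: p2; lra|exact: powR_ge0| |].
  by rewrite fz Normc.normc0 powR0// gt_eqF//; move: p2; lra.
move=> w /H h; rewrite normc_real ger0_norm ?powR_ge0// -powRM ?normc_ge0//.
apply: ge0_ler_powR h; [move: p2; lra|by rewrite nnegrE normc_ge0|by rewrite nnegrE mulr_ge0 ?normc_ge0].
Qed.

(** The derivative of [|f|^(p-2) conj f] with respect to the conjugate of
    [z]: away from the zeros of [f] the two factors contribute [(p - 2) /
    2] and [1]. At a zero the function is flat if [p > 2], and it is [conj
    f] if [p = 2]. *)
Lemma wirtinger_U z : 0 < complex.Im z -> exists al,
  wirtinger (fun z => (psi z)%:C * (f z)^*%C) z al ((p / 2 * psi z)%:C * (f' z)^*%C).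
Proof.
move=> z0; have hc := wirtinger_conj (hf z0).
have [fz|fz] := eqVneq (f z) 0; last first.
  eexists; refine (wirtinger_eq (wirtingerM (wirtinger_norm_powR (p - 2) z0 fz) hc) (fun=> erefl) erefl _).
  have -> : N (f z) `^ (p - 2 - 2) = psi z / N (f z) ^+ 2.
    rewrite /psi -powR_mulrn ?normc_ge0// -powRB//; apply/implyP => _.
    by rewrite normc_eq0.
  have nz : (N (f z) ^+ 2)%:C != 0 :> R[i].
    by rewrite -normc_gt0 normc_real normr_gt0 expf_neq0// normc_eq0.
  have e : f z * (f z)^*%C / (N (f z) ^+ 2)%:C = 1 by rewrite -sqr_normc_conj divff.
  rewrite -/(psi z) (_ : ((p - 2) / 2 * (psi z / N (f z) ^+ 2))%:C =
     ((p - 2) / 2 * psi z)%:C / (N (f z) ^+ 2)%:C); last by rewrite mulrA rmorphM fmorphV.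
  transitivity (((p - 2) / 2 * psi z)%:C * (f' z)^*%C * (f z * (f z)^*%C / (N (f z) ^+ 2)%:C) + (psi z)%:C * (f' z)^*%C).
    by ring.
  by rewrite e mulr1 -mulrDl -rmorphD /=; congr (_%:C * _); field.
have [pe|pn] := eqVneq p 2.
  exists (0^*)%C; refine (wirtinger_eq hc _ _ _) => [w||] //.
    by rewrite /psi pe subrr powRr0 mul1r.
  by rewrite /psi pe subrr powRr0 mulr1 divff ?pnatr_eq0// mul1r.
have [r r0 [K K0 H]] := f_zero_bound z0 fz.
have ps0 : psi z = 0 by rewrite /psi fz Normc.normc0 powR0// subr_eq0.
exists 0; rewrite ps0 mulr0 mul0r.
have p3 : 2 < p by rewrite lt_def pn p2.
apply: (@wirtinger_superlinear _ _ (K `^ (p - 1)) (p - 1) r) => //; [move: p2; lra|exact: powR_ge0| |].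
  by rewrite ps0 mul0r.
move=> w /H h; rewrite Normc.normcM normc_conj normc_real ger0_norm ?psi_ge0// psi_norm -powRM ?normc_ge0//.
apply: ge0_ler_powR h; [move: p2; lra|by rewrite nnegrE normc_ge0|by rewrite nnegrE mulr_ge0 ?normc_ge0].
Qed.

Lemma cderiv_ccont z : 0 < complex.Im z -> ccont f' z.
Proof.
move=> z0 e e0.
have [L L0 [r r0 HL]] := cderiv_lipschitz (complex.Re z) (complex.Re z) (complex.Im z) hf z0.
have zR : in_rect (complex.Re z) (complex.Re z) (complex.Im z) (complex.Im z) z by rewrite /in_rect !lexx.
have L1 : 0 < L + 1 by rewrite ltr_wpDl.
exists (Order.min r (e / (L + 1))); first by rewrite lt_min r0 divr_gt0.
move=> w; rewrite lt_min ltr_pdivlMr// => /andP[/ltW wr h].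
apply: le_lt_trans (HL _ _ zR wr) _; have := normc_ge0 w; lra.
Qed.

Lemma powR_continuous_ge0 (s x : R) : 0 < s -> 0 <= x -> forall e, 0 < e ->
  exists2 r, 0 < r & forall y, 0 <= y -> `|y - x| < r -> `|y `^ s - x `^ s| < e.
Proof.
move=> s0; rewrite le_eqVlt => /orP[/eqP <-|x0] e e0.
  have /cvgrPdist_lt/(_ _ e0)/nbhs_ballP[r /= r0 Hr] := powR_cvg0 s0.
  exists r => // y y0; rewrite subr0 powR0 ?gt_eqF// subr0.
  move: y0; rewrite le_eqVlt => /orP[/eqP <- _|y0 yr]; first by rewrite powR0 ?gt_eqF// normr0.
  have := Hr y; rewrite -ball_normE /ball_ /= sub0r normrN => /(_ yr y0).
  by rewrite sub0r normrN.
have [] := is_derive_rdiff (is_derive1_powR s x0) ltr01.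
set d := s * _ => r r0 Hr.
pose K := `|d| + 1; have K0 : 0 < K by rewrite ltr_wpDl.
exists (Order.min r (e / K)); first by rewrite lt_min r0 divr_gt0.
move=> y _; rewrite lt_min ltr_pdivlMr// => /andP[/Hr + h2].
rewrite (_ : x + (y - x) = y) ?mul1r; last by ring.
move=> h1.
have -> : y `^ s - x `^ s = (y `^ s - x `^ s - d * (y - x)) + d * (y - x) by ring.
apply: le_lt_trans (ler_normD _ _) _; apply: le_lt_trans h2.
by rewrite normrM /K; lra.
Qed.

Lemma psi_rcont z : 0 < complex.Im z -> rcont psi z.
Proof.
move=> z0; have [pe|pn] := eqVneq p 2.
  move=> e e0; exists 1 => // w _; by rewrite /psi pe subrr !powRr0 subrr normr0.
have p3 : 0 < p - 2 by rewrite subr_gt0 lt_def pn p2.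
move=> e e0; have [r r0 Hr] := powR_continuous_ge0 p3 (normc_ge0 (f z)) e0.
have [s s0 Hs] := holo_rcont_norm fholo z0 r0.
by exists s => // w /Hs; apply: Hr; exact: normc_ge0.
Qed.

End Fields.

(** * Two fields in divergence form *)

Section ZeroDefect.
Context {R : realType}.
Local Notation N := (@Normc.normc R).
Implicit Types (z w : R[i]).

Lemma ccont_conj (V : R[i] -> R[i]) z : ccont V z -> ccont (fun z => (V z)^*%C) z.
Proof.
move=> H e /H[r r0 Hr]; exists r => // w /Hr.
by rewrite -normc_conj (_ : conjc _ = (V (z + w))^*%C - (V z)^*%C)// rmorphB.
Qed.

Lemma ccont_cont2_Re (V : R[i] -> R[i]) : (forall z, 0 < complex.Im z -> ccont V z) ->
  cont2 (fun x y => complex.Re (V (x +i* y))).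
Proof. by move=> H; apply: (@rcont_cont2 _ (fun z => complex.Re (V z))) => z /H/ccont_Re. Qed.

Lemma ccont_cont2_Im (V : R[i] -> R[i]) : (forall z, 0 < complex.Im z -> ccont V z) ->
  cont2 (fun x y => complex.Im (V (x +i* y))).
Proof. by move=> H; apply: (@rcont_cont2 _ (fun z => complex.Im (V z))) => z /H/ccont_Im. Qed.

Lemma cont2N (g : R -> R -> R) : cont2 g -> cont2 (fun x y => - g x y).
Proof. by move=> cg x y y0; apply: cvgN; exact: cg. Qed.

Lemma normc_sqr_Re z : complex.Re (z^*%C * z) = N z ^+ 2.
Proof. by rewrite sqr_normcE; case: z => a b /=; ring. Qed.

Lemma in_rectP a b c d (x y : R) : a <= x <= b -> c <= y <= d -> in_rect a b c d (x +i* y).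
Proof. by move=> h1 h2; rewrite /in_rect /= h1 h2. Qed.

Variables (f f' : R[i] -> R[i]) (p : R).
Hypotheses (hf : cderiv f f') (p2 : 2 <= p).

Let fholo : holo_uhp f.
Proof. exact: cderiv_holo hf. Qed.

Local Notation psi := (psi f p).

Definition Ufield z : R[i] := (psi z)%:C * (f z)^*%C.
(** [p * Wfield] is twice the derivative of [|f|^p] with respect to [z]:
    its real and imaginary parts are the partial derivative of [|f|^p] in
    [x] and the opposite of that in [y]. *)
Definition Wfield z : R[i] := Ufield z * f' z.
Definition Mass z : R := N (f z) `^ p.
(** [p ^ 2 * Energy] is the Laplacian of [|f|^p]. *)
Definition Energy z : R := psi z * N (f' z) ^+ 2.

Lemma Ufield_ccont z : 0 < complex.Im z -> ccont Ufield z.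
Proof. by move=> z0; have [al /wirtinger_ccont] := wirtinger_U hf p2 z0. Qed.

Lemma Wfield_ccont z : 0 < complex.Im z -> ccont Wfield z.
Proof. by move=> z0; apply: ccontM; [exact: Ufield_ccont|exact: cderiv_ccont hf _ z0]. Qed.

Lemma Mass_rcont z : 0 < complex.Im z -> rcont Mass z.
Proof. by move=> z0; have [al /rcont_wirtinger] := wirtinger_mass hf p2 z0. Qed.

Lemma Energy_rcont z : 0 < complex.Im z -> rcont Energy z.
Proof.
move=> z0; apply: rcontM; first exact: (psi_rcont hf p2 z0).
have h := ccont_norm (cderiv_ccont hf z0).
by apply: rcont_eq (rcontM h h) _ => w; rewrite expr2.
Qed.

Lemma Mass_cont2 : cont2 (fun x y => Mass (x +i* y)).
Proof. by apply: (@rcont_cont2 _ Mass) => z; exact: Mass_rcont. Qed.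

Lemma Energy_cont2 : cont2 (fun x y => Energy (x +i* y)).
Proof. by apply: (@rcont_cont2 _ Energy) => z; exact: Energy_rcont. Qed.

(** The divergence of the field [(0, |f|^p)] is the derivative of [|f|^p]
    in [y], that is [- p Im Wfield]. *)
Lemma defect_mass a b c d : a <= b -> c <= d -> 0 < c ->
  defect (fun _ _ => 0) (fun x y => Mass (x +i* y))
    (fun x y => - p * complex.Im (Wfield (x +i* y))) a b c d = 0.
Proof.
move=> ab cd c0; apply: green => //.
- exact: cont2_cst.
- exact: Mass_cont2.
- apply: cont2M; first exact: cont2_cst.
  by apply: ccont_cont2_Im => z; exact: Wfield_ccont.
move=> x y hx /andP[cy _]; have y0 : 0 < y by exact: lt_le_trans cy.
have [al Hal] := wirtinger_mass hf p2 (y0 : 0 < complex.Im (x +i* y)).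
have H := wirtingerM (wirtinger_cst (- 'i%C) (x +i* y)) Hal.
have := @wirtinger_divergence _ _ (fun x y => - p * complex.Im (Wfield (x +i* y))) x y _ _ H.
rewrite (_ : (fun x y => complex.Re (- 'i%C * (Normc.normc (f (x +i* y)) `^ p)%:C)) = fun _ _ => 0); last first.
  by apply/funext => u; apply/funext => v; rewrite Re_rot.
rewrite (_ : (fun x y => - complex.Im (- 'i%C * (Normc.normc (f (x +i* y)) `^ p)%:C)) = fun x y => Mass (x +i* y)); last first.
  by apply/funext => u; apply/funext => v; rewrite /Mass /=; ring.
apply; rewrite mul0r add0r Re_rot /Wfield /Ufield.
by case: (f _) => ? ?; case: (f' _) => ? ? /=; field.
Qed.

(** The product [Wfield] of [Ufield] and [f'] need not be differentiable,
    as nothing is known about the derivative of [f']. Replacing [f'] by the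
    difference quotients of [f], which are holomorphic, gives
    differentiable fields with zero defect; they and their divergences
    converge uniformly on the rectangle. *)
Lemma defect_W a b c d : a <= b -> c <= d -> 0 < c ->
  defect (fun x y => complex.Re (Wfield (x +i* y))) (fun x y => - complex.Im (Wfield (x +i* y)))
    (fun x y => p * Energy (x +i* y)) a b c d = 0.
Proof.
move=> ab cd c0.
have [K K0 [r r0 HK]] := dq_uniform a b d hf c0.
pose rho := c / 8; have rho0 : 0 < rho by rewrite divr_gt0.
have rhoc : 2 * rho < c by rewrite /rho; lra.
have [S S0 HS] := rect_sup_bound a b d rho0 rhoc fholo.
have [L L0 [r' r'0 HL]] := cderiv_lipschitz a b d hf c0.
have [S' S'0 HS'] : exists2 S', 0 <= S' & forall z, in_rect a b c d z -> N (f' z) <= S'.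
  have [C C0 HC] := cderiv_estimate rho0.
  pose J := dint (a - 2 * rho) (b + 2 * rho) (c - 2 * rho) (d + 2 * rho) (fun x y => N (f (x +i* y))).
  exists (C * J).
    by rewrite mulr_ge0 ?(ltW C0)//; apply: dint_ge0 => *; exact: normc_ge0.
  move=> z /andP[/andP[az zb] /andP[cz zd]].
  have [_ h] := HC f f' z hf (lt_le_trans rhoc cz).
  apply: le_trans h _; apply: ler_wpM2l (ltW C0) _ _ _.
  by apply: dint_sub; try lra; [exact: box_cont2|move=> *; exact: normc_ge0].
(* A t bounds the error on the field (first term) and on the divergence
   (second term) when f' is replaced by a difference quotient of step t. *)
pose A := S `^ (p - 1) * K + p * S `^ (p - 2) * S' * K.
have A0 : 0 <= A by rewrite addr_ge0// !mulr_ge0 ?powR_ge0//; move: p2; lra.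
have psiS z : in_rect a b c d z -> psi z <= S `^ (p - 2).
  move=> zR; apply: ge0_ler_powR (HS z zR); [by move: p2; lra|by rewrite nnegrE normc_ge0|by rewrite nnegrE].
have US z : in_rect a b c d z -> N (Ufield z) <= S `^ (p - 1).
  move=> zR; rewrite /Ufield Normc.normcM normc_conj normc_real ger0_norm ?psi_ge0// psi_norm//.
  apply: ge0_ler_powR (HS z zR); [by move: p2; lra|by rewrite nnegrE normc_ge0|by rewrite nnegrE].
pose g (t : R) z := (f (z + t%:C) - f z) * (t%:C)^-1.
pose Wt t z := Ufield z * g t z.
pose Dt t z := p * psi z * complex.Re ((f' z)^*%C * g t z).
have gholo t : holo_uhp (g t) by exact: diff_quotient_holo.
have WtW t z : 0 < complex.Im z -> exists al, wirtinger (Wt t) z al ((p / 2 * psi z)%:C * ((f' z)^*%C * g t z)).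
  move=> z0; have [al Hal] := wirtinger_U hf p2 z0; have [l Hl] := gholo t z z0.
  by eexists; refine (wirtinger_eq (wirtingerM Hal Hl) (fun=> erefl) erefl _); rewrite mulr0 addr0 mulrA.
have Wtc t z : 0 < complex.Im z -> ccont (Wt t) z by move=> /(WtW t)[al /wirtinger_ccont].
have Dtc t z : 0 < complex.Im z -> rcont (Dt t) z.
  move=> z0; apply: (@rcontM _ (fun z => p * psi z)).
    apply: rcontM; last exact: (psi_rcont hf p2 z0).
    by move=> e e0; exists 1 => // w _; rewrite subrr normr0.
  apply: ccont_Re; apply: ccontM; first exact/ccont_conj/(cderiv_ccont hf).
  by have [l /wirtinger_ccont] := gholo t z z0.
have Dt0 t : defect (fun x y => complex.Re (Wt t (x +i* y))) (fun x y => - complex.Im (Wt t (x +i* y)))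
    (fun x y => Dt t (x +i* y)) a b c d = 0.
  apply: green => //.
  - exact: ccont_cont2_Re (Wtc t).
  - exact/cont2N/ccont_cont2_Im/Wtc.
  - exact: rcont_cont2 (Dtc t).
  move=> x y hx /andP[cy _]; have y0 : 0 < y by exact: lt_le_trans cy.
  have [al Hal] := WtW t (x +i* y) y0.
  apply: wirtinger_divergence Hal _; rewrite /Dt.
  by case: (_^*%C * _) => ? ? /=; field.
apply/eqP; rewrite -normr_le0; apply/ler_addgt0Pl => e e0; rewrite addr0.
pose T := A * (2 * (d - c) + 2 * (b - a) + (d - c) * (b - a)).
have T0 : 0 <= T by rewrite mulr_ge0// !addr_ge0 ?mulr_ge0 ?subr_ge0.
pose t := Order.min r (e / (T + 1)).
have T1 : 0 < T + 1 by rewrite ltr_wpDl.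
have t0 : 0 < t by rewrite lt_min r0 divr_gt0.
have tr : t <= r by rewrite ge_min lexx.
have te : t * T <= e.
  have : t <= e / (T + 1) by rewrite ge_min lexx orbT.
  by rewrite ler_pdivlMr// mulrDr mulr1; move: t0; lra.
have pp : 0 <= p by move: p2; lra.
rewrite -[defect _ _ _ _ _ _ _]subr0 -(Dt0 t).
apply: (@le_trans _ _ (A * t * (2 * (d - c) + 2 * (b - a) + (d - c) * (b - a)))); last first.
  by apply: le_trans te; rewrite /T; lra.
apply: defect_close; [| | | | | |exact: c0|exact: ab|exact: cd| |].
- by apply: ccont_cont2_Re => z; exact: Wfield_ccont.
- by apply/cont2N/ccont_cont2_Im => z; exact: Wfield_ccont.
- by apply: cont2M; [exact: cont2_cst|exact: Energy_cont2].
- exact: ccont_cont2_Re (Wtc t).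
- exact/cont2N/ccont_cont2_Im/Wtc.
- exact: rcont_cont2 (Dtc t).
- by rewrite mulr_ge0// ltW.
move=> x y hx hy; have zR := in_rectP hx hy.
have gK := HK _ t zR t0 tr; rewrite -/(g t _) in gK.
set z := x +i* y in zR gK *.
have hW : N (Wfield z - Wt t z) <= A * t.
  rewrite /Wfield /Wt -mulrBr Normc.normcM normc_distC.
  apply: le_trans (ler_pM (normc_ge0 _) (normc_ge0 _) (US z zR) gK) _.
  rewrite /A mulrA mulrDl lerDl !mulr_ge0 ?powR_ge0//; exact: ltW.
split.
- by rewrite -complex_ReB; apply: le_trans (ler_normc_Re _) hW.
- have negB (u v : R) : - u - - v = - (u - v) by ring.
  by rewrite negB normrN -complex_ImB; apply: le_trans (ler_normc_Im _) hW.
rewrite /Dt /Energy -normc_sqr_Re mulrA -mulrBr -complex_ReB -mulrBr.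
rewrite normrM ger0_norm; last by rewrite mulr_ge0 ?psi_ge0.
have hR : `|complex.Re ((f' z)^*%C * (f' z - g t z))| <= S' * (K * t).
  apply: le_trans (ler_normc_Re _) _; rewrite Normc.normcM normc_conj normc_distC.
  by apply: ler_pM => //; [exact: normc_ge0|exact: normc_ge0|exact: HS'].
apply: le_trans (ler_pM _ (normr_ge0 _) (ler_wpM2l pp (psiS z zR)) hR) _.
  by rewrite mulr_ge0 ?psi_ge0.
rewrite /A mulrDl !mulrA lerDr !mulr_ge0 ?powR_ge0//; exact: ltW.
Qed.

End ZeroDefect.

(** * Integrals over a line *)

Section LineIntegrals.
Context {R : realType}.
Local Notation mu := (@lebesgue_measure R).

Lemma bigcup_sym_itv : \bigcup_n `[- n%:R, n%:R]%classic = [set: R].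
Proof.
apply/seteqP; split => // x _.
exists (Num.truncn `|x|).+1 => //=; rewrite in_itv/= -ler_norml; apply: ltW.
exact: truncnS_gt.
Qed.

Lemma nondecreasing_sym_itv : nondecreasing_seq (fun n : nat => `[- n%:R, n%:R]%classic : set R).
Proof.
move=> m n mn; rewrite subsetEset => x /=; rewrite !in_itv/= => /andP[h1 h2].
have : (m%:R : R) <= n%:R by rewrite ler_nat.
by move=> h; apply/andP; split; lra.
Qed.

Lemma cts_measurable (g : R -> R) : continuous g -> measurable_fun [set: R] g.
Proof. exact: continuous_measurable_fun. Qed.

Lemma cts_cts_on (g : R -> R) a b : continuous g -> cts_on a b g.
Proof. by move=> cg x _; exact: cg. Qed.

Lemma EFin_Rintegral (D : set R) (g : R -> R) : measurable D -> mu.-integrable D (EFin \o g) ->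
  ((\int[mu]_(x in D) g x)%:E = \int[mu]_(x in D) (g x)%:E)%E.
Proof. by move=> mD ig; rewrite /Rintegral fineK//; exact: integrable_fin_num. Qed.

Lemma cts_ge0_integrable (g : R -> R) K : continuous g -> (forall x, 0 <= g x) ->
  (forall n : nat, \int[mu]_(x in `[- n%:R, n%:R]) g x <= K) ->
  mu.-integrable [set: R] (EFin \o g).
Proof.
move=> cg g0 HK.
have mg : measurable_fun [set: R] (EFin \o g).
  by apply/measurable_EFinP; exact: cts_measurable.
apply/integrableP; split => //.
have -> : (\int[mu]_x `|(EFin \o g) x| = \int[mu]_x (g x)%:E)%E.
  by apply: eq_integral => x _ /=; rewrite ger0_norm.
have cv : (\int[mu]_(x in `[(- n%:R)%R, n%:R%R]) (g x)%:E)%E @[n --> \oo] --> (\int[mu]_x (g x)%:E)%E.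
  rewrite -bigcup_sym_itv; apply: ge0_nondecreasing_set_cvg_integral => //.
  - exact: nondecreasing_sym_itv.
  - by move=> n; exact: measurable_funTS.
  - by move=> n x _; rewrite lee_fin.
apply: (@le_lt_trans _ _ K%:E); last exact: ltry.
rewrite -(cvg_lim _ cv)//; apply: lime_le; first by apply/cvg_ex; eexists; exact: cv.
apply: nearW => n; rewrite -EFin_Rintegral ?lee_fin//.
exact/cts_on_integrable/cts_cts_on.
Qed.

Lemma cvg_sym_itv_int (g : R -> R) : mu.-integrable [set: R] (EFin \o g) ->
  (fun n : nat => \int[mu]_(x in `[- n%:R, n%:R]) g x) @ \oo --> \int[mu]_x g x.
Proof.
move=> ig; apply: fine_cvg; rewrite fineK; last exact: integrable_fin_num.
have mg := measurable_int _ ig.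
rewrite [X in X @ _ --> _](_ : _ = fun n : nat =>
    \int[mu]_x (((EFin \o g) \_ `[(- n%:R)%R, n%:R%R]%classic) x))%E; last first.
  by apply/funext => n; rewrite -integral_mkcond.
apply: (@dominated_cvg _ _ _ mu _ measurableT
  (fun (n : nat) (x : R) => ((EFin \o g) \_ `[(- n%:R)%R, n%:R%R]%classic) x) (EFin \o g)
  (fun x => `|(EFin \o g) x|%E)) => //=.
- by move=> n; apply/(measurable_restrictT _ _).1 => //; exact: measurable_funTS.
- move=> x _; apply: cvg_near_cst; near=> n.
  rewrite patchE mem_set//= in_itv/= -ler_norml; near: n.
  exact: nbhs_infty_ger.
- exact: (integrable_abse ig).
- by move=> n x _; rewrite patchE; case: ifP => _ //; rewrite /point /= normr0 lee_fin.
Unshelve. all: by end_near. Qed.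

End LineIntegrals.

(** * Differentiating a line integral with respect to the height *)

Section StripDerivative.
Context {R : realType}.
Local Notation mu := (@lebesgue_measure R).

Lemma le_cts_integrable (g B : R -> R) : continuous g -> mu.-integrable [set: R] (EFin \o B) ->
  (forall x, `|g x| <= B x) -> mu.-integrable [set: R] (EFin \o g).
Proof.
move=> cg iB gB; apply: le_integrable iB => //.
  by apply/measurable_EFinP; exact: cts_measurable.
by move=> x _ /=; rewrite lee_fin (le_trans (gB x))// ler_norm.
Qed.

Lemma integrable_EFinB (g h : R -> R) : mu.-integrable [set: R] (EFin \o g) ->
  mu.-integrable [set: R] (EFin \o h) -> mu.-integrable [set: R] (EFin \o (fun x => g x - h x)).
Proof.
move=> ig ih; rewrite (_ : EFin \o _ = (EFin \o g) \- (EFin \o h))%E.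
  exact: integrableB.
by apply/funext => x /=; rewrite EFinB.
Qed.

Lemma integrable_EFinZ (k : R) (g : R -> R) : mu.-integrable [set: R] (EFin \o g) ->
  mu.-integrable [set: R] (EFin \o (fun x => k * g x)).
Proof.
move=> ig; rewrite (_ : EFin \o _ = fun x => k%:E * (EFin \o g) x)%E.
  exact: integrableZl.
by apply/funext => x /=; rewrite -EFinM.
Qed.

(** Green's formula on the rectangles with base [-n, n] and height from
    [y1] to [t]: the fluxes through the vertical sides vanish in the limit
    since [B] does, so that the integral of [Q] over the line of height [t]
    is a constant plus the integral of [D] over a strip. The latter is
    differentiated under the integral sign, [B] being a majorant. *)
Lemma strip_derivative (P Q D : R -> R -> R) (B : R -> R) (y1 y2 y : R) :
  cont2 P -> cont2 Q -> cont2 D -> 0 < y1 ->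
  (forall a b c d, a <= b -> c <= d -> 0 < c -> defect P Q D a b c d = 0) ->
  mu.-integrable [set: R] (EFin \o B) ->
  (forall e, 0 < e -> exists T, forall x, T <= `|x| -> B x <= e) ->
  (forall x y, y1 <= y <= y2 -> [/\ `|P x y| <= B x, `|Q x y| <= B x & `|D x y| <= B x]) ->
  y1 < y < y2 ->
  is_derive y 1 (fun y => \int[mu]_x Q x y) (\int[mu]_x D x y).
Proof.
move=> cP cQ cD y10 def0 iB Binf bnd /andP[y1y yy2].
have B0 x : 0 <= B x.
  have y11 : y1 <= y1 <= y2 by rewrite lexx ltW// (lt_trans y1y).
  by have [h _ _] := bnd x y1 y11; exact: le_trans h.
have cy (g : R -> R -> R) t : cont2 g -> y1 <= t -> continuous (g ^~ t).
  by move=> cg y1t x; apply: cont2_x => //; exact: lt_le_trans y1t.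
pose I x t := \int[mu]_(s in `[y1, t]) D x s.
have cI t : continuous (I ^~ t) by move=> x; exact: cont2_int_continuous.
have IB x t : y1 <= t <= y2 -> `|I x t| <= (t - y1) * B x.
  move=> /andP[y1t ty2]; rewrite mulrC; apply: itv_int_bound => //; first exact: cont2_cts_y.
  by move=> s /andP[h1 h2]; have [|_ _] := bnd x s; rewrite ?h1 ?(le_trans h2).
have iBk k : mu.-integrable [set: R] (EFin \o (fun x => k * B x)) by exact: integrable_EFinZ.
have iI t : y1 <= t <= y2 -> mu.-integrable [set: R] (EFin \o (I ^~ t)).
  by move=> ht; apply: le_cts_integrable (iBk (t - y1)) _ => // x; exact: IB.
have iQ t : y1 <= t <= y2 -> mu.-integrable [set: R] (EFin \o (Q ^~ t)).
  move=> ht; apply: le_cts_integrable iB _ => [|x]; first by apply: cy => //; case/andP: ht.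
  by have [] := bnd x t ht.
have y11 : y1 <= y1 <= y2 by rewrite lexx ltW// (lt_trans y1y).
have key t : y1 <= t <= y2 -> \int[mu]_x Q x t = \int[mu]_x Q x y1 + \int[mu]_x I x t.
  move=> ht; have /andP[y1t ty2] := ht.
  have t0 : 0 < t by exact: lt_le_trans y1t.
  (* The integral of g over [-n, n] is minus the flux through the vertical
     sides. *)
  pose g x := (Q x t - Q x y1) - I x t.
  have ig : mu.-integrable [set: R] (EFin \o g).
    by apply: integrable_EFinB; [apply: integrable_EFinB; exact: iQ|exact: iI].
  have : \int[mu]_x g x = 0.
    have h1 := cvg_sym_itv_int ig.
    apply: (cvg_unique _ h1) => //.
    apply/cvgrPdist_le => e e0.
    have e' : 0 < e / (2 * (t - y1 + 1)) by rewrite divr_gt0// mulr_gt0//; lra.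
    have [T HT] := Binf _ e'.
    near=> n; rewrite sub0r normrN.
    have nT : T <= n%:R by near: n; exact: nbhs_infty_ger.
    have n0 : (0 : R) <= n%:R by [].
    have nn : - n%:R <= n%:R :> R by lra.
    have hu : `|\int[mu]_(s in `[y1, t]) (P n%:R s - P (- n%:R) s)| <= e / (t - y1 + 1) * (t - y1).
      apply: itv_int_bound => //; first exact: flux_cts_y.
      move=> s /andP[h2 h3]; have hs : y1 <= s <= y2 by rewrite h2 (le_trans h3).
      have [k1 _ _] := bnd n%:R s hs; have [k2 _ _] := bnd (- n%:R) s hs.
      have m1 : B n%:R <= e / (2 * (t - y1 + 1)) by apply: HT; rewrite ger0_norm.
      have m2 : B (- n%:R) <= e / (2 * (t - y1 + 1)) by apply: HT; rewrite normrN ger0_norm.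
      have -> : e / (t - y1 + 1) = e / (2 * (t - y1 + 1)) + e / (2 * (t - y1 + 1)).
        by field; rewrite gt_eqF//; lra.
      by apply: le_trans (ler_normB _ _) _; apply: lerD; [exact: le_trans k1 m1|exact: le_trans k2 m2].
    have := def0 (- n%:R) n%:R y1 t nn y1t y10; rewrite /defect /flux.
    have -> : \int[mu]_(x in `[- n%:R, n%:R]) g x =
       \int[mu]_(x in `[- n%:R, n%:R]) (Q x t - Q x y1) - dint (- n%:R) n%:R y1 t D.
      rewrite /g itv_intB//; first exact: flux_cts_x.
      exact: cts_cts_on.
    have reg (u v w : R) : u + v - w = 0 -> v - w = - u by clear; lra.
    move=> /reg ->; rewrite normrN; apply: le_trans hu _.
    rewrite -mulrA ger_pMr// mulrC ler_pdivrMr; last by move: y1t; clear; lra.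
    by clear; lra.
  rewrite /g RintegralB//; last exact: iI.
    rewrite RintegralB//; [|exact: iQ..].
    by move: (\int[mu]_x _) (\int[mu]_x _) (\int[mu]_x _) => u v w; clear; lra.
  by apply: integrable_EFinB; exact: iQ.
have dI x t : y1 < t < y2 -> derivable (I x) t 1 /\ (I x)^`() t = D x t.
  move=> /andP[h1 h2]; apply: (@continuous_FTC1_closed _ _ y1 t y2) => //.
    exact/cts_on_integrable/cont2_cts_y.
  by apply: cont2_y => //; exact: lt_trans h1.
have oc t : `]y1, y2[%classic t -> y1 < t < y2 by rewrite /= in_itv.
have oc' t : `]y1, y2[%classic t -> y1 <= t <= y2.
  by move=> /oc/andP[h1 h2]; rewrite !ltW.
have yI : `]y1, y2[%classic y by rewrite /= in_itv/= y1y.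
have d1E t x : `]y1, y2[%classic t -> partial1of2 (fun t x => I x t) t x = D x t.
  by move=> /oc ht; rewrite /partial1of2; have [_] := dI x t ht.
have der : is_derive y 1 (fun t => \int[mu]_x I x t) (\int[mu]_x D x y).
  have h := @cvg_differentiation_under_integral R _ _ mu (fun t x => I x t) setT measurableT y y1 y2 yI
    (fun t ht => iI t (oc' t ht)) (fun t x ht _ => (dI x t (oc t ht)).1) B B0 iB.
  have Dub t x : `]y1, y2[%classic t -> setT x -> `|partial1of2 (fun t x => I x t) t x| <= B x.
    by move=> /[dup] ht /oc' /(bnd x)[_ _ hb] _; rewrite d1E.
  have e : \int[mu]_x partial1of2 (fun t x => I x t) y x = \int[mu]_x D x y.
    by apply: eq_Rintegral => x _; exact: d1E.
  have {}h := h Dub; rewrite e in h.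
  have {}h : (fun t => t^-1 *: (\int[mu]_x I x (t *: 1 + y) - \int[mu]_x I x y)) @ 0^' --> \int[mu]_x D x y.
    by under eq_fun do rewrite scaler1.
  by split; [apply/cvg_ex; exists (\int[mu]_x D x y)|apply/cvg_lim].
have der2 : is_derive y 1 (fun t => \int[mu]_x Q x y1 + \int[mu]_x I x t) (\int[mu]_x D x y).
  by rewrite -[\int[mu]_x D x y]add0r; apply: is_deriveD.
apply: near_eq_is_derive der2.
near=> t; apply/esym/key/oc'; near: t.
by apply: near_in_itvoo; rewrite in_itv/= y1y.
Unshelve. all: by end_near. Qed.

End StripDerivative.

(** * Exchanging the order of integration *)

Section Swap.
Context {R : realType}.
Local Notation mu := (@lebesgue_measure R).
Implicit Types (a b c d x y : R) (g : R -> R -> R).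

Lemma cont2_unif_x g y a b e : 0 < y -> 0 < e -> cont2 g ->
  \forall y' \near y, forall x, a <= x <= b -> `|g x y' - g x y| < e.
Proof.
move=> y0 e0 H.
have /compact_near_coveringP := @segment_compact R a b.
move/(_ R (nbhs y) (fun y' x => `|g x y' - g x y| < e) _) => K.
have /K : forall x : R, `[a, b] x ->
    \forall x' \near x & y' \near y, `|g x' y' - g x' y| < e.
  move=> x _; have e20 : 0 < e / 2 by rewrite divr_gt0.
  have /cvgrPdist_lt/(_ _ e20) [[U V] /= [xU yV] UV] := H x y y0.
  exists (U, V) => //= -[x' y'] /= [Ux' Vy'].
  have /= h1 := UV (x', y') (conj Ux' Vy').
  have /= h2 := UV (x', y) (conj Ux' (nbhs_singleton yV)).
  have -> : g x' y' - g x' y = (g x y - g x' y) - (g x y - g x' y') by ring.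
  by rewrite (le_lt_trans (ler_normB _ _))// [e]splitr ltrD.
apply: filterS => y' /= Ky x /andP[cy yd]; apply: Ky.
by rewrite /= in_itv/= cy.
Qed.

Lemma cont2_int_continuous_y g y a b : 0 < y -> cont2 g ->
  {for y, continuous (fun y => \int[mu]_(x in `[a, b]) g x y)}.
Proof.
move=> y0 H; apply/cvgrPdist_lt => e e0.
have [ab|ba] := leP a b; last first.
  rewrite set_itv_ge ?bnd_simp -?ltNge//.
  by apply: nearW => z; rewrite !Rintegral_set0 subrr normr0.
have d0 : 0 < b - a + 1 by lra.
have e10 : 0 < e / (b - a + 1) by rewrite divr_gt0.
have K := cont2_unif_x a b y0 e10 H.
near=> y'.
have y'0 : 0 < y' by near: y'; exact: (lt_nbhsr y0).
have K2 : forall x, a <= x <= b -> `|g x y' - g x y| < e / (b - a + 1).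
  by near: y'; exact: K.
rewrite -itv_intB; [|exact: cont2_cts_x..].
have /le_lt_trans H0 : `|\int[mu]_(x in `[a, b]) (g x y - g x y')| <= e / (b - a + 1) * (b - a).
  apply: itv_int_bound => //.
    by move=> x hx; apply: cvgB; apply: cont2_cts_x hx.
  by move=> x hx; rewrite distrC ltW// K2.
apply: H0; rewrite -mulrA gtr_pMr// mulrC ltr_pdivrMr//; lra.
Unshelve. all: by end_near. Qed.

Lemma cont2_int_cts_y g a b c d : 0 < c -> cont2 g ->
  cts_on c d (fun y => \int[mu]_(x in `[a, b]) g x y).
Proof.
by move=> c0 cg y /andP[cy _]; apply: cont2_int_continuous_y => //; exact: lt_le_trans cy.
Qed.

Definition dint_yx a b c d g := \int[mu]_(y in `[c, d]) \int[mu]_(x in `[a, b]) g x y.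

(** Both iterated integrals are additive and, on a small rectangle, close
    to its area times the value at a point; bisection shows that they
    agree. *)
Lemma dint_swap g a b c d : cont2 g -> a <= b -> c <= d -> 0 < c ->
  dint a b c d g = dint_yx a b c d g.
Proof.
move=> cg ab cd c0; apply/eqP; rewrite -subr_eq0; apply/eqP.
have regroup (x1 x2 x3 x4 : R) : x1 + x2 - (x3 + x4) = x1 - x3 + (x2 - x4) by ring.
apply: (@additive_rect_eq0 _ (fun a b c d => dint a b c d g - dint_yx a b c d g)) => //.
- move=> m a' b' c' d' am mb c'0 cd'; rewrite (dint_splitx _ am mb)//.
  have -> : dint_yx a' b' c' d' g = dint_yx a' m c' d' g + dint_yx m b' c' d' g.
    rewrite /dint_yx -itv_intD; [|exact: cont2_int_cts_y..].
    apply: eq_Rintegral => y; rewrite inE/= in_itv/= => /andP[cy _].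
    by apply: itv_int_split => //; apply: cont2_cts_x => //; exact: lt_le_trans cy.
  exact: regroup.
- move=> m a' b' c' d' cm md c'0; rewrite (dint_splity _ _ cm md)//.
  have -> : dint_yx a' b' c' d' g = dint_yx a' b' c' m g + dint_yx a' b' m d' g.
    by apply: itv_int_split => //; exact: cont2_int_cts_y.
  exact: regroup.
move=> x0 y0 _ /andP[cy _] e e0.
have y00 : 0 < y0 by exact: lt_le_trans cy.
have e20 : 0 < e / 2 by rewrite divr_gt0.
have /cvgrPdist_lt/(_ _ e20)/nbhs_ballP[r /= r0 Hr] := @cg x0 y0 y00.
exists r => // a' b' c' d' /andP[ax xb] /andP[cy' yd] c'0 abr cdr.
have ab' : a' <= b' by exact: le_trans xb.
have cd' : c' <= d' by exact: le_trans yd.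
have near x y : a' <= x <= b' -> c' <= y <= d' -> `|g x y - g x0 y0| <= e / 2.
  move=> /andP[h1 h2] /andP[h3 h4]; rewrite distrC ltW//; apply: (Hr (x, y)).
  by split => /=; rewrite -ball_normE /ball_ /= ltr_norml; apply/andP; split; lra.
have kc : cont2 (fun _ _ => g x0 y0) by exact: cont2_cst.
have h1 : `|dint a' b' c' d' g - g x0 y0 * (d' - c') * (b' - a')| <= e / 2 * (d' - c') * (b' - a').
  by rewrite -dint_cst// -dintB//; apply: dint_bound => //; exact: cont2B.
have h2 : `|dint_yx a' b' c' d' g - g x0 y0 * (b' - a') * (d' - c')| <= e / 2 * (b' - a') * (d' - c').
  rewrite -(itv_int_cst (g x0 y0 * (b' - a')) cd') /dint_yx -itv_intB; last 2 first.
  - exact: cont2_int_cts_y.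
  - by move=> y _; apply: cvg_cst.
  apply: itv_int_bound => //.
    by move=> y hy; apply: cvgB; [exact: cont2_int_cts_y hy|apply: cvg_cst].
  move=> y hy; have y'0 : 0 < y by case/andP: hy => h _; exact: lt_le_trans h.
  rewrite -(itv_int_cst (g x0 y0) ab') -itv_intB; last 2 first.
  - exact: cont2_cts_x.
  - by move=> x _; apply: cvg_cst.
  apply: itv_int_bound => //.
    by move=> x hx; apply: cvgB; [exact: cont2_cts_x hx|apply: cvg_cst].
  by move=> x hx; exact: near.
have -> : dint a' b' c' d' g - dint_yx a' b' c' d' g =
  (dint a' b' c' d' g - g x0 y0 * (d' - c') * (b' - a')) - (dint_yx a' b' c' d' g - g x0 y0 * (b' - a') * (d' - c')).
  by move: (dint _ _ _ _ _) (dint_yx _ _ _ _ _) => u v; clear; ring.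
apply: le_trans (ler_normB _ _) _; apply: le_trans (lerD h1 h2) _.
have k0 : 0 <= b' - a' by rewrite subr_ge0.
have l0 : 0 <= d' - c' by rewrite subr_ge0.
move: k0 l0; move: (b' - a') (d' - c') => k l k0 l0.
have -> : e / 2 * l * k + e / 2 * k * l = e * (k * l) by field.
by rewrite ler_pM2l//; have := mulr_ge0 k0 l0; have := sqr_ge0 k; have := sqr_ge0 l; clear; nra.
Qed.

Lemma itv_int_shift (g : R -> R) t a b : a <= b -> continuous g ->
  \int[mu]_(x in `[a, b]) g (x + t) = \int[mu]_(x in `[a + t, b + t]) g x.
Proof.
move=> ab cg; pose F x := x + t.
have dF x : is_derive x 1 F 1.
  by rewrite /F; have := is_deriveD (is_derive_id x (1 : R)) (is_derive_cst t x (1 : R)); rewrite addr0.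
have F1 : F^`()%classic = cst 1.
  by apply/funext => x; rewrite derive1E; have [_] := dF x.
have cF : continuous F.
  by move=> x; apply: differentiable_continuous; apply/derivable1_diffP; exact: (@ex_derive _ _ _ _ _ _ _ (dF x)).
rewrite /Rintegral; congr fine.
rewrite -[RHS]/(\int[mu]_(x in `[F a, F b]) (g x)%:E)%E.
rewrite (@integration_by_substitution_increasing _ F)//.
- by apply: eq_integral => x _; rewrite F1 /= mulr1.
- by move=> x y _ _ xy; rewrite /F ltrD2r.
- by rewrite F1 => x _; exact: cst_continuous.
- by rewrite F1; exact: is_cvg_cst.
- by rewrite F1; exact: is_cvg_cst.
- split.
  + by move=> x _; exact: (@ex_derive _ _ _ _ _ _ _ (dF x)).
  + by apply: cvg_at_right_filter; exact: cF.
  + by apply: cvg_at_left_filter; exact: cF.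
- exact: continuous_subspaceT.
Qed.

End Swap.

(** * A majorant on horizontal strips *)

Section Domination.
Context {R : realType}.
Local Notation mu := (@lebesgue_measure R).
Local Notation N := (@Normc.normc R).
Implicit Types (a b c d x y : R).

(** Young's inequality [p l^(p-1) t <= t^p + (p - 1) l^p], applied
    pointwise with [l] the mean of [g]. *)
Lemma dint_powR_jensen (g : R -> R -> R) (p : R) a b c d : cont2 g ->
  cont2 (fun x y => g x y `^ p) -> 1 < p -> a < b -> c < d -> 0 < c ->
  (forall x y, a <= x <= b -> c <= y <= d -> 0 <= g x y) ->
  dint a b c d g `^ p <= ((d - c) * (b - a)) `^ (p - 1) * dint a b c d (fun x y => g x y `^ p).
Proof.
move=> cg cgp p1 ab cd c0 g0.
set m := (d - c) * (b - a); have m0 : 0 < m by rewrite mulr_gt0 ?subr_gt0.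
have J0 : 0 <= dint a b c d g by exact: dint_ge0.
pose l := dint a b c d g / m.
have l0 : 0 <= l by exact: divr_ge0 J0 (ltW m0).
have p0 : 0 < p by lra.
have p10 : 0 < p - 1 by lra.
have pn : p != 0 by rewrite gt_eqF.
have p1n : p - 1 != 0 by rewrite gt_eqF.
(* q is the exponent conjugate to p. *)
have young t : 0 <= t -> p * l `^ (p - 1) * t - t `^ p <= (p - 1) * l `^ p.
  move=> t0; pose q := p / (p - 1).
  have q0 : 0 < q by rewrite divr_gt0.
  have := @conjugate_powR _ t (l `^ (p - 1)) p q t0 (powR_ge0 _ _) p0 q0.
  have -> : p^-1 + q^-1 = 1 by rewrite /q; field; rewrite pn p1n.
  rewrite -powRrM; have -> : (p - 1) * q = p by rewrite /q; field.
  move=> /(_ erefl) h.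
  have : p * (t * l `^ (p - 1)) <= p * (t `^ p / p + l `^ p / q) by rewrite ler_pM2l.
  have -> : p * (t `^ p / p + l `^ p / q) = t `^ p + (p - 1) * l `^ p.
    by rewrite /q; field; rewrite pn p1n.
  by move: (l `^ _) (l `^ _) (t `^ _) => *; lra.
have h1 : dint a b c d (fun x y => p * l `^ (p - 1) * g x y - g x y `^ p) <= (p - 1) * l `^ p * m.
  rewrite /m mulrA -(dint_cst _ (ltW ab) (ltW cd)); apply: le_dint => //.
  - by apply: cont2B => //; apply: cont2M => //; exact: cont2_cst.
  - exact: cont2_cst.
  - by move=> x y hx hy; exact/young/g0.
rewrite dintB// in h1; last by apply: cont2M => //; exact: cont2_cst.
rewrite dintZ// in h1.
have lm : dint a b c d g = l * m by rewrite /l divfK// gt_eqF.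
have lp : l * l `^ (p - 1) = l `^ p by rewrite mulr_powRB1.
have mp : m * m `^ (p - 1) = m `^ p by rewrite mulr_powRB1// ltW.
move: h1; rewrite lm (powRM p l0 (ltW m0)) -mp.
move: (dint _ _ _ _ _) => J h1.
have h2 : l `^ p * m <= J.
  have : p * l `^ (p - 1) * (l * m) = p * l `^ p * m by rewrite -lp; ring.
  by move: h1; move: (l `^ p) (p * l `^ (p - 1) * (l * m)) => *; lra.
have -> : l `^ p * (m * m `^ (p - 1)) = m `^ (p - 1) * (l `^ p * m) by ring.
by apply: ler_wpM2l => //; exact: powR_ge0.
Qed.

Variables (f f' : R[i] -> R[i]) (p : R).
Hypotheses (hf : cderiv f f') (p2 : 2 <= p).
Variable K : R.
Hypothesis Kint : forall y, 0 < y -> mu.-integrable [set: R] (EFin \o (fun x => Mass f p (x +i* y))).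
Hypothesis Kbound : forall y, 0 < y -> \int[mu]_x Mass f p (x +i* y) <= K.

Let fholo : holo_uhp f.
Proof. exact: cderiv_holo hf. Qed.

Let p_gt1 : 1 < p.
Proof. by move: p2; lra. Qed.

Lemma Mass_ge0 z : 0 <= Mass f p z. Proof. exact: powR_ge0. Qed.

Lemma itv_int_le_line (g : R -> R) a b : continuous g -> (forall x, 0 <= g x) ->
  mu.-integrable [set: R] (EFin \o g) -> \int[mu]_(x in `[a, b]) g x <= \int[mu]_x g x.
Proof.
move=> cg g0 ig; rewrite -lee_fin !EFin_Rintegral//; last exact/cts_on_integrable/cts_cts_on.
apply: ge0_subset_integral => //.
  by apply/measurable_EFinP; exact: cts_measurable.
by move=> x _; rewrite lee_fin.
Qed.

Section Strip.
Variables (c d : R).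
Hypotheses (c0 : 0 < c) (cd : c <= d).

Let G x := \int[mu]_(y in `[c, d]) Mass f p (x +i* y).

Lemma strip_mass_cts : continuous G.
Proof. by move=> x; apply: (cont2_int_continuous (g := fun x y => Mass f p (x +i* y))) => //; exact: Mass_cont2 hf p2. Qed.

Lemma strip_mass_ge0 x : 0 <= G x.
Proof. by apply: Rintegral_ge0 => y _; exact: Mass_ge0. Qed.

Lemma strip_mass_bound a b : a <= b -> \int[mu]_(x in `[a, b]) G x <= K * (d - c).
Proof.
move=> ab; have cM := Mass_cont2 hf p2.
rewrite -[X in X <= _]/(dint a b c d (fun x y => Mass f p (x +i* y))) dint_swap//.
rewrite -(itv_int_cst K cd); apply: le_Rintegral => //.
- exact/cts_on_integrable/cont2_int_cts_y.
- by apply: cts_on_integrable => y _; apply: cvg_cst.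
- move=> y; rewrite /= in_itv/= => /andP[cy _].
  have y0 : 0 < y by exact: lt_le_trans c0 cy.
  apply: le_trans (Kbound y0); apply: itv_int_le_line; [|by move=> x; exact: Mass_ge0|exact: Kint].
  by move=> x; apply: (cont2_x (g := fun x y => Mass f p (x +i* y))).
Qed.

Lemma strip_mass_integrable : mu.-integrable [set: R] (EFin \o G).
Proof.
apply: (@cts_ge0_integrable _ _ (K * (d - c))); [exact: strip_mass_cts|exact: strip_mass_ge0|].
by move=> n; apply: strip_mass_bound; have : (0 : R) <= n%:R by []; move=> ?; lra.
Qed.

Variable r : R.
Hypothesis r0 : 0 < r.

(** Mass of the strip above the interval of length [4 r] around [x]. The
    variable of integration is shifted to the positive interval from [r] to
    [5 r], where joint continuity is available; [windowE] is the natural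
    form. *)
Definition window x := \int[mu]_(t in `[r, 5 * r]) G (x + (t - 3 * r)).

Lemma windowE x : window x = \int[mu]_(s in `[x - 2 * r, x + 2 * r]) G s.
Proof.
have h : r <= 5 * r by move: r0; lra.
rewrite /window; under eq_Rintegral do rewrite addrCA.
rewrite (itv_int_shift (x - 3 * r) h strip_mass_cts).
have -> : r + (x - 3 * r) = x - 2 * r by ring.
by have -> : 5 * r + (x - 3 * r) = x + 2 * r by ring.
Qed.

Let shifted_cont2 : cont2 (fun x t => G (x + (t - 3 * r))).
Proof.
move=> x t _; have := @strip_mass_cts (x + (t - 3 * r)).
apply: cvg_comp; apply: cvgD; first exact: cvg_fst.
by apply: cvgB; [exact: cvg_snd|exact: cvg_cst].
Qed.

Lemma window_cts : continuous window.
Proof. by move=> x; exact: cont2_int_continuous r0 shifted_cont2. Qed.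

Lemma window_ge0 x : 0 <= window x.
Proof. by apply: Rintegral_ge0 => t _; exact: strip_mass_ge0. Qed.

(** Exchanging the integrations in [x] and [t] leaves integrals of [G] over
    translated intervals, all bounded by the mass of the strip. *)
Lemma window_integrable : mu.-integrable [set: R] (EFin \o window).
Proof.
have r5 : r <= 5 * r by move: r0; lra.
apply: (@cts_ge0_integrable _ _ (K * (d - c) * (5 * r - r))); [exact: window_cts|exact: window_ge0|].
move=> n; have nn : - n%:R <= n%:R :> R by have : (0 : R) <= n%:R by []; move=> ?; lra.
rewrite -[X in X <= _]/(dint (- n%:R) n%:R r (5 * r) (fun x t => G (x + (t - 3 * r)))) dint_swap//.
rewrite -(itv_int_cst _ r5); apply: le_Rintegral => //.
- exact/cts_on_integrable/cont2_int_cts_y.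
- by apply: cts_on_integrable => y _; apply: cvg_cst.
- move=> t _; rewrite (itv_int_shift _ nn strip_mass_cts).
  by apply: strip_mass_bound; rewrite lerD2r.
Qed.

(** The window of a far point is disjoint from [-n, n], which already
    carries almost all of the mass. *)
Lemma window_vanishes e : 0 < e -> exists T, forall x, T <= `|x| -> window x <= e.
Proof.
move=> e0; have iG := strip_mass_integrable.
have /cvgrPdist_lt/(_ _ e0)[n _ /(_ n (leqnn n))/=] := cvg_sym_itv_int iG.
set E := \int[mu]_x G x; set En := \int[mu]_(x in _) _ => hE.
exists (n%:R + 2 * r) => x hx; rewrite windowE.
have n0 : (0 : R) <= n%:R by [].
have Gc a b : cts_on a b G by exact/cts_cts_on/strip_mass_cts.
have pos a b : 0 <= \int[mu]_(x in `[a, b]) G x by apply: Rintegral_ge0 => s _; exact: strip_mass_ge0.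
have tot a b : \int[mu]_(x in `[a, b]) G x <= E.
  by apply: itv_int_le_line => //; [exact: strip_mass_cts|exact: strip_mass_ge0].
suff h : En + \int[mu]_(s in `[x - 2 * r, x + 2 * r]) G s <= E.
  have reg (u v w : R) : u - v < e -> v + w <= u -> w <= e by move=> ? ?; lra.
  exact: reg (ltr_normlW hE) h.
have rr := r0.
have [x0|x0] := leP 0 x.
  have {}hx : n%:R + 2 * r <= x by move: hx; rewrite ger0_norm.
  have a1 : - n%:R <= n%:R :> R by lra.
  have a2 : n%:R <= x - 2 * r by lra.
  have a3 : x - 2 * r <= x + 2 * r by lra.
  apply: le_trans (tot (- n%:R) (x + 2 * r)).
  rewrite (itv_int_split a1 (le_trans a2 a3) (Gc _ _)) lerD2l.
  by rewrite (itv_int_split a2 a3 (Gc _ _)) lerDr.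
have {}hx : n%:R + 2 * r <= - x by move: hx; rewrite ltr0_norm.
have a1 : - n%:R <= n%:R :> R by lra.
have a2 : x + 2 * r <= - n%:R by lra.
have a3 : x - 2 * r <= x + 2 * r by lra.
apply: le_trans (tot (x - 2 * r) n%:R).
rewrite (itv_int_split (le_trans a3 a2) a1 (Gc _ _)) addrC lerD2r.
by rewrite (itv_int_split a3 a2 (Gc _ _)) lerDl.
Qed.

End Strip.

Lemma box_window r z c d : 0 < r -> 0 < c -> c <= complex.Im z - 2 * r -> complex.Im z + 2 * r <= d ->
  box r z (Mass f p) <= window c d r (complex.Re z).
Proof.
move=> r0 c0 cz zd; have cd : c <= d by lra.
have cM := Mass_cont2 hf p2.
rewrite (windowE d c0 r0).
have a1 : complex.Re z - 2 * r <= complex.Re z + 2 * r by lra.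
have a2 : complex.Im z - 2 * r <= complex.Im z + 2 * r by lra.
apply: (dint_sub (lexx _) a1 (lexx _) cz a2 zd c0 cM).
by move=> x y _ _; exact: Mass_ge0.
Qed.

(** [|f|] and [|f'|] are bounded by a multiple of the mean of [|f|] over a
    square, whose [p]-th power is controlled by the mean of [|f|^p]
    (Jensen). The three fields are homogeneous of degree [p] in [(f, f')],
    so one majorant suffices. *)
Lemma fields_dominated y1 y2 : 0 < y1 -> y1 <= y2 -> exists B : R -> R,
  [/\ mu.-integrable [set: R] (EFin \o B),
      forall e, 0 < e -> exists T, forall x, T <= `|x| -> B x <= e &
      forall x y, y1 <= y <= y2 -> let z := x +i* y in
       [/\ Mass f p z <= B x, p * N (Wfield f f' p z) <= B x & p * Energy f f' p z <= B x]].
Proof.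
move=> y10 y12; pose r := y1 / 4; have r0 : 0 < r by rewrite divr_gt0.
have r4 : y1 = 4 * r by rewrite /r; lra.
have [C C0 HC] := cderiv_estimate r0.
pose c := y1 - 2 * r; pose d := y2 + 2 * r.
have c0 : 0 < c by rewrite /c; lra.
have cd : c <= d by rewrite /c /d; lra.
pose A := p * C `^ p * (4 * r * (4 * r)) `^ (p - 1).
have pp : 0 < p by move: p_gt1; lra.
have A0 : 0 < A by rewrite !mulr_gt0 ?powR_gt0// !mulr_gt0.
have iw := window_integrable c0 cd r0.
exists (fun x => A * window c d r x); split.
- exact: integrable_EFinZ.
- move=> e e0; have [T HT] := window_vanishes c0 cd r0 (divr_gt0 e0 A0).
  by exists T => x /HT; rewrite ler_pdivlMr// mulrC.
move=> x y /andP[h1 h2] z.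
have rz : 2 * r < complex.Im z by rewrite /z /=; lra.
have [hf1 hf2] := HC f f' z hf rz.
set b := box r z _ in hf1 hf2.
have cN : cont2 (fun x y => N (f (x +i* y))) by exact: box_cont2.
have b0 : 0 <= b by apply: dint_ge0 => *; exact: normc_ge0.
have jensen : b `^ p <= (4 * r * (4 * r)) `^ (p - 1) * window c d r x.
  apply: (@le_trans _ _ ((4 * r * (4 * r)) `^ (p - 1) * box r z (Mass f p))); last first.
    apply: ler_wpM2l; first exact: powR_ge0.
    have hz1 : c <= complex.Im z - 2 * r by rewrite /z /c /=; lra.
    have hz2 : complex.Im z + 2 * r <= d by rewrite /z /d /=; lra.
    exact: (box_window r0 c0 hz1 hz2).
  have -> : 4 * r * (4 * r) = (complex.Im z + 2 * r - (complex.Im z - 2 * r)) *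
      (complex.Re z + 2 * r - (complex.Re z - 2 * r)) by ring.
  apply: dint_powR_jensen => //; [exact: Mass_cont2 hf p2|lra|lra|lra|].
  by move=> *; exact: normc_ge0.
have Cb : 0 <= C * b by rewrite mulr_ge0// ltW.
have cap : p * (C * b) `^ p <= A * window c d r x.
  rewrite (powRM p (ltW C0) b0).
  have -> : A * window c d r x = p * (C `^ p * ((4 * r * (4 * r)) `^ (p - 1) * window c d r x)).
    by rewrite /A !mulrA.
  by apply: ler_wpM2l (ltW pp) _ _ _; apply: ler_wpM2l => //; exact: powR_ge0.
have p1 : 1 <= p by rewrite ltW.
have Cbp : 0 <= (C * b) `^ p by exact: powR_ge0.
have pw s : 0 <= s -> N (f z) `^ s <= (C * b) `^ s.
  move=> s0; apply: ge0_ler_powR s0 _ _ _ _ hf1; rewrite nnegrE; [exact: normc_ge0|exact: Cb].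
have p10 : 0 <= p - 1 by move: p1; lra.
have p20 : 0 <= p - 2 by move: p2; lra.
split.
- apply: le_trans cap; apply: le_trans (pw _ (ltW pp)) _.
  by rewrite ler_peMl.
- apply: le_trans cap; rewrite ler_pM2l// /Wfield /Ufield !Normc.normcM normc_conj normc_real.
  rewrite ger0_norm ?powR_ge0// -/(psi f p z) psi_norm//.
  rewrite -(@mulr_powRB1 _ (C * b))// mulrC.
  by apply: ler_pM => //; [exact: normc_ge0|exact: powR_ge0|exact: pw].
- apply: le_trans cap; rewrite ler_pM2l// /Energy /psi.
  have e2 : (C * b) `^ p = (C * b) `^ (p - 2) * (C * b) ^+ 2.
    by rewrite powR_mul_sqr.
  rewrite e2; apply: ler_pM => //; [exact: powR_ge0|exact: sqr_ge0|exact: pw|].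
  by rewrite ler_sqr ?nnegrE ?normc_ge0.
Qed.

End Domination.

(** * Monotonicity and logarithmic convexity of the means *)

Section MeanGrowth.
Context {R : realType}.
Local Notation mu := (@lebesgue_measure R).
Local Notation N := (@Normc.normc R).
Implicit Types (a b c d x y : R).

Lemma cts_ge0_int_eq0 (g : R -> R) : continuous g -> (forall x, 0 <= g x) ->
  mu.-integrable [set: R] (EFin \o g) -> \int[mu]_x g x = 0 -> forall x, g x = 0.
Proof.
move=> cg g0 ig int0 x; apply/eqP; rewrite -[_ == _]negbK; apply/negP => gx.
have {}gx : 0 < g x by rewrite lt_def gx g0.
have e0 : 0 < g x / 2 by rewrite divr_gt0.
have /cvgrPdist_lt/(_ _ e0)/nbhs_ballP[r /= r0 Hr] := cg x.
have : g x / 2 * (x + r / 2 - (x - r / 2)) <= \int[mu]_(t in `[x - r / 2, x + r / 2]) g t.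
  have xr : x - r / 2 <= x + r / 2 by lra.
  rewrite -(itv_int_cst _ xr); apply: le_Rintegral => //.
  - by apply: cts_on_integrable => t _; apply: cvg_cst.
  - exact/cts_on_integrable/cts_cts_on.
  - move=> t; rewrite /= in_itv/= => /andP[h1 h2].
    have := Hr t; rewrite -ball_normE /ball_ /= => Ht.
    have xt : `|x - t| < r by rewrite ltr_norml; apply/andP; split; lra.
    by have := ltr_normlW (Ht xt); lra.
move=> h; have := le_trans h (itv_int_le_line (x - r / 2) (x + r / 2) cg g0 ig).
rewrite int0 (_ : x + r / 2 - (x - r / 2) = r); last by field.
by have := mulr_gt0 e0 r0; lra.
Qed.

Section WithFunction.
Variables (f f' : R[i] -> R[i]) (p K : R).
Hypotheses (hf : cderiv f f') (p2 : 2 <= p).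
Hypothesis Kint : forall y, 0 < y -> mu.-integrable [set: R] (EFin \o (fun x => Mass f p (x +i* y))).
Hypothesis Kbound : forall y, 0 < y -> \int[mu]_x Mass f p (x +i* y) <= K.

Let p_gt0 : 0 < p.
Proof. by move: p2; lra. Qed.

Let p_ge1 : 1 <= p.
Proof. by move: p2; lra. Qed.

Definition line_mass y := \int[mu]_x Mass f p (x +i* y).
Definition line_flux y := \int[mu]_x - complex.Im (Wfield f f' p (x +i* y)).
Definition line_energy y := \int[mu]_x Energy f f' p (x +i* y).

Let cMass := Mass_cont2 hf p2.
Let cEnergy := Energy_cont2 hf p2.
Let cReW : cont2 (fun x y => complex.Re (Wfield f f' p (x +i* y))).
Proof. by apply: ccont_cont2_Re => z; exact: Wfield_ccont hf p2 z. Qed.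
Let cImW : cont2 (fun x y => complex.Im (Wfield f f' p (x +i* y))).
Proof. by apply: ccont_cont2_Im => z; exact: Wfield_ccont hf p2 z. Qed.

Lemma Energy_ge0 z : 0 <= Energy f f' p z.
Proof. by rewrite mulr_ge0 ?psi_ge0 ?sqr_ge0. Qed.

Lemma line_integrable y : 0 < y ->
  mu.-integrable [set: R] (EFin \o (fun x => complex.Im (Wfield f f' p (x +i* y)))) /\
  mu.-integrable [set: R] (EFin \o (fun x => Energy f f' p (x +i* y))).
Proof.
move=> y0; have [B [iB _ HB]] := fields_dominated hf p2 Kint Kbound y0 (lexx y).
have yy : y <= y <= y by rewrite lexx.
split; apply: le_cts_integrable iB _ => [x|x].
- exact: cont2_x y0 cImW.
- have [_ h _] := HB x y yy; apply: le_trans h; apply: le_trans (ler_normc_Im _) _.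
  by rewrite ler_peMl ?normc_ge0.
- exact: cont2_x y0 cEnergy.
- have [_ _ h] := HB x y yy; apply: le_trans h; rewrite ger0_norm ?Energy_ge0//.
  by rewrite ler_peMl ?Energy_ge0.
Qed.

Let halves y : 0 < y -> [/\ 0 < y / 2, y / 2 <= 2 * y & y / 2 < y < 2 * y].
Proof. by move=> y0; split; [rewrite divr_gt0| |apply/andP; split]; lra. Qed.

Lemma is_derive_line_mass y : 0 < y -> is_derive y 1 line_mass (p * line_flux y).
Proof.
move=> y0; have [y1 y12 yy] := halves y0.
have [B [iB Binf HB]] := fields_dominated hf p2 Kint Kbound y1 y12.
have -> : p * line_flux y = \int[mu]_x (- p * complex.Im (Wfield f f' p (x +i* y))).
  have [iI _] := line_integrable y0.
  rewrite RintegralZl// /line_flux mulNr -mulrN; congr (_ * _).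
  under eq_Rintegral do rewrite -mulN1r.
  by rewrite RintegralZl// mulN1r.
apply: (@strip_derivative _ (fun _ _ => 0) (fun x y => Mass f p (x +i* y))
  (fun x y => - p * complex.Im (Wfield f f' p (x +i* y))) B (y / 2) (2 * y)) => //.
- exact: cont2_cst.
- by apply: cont2M; [exact: cont2_cst|exact: cImW].
- by move=> *; exact: defect_mass hf p2 _ _ _ _ _ _ _.
- move=> x t ht; have [h1 h2 _] := HB x t ht.
  rewrite normr0 ger0_norm ?powR_ge0//; split => //; first exact: le_trans (Mass_ge0 f p _) h1.
  apply: le_trans h2; by rewrite normrM normrN (gtr0_norm p_gt0) ler_pM2l ?p_gt0//; exact: ler_normc_Im.
Qed.

Lemma is_derive_line_flux y : 0 < y -> is_derive y 1 line_flux (p * line_energy y).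
Proof.
move=> y0; have [y1 y12 yy] := halves y0.
have [B [iB Binf HB]] := fields_dominated hf p2 Kint Kbound y1 y12.
have -> : p * line_energy y = \int[mu]_x (p * Energy f f' p (x +i* y)).
  by have [_ iE] := line_integrable y0; rewrite RintegralZl.
apply: (@strip_derivative _ (fun x y => complex.Re (Wfield f f' p (x +i* y)))
  (fun x y => - complex.Im (Wfield f f' p (x +i* y)))
  (fun x y => p * Energy f f' p (x +i* y)) B (y / 2) (2 * y)) => //.
- exact: cont2N.
- by apply: cont2M => //; exact: cont2_cst.
- by move=> *; exact: defect_W hf p2 _ _ _ _ _ _ _.
- move=> x t ht; have [_ h2 h3] := HB x t ht.
  have NB : N (Wfield f f' p (x +i* t)) <= B x by apply: le_trans h2; rewrite ler_peMl ?normc_ge0.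
  split; [exact: le_trans (ler_normc_Re _) NB|by rewrite normrN; exact: le_trans (ler_normc_Im _) NB|].
  by rewrite ger0_norm// mulr_ge0 ?Energy_ge0// ltW.
Qed.

(** [|f|^(p-2) |f' + i l f|^2]: the positivity of its integral for all real
    [l] is the Cauchy-Schwarz inequality. *)
Let Qf l z : R := psi f p z * N (f' z + (0 +i* l) * f z) ^+ 2.

Lemma QfE l z : Qf l z = Energy f f' p z + l ^+ 2 * Mass f p z - 2 * l * (- complex.Im (Wfield f f' p z)).
Proof.
have -> : Mass f p z = psi f p z * N (f z) ^+ 2 by rewrite /Mass /psi powR_mul_sqr ?normc_ge0.
rewrite /Qf /Energy /Wfield /Ufield !sqr_normcE.
by move: (psi f p z); case: (f z) => ? ?; case: (f' z) => ? ? s /=; ring.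
Qed.

Lemma int_Qf l y : 0 < y ->
  [/\ mu.-integrable [set: R] (EFin \o (fun x => Qf l (x +i* y))),
      continuous (fun x => Qf l (x +i* y)) &
      \int[mu]_x Qf l (x +i* y) = line_energy y + l ^+ 2 * line_mass y - 2 * l * line_flux y].
Proof.
move=> y0; have [iI iE] := line_integrable y0.
have iM := Kint y0.
have iN : mu.-integrable [set: R] (EFin \o (fun x => - complex.Im (Wfield f f' p (x +i* y)))).
  by rewrite (_ : (fun x => _) = (fun x => -1 * complex.Im (Wfield f f' p (x +i* y)))); [exact: integrable_EFinZ|apply/funext => x; rewrite mulN1r].
have i1 := integrable_EFinZ (l ^+ 2) iM.
have i1' := integrable_EFinZ (- l ^+ 2) iM.
have i2 := integrable_EFinZ (2 * l) iN.
have i3 := integrable_EFinB iE i1'.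
have e : (fun x => Qf l (x +i* y)) = (fun x => (Energy f f' p (x +i* y) - - l ^+ 2 * Mass f p (x +i* y))
   - 2 * l * (- complex.Im (Wfield f f' p (x +i* y)))).
  by apply/funext => x; rewrite QfE; congr (_ + _); rewrite mulNr opprK.
rewrite e; split; first exact: integrable_EFinB.
  move=> x; apply: cvgB; last by apply: cvgM; [exact: cvg_cst|apply: cvgN; exact: cont2_x y0 cImW].
  apply: cvgB; first exact: cont2_x y0 cEnergy.
  by apply: cvgM; [exact: cvg_cst|exact: cont2_x y0 cMass].
by rewrite RintegralB// RintegralB// !RintegralZl// mulNr opprK.
Qed.

Lemma Qf_ge0 l z : 0 <= Qf l z.
Proof. by rewrite mulr_ge0 ?psi_ge0 ?sqr_ge0. Qed.

Lemma quad_ge0 l y : 0 < y -> 0 <= line_energy y + l ^+ 2 * line_mass y - 2 * l * line_flux y.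
Proof.
by move=> y0; have [_ _ <-] := int_Qf l y0; apply: Rintegral_ge0 => x _; exact: Qf_ge0.
Qed.

Lemma line_mass_ge0 y : 0 <= line_mass y.
Proof. by apply: Rintegral_ge0 => x _; exact: Mass_ge0. Qed.

Lemma line_energy_ge0 y : 0 <= line_energy y.
Proof. by apply: Rintegral_ge0 => x _; exact: Energy_ge0. Qed.

Lemma cauchy_schwarz y : 0 < y -> line_flux y ^+ 2 <= line_energy y * line_mass y.
Proof.
move=> y0; have := line_mass_ge0 y; rewrite le_eqVlt => /orP[/eqP M0|M0].
  rewrite -M0 mulr0; have E0 := quad_ge0 0 y0.
  rewrite -M0 !mulr0 !mul0r subr0 addr0 in E0.
  suff -> : line_flux y = 0 by rewrite expr0n.
  apply/eqP; rewrite -[_ == _]negbK; apply/negP => V0.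
  have := quad_ge0 ((line_energy y + 1) / (2 * line_flux y)) y0.
  rewrite -M0 mulr0 addr0 (_ : 2 * ((line_energy y + 1) / (2 * line_flux y)) * line_flux y = line_energy y + 1); last by field.
  by move: (line_energy y) => ?; lra.
have := quad_ge0 (line_flux y / line_mass y) y0.
have -> : line_energy y + (line_flux y / line_mass y) ^+ 2 * line_mass y - 2 * (line_flux y / line_mass y) * line_flux y = (line_energy y * line_mass y - line_flux y ^+ 2) / line_mass y.
  by field; rewrite gt_eqF.
by rewrite pmulr_lge0 ?invr_gt0// subr_ge0.
Qed.

(** Where [f] does not vanish, [f' = - i l f] says that [|f|^2] has zero
    derivative along the line; where it vanishes, this is clear. So [|f|]
    is constant, and a nonzero constant is not integrable. *)
Lemma line_zero y l : 0 < y -> (forall x, Qf l (x +i* y) = 0) -> line_mass y = 0.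
Proof.
move=> y0 HQ.
have z0 x : 0 < complex.Im (x +i* y) by [].
have HQ' x : f (x +i* y) = 0 \/ f' (x +i* y) = - ((0 +i* l) * f (x +i* y)).
  have [fz|fz] := eqVneq (f (x +i* y)) 0; [by left|right].
  have := HQ x; rewrite /Qf => /eqP; rewrite mulf_eq0 => /orP[|].
    by rewrite /psi powR_eq0 normc_eq0 (negbTE fz).
  by rewrite expf_eq0 normc_eq0 /= addr_eq0 => /eqP.
pose g x := N (f (x +i* y)) ^+ 2.
have dg x : is_derive x 1 g 0.
  apply: rdiff_is_derive => e e0.
  have W := wirtingerM (hf (z0 x)) (wirtinger_conj (hf (z0 x))).
  have [r r0 Hr] := W e e0; exists r => // h hr.
  have := Hr h%:C; rewrite normc_real => /(_ hr) hh; apply: le_trans hh.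
  apply: le_trans (ler_normc_Re _); rewrite le_eqVlt; apply/orP; left; apply/eqP; congr `|_|.
  have -> : (x +i* y) + h%:C = (x + h) +i* y by apply/eqP; rewrite eq_complex /= addr0 !eqxx.
  rewrite /g !sqr_normcE; have [->|->] := HQ' x.
    by case: (f ((x + h) +i* y)) => ? ?; case: (f' _) => ? ? /=; ring.
  by case: (f ((x + h) +i* y)) => ? ?; case: (f (x +i* y)) => ? ? /=; ring.
have gc x : g x = g 0.
  have cg t : {for t, continuous g}.
    exact: deriv_continuous (dg t).
  have mv a b : a < b -> g b = g a.
    move=> ab; have [t _] := MVT ab (fun t _ => dg t) (continuous_subspaceT cg).
    by rewrite mul0r => /eqP; rewrite subr_eq0 => /eqP.
  by case: (ltgtP x 0) => [/mv ->|/mv ->|->].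
pose k := Mass f p (0 +i* y).
have mc x : Mass f p (x +i* y) = k.
  have h : N (f (x +i* y)) = N (f (0 +i* y)).
    apply/eqP; rewrite -(@eqrXn2 _ 2) ?normc_ge0//; apply/eqP; exact: gc.
  by rewrite /k /Mass h.
have k0 : 0 <= k by exact: Mass_ge0.
have kn (n : nat) : k * (n%:R - - n%:R) <= line_mass y.
  have nn : - n%:R <= n%:R :> R by have : (0 : R) <= n%:R by []; move=> ?; lra.
  have <- : \int[mu]_(x in `[- n%:R, n%:R]) Mass f p (x +i* y) = k * (n%:R - - n%:R).
    by rewrite -(itv_int_cst k nn); apply: eq_Rintegral => x _; exact: mc.
  apply: itv_int_le_line; [|by move=> x; exact: Mass_ge0|exact: Kint].
  by move=> x; exact: cont2_x y0 cMass.
have k00 : k = 0.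
  apply/eqP; rewrite -[_ == _]negbK; apply/negP => kn0.
  have kp : 0 < k by rewrite lt_def kn0.
  have := kn (Num.truncn (line_mass y / k)).+1.
  have := truncnS_gt (line_mass y / k); rewrite ltr_pdivrMr// => h1 h2.
  have n0 : (0 : R) <= (Num.truncn (line_mass y / k)).+1%:R by [].
  have := mulr_ge0 n0 (ltW kp); lra.
by rewrite /line_mass (@eq_Rintegral _ _ _ _ _ (cst 0)) ?Rintegral_cst ?mul0r// => x _; rewrite mc k00.
Qed.

(** In the case of equality the quadratic form integrates to zero for [l =
    line_flux y / line_mass y]. *)
Lemma cauchy_schwarz_strict y : 0 < y -> 0 < line_mass y -> line_flux y ^+ 2 < line_energy y * line_mass y.
Proof.
move=> y0 M0; rewrite lt_def cauchy_schwarz// andbT; apply/eqP => e.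
have [iq cq intq] := int_Qf (line_flux y / line_mass y) y0.
have : line_mass y = 0.
  apply: (line_zero (l := line_flux y / line_mass y)) => //.
  apply: cts_ge0_int_eq0 cq (fun x => Qf_ge0 _ _) iq _.
  rewrite intq.
  have -> : line_energy y + (line_flux y / line_mass y) ^+ 2 * line_mass y - 2 * (line_flux y / line_mass y) * line_flux y = (line_energy y * line_mass y - line_flux y ^+ 2) / line_mass y.
    by field; rewrite gt_eqF.
  by rewrite e subrr mul0r.
by move: M0 => /[swap] ->; rewrite ltxx.
Qed.

Hypothesis fnz : exists2 z, 0 < complex.Im z & f z != 0.

(** Write [M] for the mean and suppose [M y = 0 < M ys]. For every [e > 0]
    the function [ln (M + e)] is convex, and its slope at [ys] is bounded
    by a constant [k] independent of [e]; hence [M ys + e <= e * expR (k *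
    `|ys - y|)], which fails for small [e]. *)
Lemma line_mass_gt0 y : 0 < y -> 0 < line_mass y.
Proof.
move=> y0; have [[xs ys] /= ys0 fz] := fnz.
have Ms : 0 < line_mass ys.
  rewrite lt_def line_mass_ge0 andbT; apply/eqP => Ms0.
  have : Mass f p (xs +i* ys) = 0.
    have cg : continuous (fun x => Mass f p (x +i* ys)) by move=> x; exact: cont2_x ys0 cMass.
    exact: (cts_ge0_int_eq0 cg (fun x => Mass_ge0 f p (x +i* ys)) (Kint ys0) Ms0 xs).
  by move=> /eqP; rewrite powR_eq0 normc_eq0 (negbTE fz).
rewrite lt_def line_mass_ge0 andbT; apply/eqP => My0.
have yn : y != ys by apply: contraTneq Ms => <-; rewrite My0 ltxx.
pose k := `|p * line_flux ys| / line_mass ys.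
have k0 : 0 <= k by rewrite divr_ge0// ltW.
(* dL is the slope of L = ln (M + e), nondecreasing by Cauchy-Schwarz. *)
have ineq e : 0 < e -> line_mass ys + e <= e * expR (k * `|ys - y|).
  move=> e0; pose L (t : R) := ln (line_mass t + e); pose dL t := p * line_flux t / (line_mass t + e).
  have Me t : 0 < line_mass t + e by rewrite ltr_wpDl ?line_mass_ge0.
  have dLd (t : R) : 0 < t -> is_derive t 1 L (dL t).
    move=> t0.
    have d1 := deriv_add (is_derive_line_mass t0) (deriv_cst e t); rewrite addr0 in d1.
    exact: deriv_ln d1 (Me t).
  have dLm a b : 0 < a -> a < b -> dL a <= dL b.
    move=> a0 ab.
    pose ddL t := (p * (p * line_energy t) * (line_mass t + e) - (p * line_flux t) ^+ 2) / (line_mass t + e) ^+ 2.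
    have H (t : R) : 0 < t -> is_derive t 1 dL (ddL t).
      move=> t0.
      have nz : line_mass t + e != 0 by rewrite gt_eqF.
      have d1 := deriv_add (is_derive_line_mass t0) (deriv_cst e t).
      have d2 := deriv_mul (deriv_cst p t) (is_derive_line_flux t0).
      apply: is_derive_eq (deriv_div d2 d1 nz) _.
      by rewrite /ddL mul0r add0r addr0 expr2.
    have [c [ac cb e1]] := mvt_pos a0 ab H.
    have c0 : 0 < c by exact: lt_trans ac.
    rewrite -subr_ge0 e1 mulr_ge0 ?subr_ge0 ?(ltW ab)//.
    rewrite divr_ge0 ?sqr_ge0// subr_ge0.
    have cs := cauchy_schwarz c0.
    have -> : p * (p * line_energy c) * (line_mass c + e) = p ^+ 2 * (line_energy c * line_mass c) + p ^+ 2 * (line_energy c * e) by ring.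
    rewrite exprMn -[leLHS]addr0 lerD// ?ler_wpM2l ?sqr_ge0//.
    exact: mulr_ge0 (sqr_ge0 _) (mulr_ge0 (line_energy_ge0 c) (ltW e0)).
  have dLk : `|dL ys| <= k.
    rewrite /dL /k normrM normfV (gtr0_norm (Me ys)) ler_wpM2l// lef_pV2 ?posrE//.
    by rewrite lerDl ltW.
  have Lk : L ys - L y <= k * `|ys - y|.
    have [yys|ysy] : y < ys \/ ys < y by move: yn; rewrite neq_lt => /orP[|]; [left|right].
      have [c [ac cb ->]] := mvt_pos y0 yys dLd.
      rewrite gtr0_norm ?subr_gt0// ler_wpM2r ?subr_ge0 ?(ltW yys)//.
      apply: le_trans (dLm c ys (lt_trans y0 ac) cb) _.
      exact: le_trans (ler_norm _) dLk.
    have [c [ac cb e1]] := mvt_pos ys0 ysy dLd.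
    have -> : L ys - L y = - dL c * (y - ys) by rewrite mulNr -e1 opprB.
    have -> : `|ys - y| = y - ys by rewrite distrC gtr0_norm ?subr_gt0.
    apply: ler_wpM2r; first by rewrite subr_ge0 ltW.
    apply: le_trans dLk; rewrite -normrN; apply: le_trans (ler_norm _).
    by rewrite lerN2 dLm.
  have e1 : expR (L ys) = line_mass ys + e by rewrite lnK // posrE; exact: Me.
  have e2 : expR (L y) = e by rewrite /L My0 add0r lnK // posrE.
  by rewrite -e1 -[X in _ <= X * _]e2 -expRD ler_expR -lerBlDl.
pose C := expR (k * `|ys - y|); have C0 : 0 < C by exact: expR_gt0.
have e0 : 0 < line_mass ys / (2 * C) by rewrite divr_gt0// mulr_gt0.
have := ineq _ e0; rewrite -/C.
have -> : line_mass ys / (2 * C) * C = line_mass ys / 2 by field; rewrite gt_eqF.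
by move: e0 Ms; move: (line_mass ys) (line_mass ys / (2 * C)) => u w *; lra.
Qed.

Lemma line_energy_gt0 y : 0 < y -> 0 < line_energy y.
Proof.
move=> y0; have M0 := line_mass_gt0 y0.
have := le_lt_trans (sqr_ge0 (line_flux y)) (cauchy_schwarz_strict y0 M0).
by rewrite pmulr_lgt0.
Qed.

Lemma line_flux_increasing a b : 0 < a -> a < b -> line_flux a < line_flux b.
Proof.
move=> a0 ab; have [c [ac cb e]] := mvt_pos a0 ab is_derive_line_flux.
by rewrite -subr_gt0 e !mulr_gt0 ?subr_gt0// line_energy_gt0// (lt_trans a0).
Qed.

(** The derivative of the mean is increasing; if it were nonnegative
    somewhere, the mean would grow at least linearly. *)
Lemma line_flux_lt0 y : 0 < y -> line_flux y < 0.
Proof.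
move=> y0; rewrite ltNge; apply/negP => V0.
pose y1 := y + 1; have y10 : 0 < y1 by rewrite addr_gt0.
have V1 : 0 < line_flux y1 by apply: le_lt_trans V0 _; apply: line_flux_increasing => //; rewrite ltrDl.
have pV : 0 < p * line_flux y1 by rewrite mulr_gt0.
have KM : 0 <= K by exact: le_trans (line_mass_ge0 y) (Kbound y0).
(* After a time T the linear growth exceeds the bound K. *)
pose T := K / (p * line_flux y1) + 1.
have T0 : 0 < T by rewrite ltr_wpDl// divr_ge0// ltW.
have y1T1 : y1 < y1 + T by rewrite ltrDl.
have [c [ac cb e]] := mvt_pos y10 y1T1 is_derive_line_mass.
have Vc : p * line_flux y1 <= p * line_flux c by rewrite ler_pM2l// ltW// line_flux_increasing.
have : p * line_flux y1 * T <= line_mass (y1 + T) - line_mass y1.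
  by rewrite e addrAC subrr add0r ler_pM2r.
have -> : p * line_flux y1 * T = K + p * line_flux y1 by rewrite /T; field; rewrite !gt_eqF.
have y1T : 0 < y1 + T by rewrite addr_gt0.
rewrite lerBrDr leNgt => /negP; apply; apply: le_lt_trans (Kbound y1T) _.
by rewrite -addrA ltrDl ltr_wpDr ?line_mass_ge0.
Qed.

End WithFunction.
End MeanGrowth.

(** * Primitives vanishing at infinity *)

Section TailPrimitive.
Context {R : realType}.
Local Notation mu := (@lebesgue_measure R).

(** The left-hand side being a real number, the integral is finite: [g] is
    integrable near infinity and [F] is a genuine primitive of [g]. *)
Lemma tail_primitive (g F : R -> R) :
  (forall t : R, 0 < t -> {for t, continuous g}) -> (forall t : R, 0 < t -> 0 < g t) ->
  (forall y : R, 0 < y ->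
    ((F y)%:E = - \int[mu]_(t in `]y, +oo[) (g t)%:E)%E) ->
  [/\ forall y : R, 0 < y -> is_derive y 1 F (g y), forall y : R, 0 < y -> F y < 0 &
      forall e : R, 0 < e -> exists2 y : R, 0 < y & - F y < e].
Proof.
move=> cg g0 FE.
have mg (y : R) : 0 < y -> measurable_fun `]y, +oo[ (EFin \o g).
  move=> y0; apply/measurable_EFinP; apply: open_continuous_measurable_fun => //.
  by move=> x; rewrite inE/= in_itv/= andbT => yx; apply: cg; exact: lt_trans yx.
have gpos (y t : R) : 0 < y -> `]y, +oo[%classic t -> (0 <= (g t)%:E)%E.
  move=> y0 /=; rewrite in_itv/= andbT => yt; rewrite lee_fin.
  exact/ltW/g0/(lt_trans y0).
have FE' (y : R) : 0 < y -> (\int[mu]_(t in `]y, +oo[) (g t)%:E = (- F y)%:E)%E.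
  by move=> y0; rewrite EFinN (FE y y0) oppeK.
have ig (y : R) : 0 < y -> mu.-integrable `]y, +oo[ (EFin \o g).
  move=> y0; apply/integrableP; split; first exact: mg.
  have -> : (\int[mu]_(t in `]y, +oo[) `|(EFin \o g) t| = \int[mu]_(t in `]y, +oo[) (g t)%:E)%E.
    by apply: eq_integral => x; rewrite inE => /(gpos _ _ y0) gx /=; rewrite ger0_norm.
  by rewrite FE'// ltry.
have FR (y : R) : 0 < y -> F y = - \int[mu]_(t in `]y, +oo[) g t.
  by move=> y0; rewrite /Rintegral FE'// opprK.
have FB (a x : R) : 0 < a -> a < x -> F x = F a + \int[mu]_(t in `]a, x]) g t.
  move=> a0 ax; have x0 : 0 < x by exact: lt_trans ax.
  have e : \int[mu]_(t in `]a, +oo[) g t - \int[mu]_(t in `]a, x]) g t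
      = \int[mu]_(t in `]x, +oo[) g t.
    by apply: Rintegral_itvB; rewrite ?bnd_simp//; [exact: ig|exact: ltW].
  by rewrite (FR x)// (FR a)// -e opprB addrC.
have dF (y : R) : 0 < y -> is_derive y 1 F (g y).
  move=> y0; pose a := y / 2.
  have a0 : 0 < a by rewrite divr_gt0.
  have ay : a < y by rewrite /a; lra.
  have [d1 d2] : derivable (fun x => \int[mu]_(t in `]a, x]) g t) y 1 /\
      (fun x => \int[mu]_(t in `]a, x]) g t)^`()%classic y = g y.
    apply: (@continuous_FTC1 _ g (BRight a) y (y + 1)); rewrite ?ltrDl//.
    - by apply: integrableS (ig _ a0) => //; exact: subset_itvl.
    - exact: cg.
  have D1 : is_derive y 1 (fun x => \int[mu]_(t in `]a, x]) g t) (g y).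
    exact: (DeriveDef d1 (etrans (esym (derive1E _ _)) d2)).
  have D := deriv_add (deriv_cst (F a) y) D1; rewrite add0r in D.
  apply: near_eq_is_derive D; near=> x; rewrite -FB//.
  by near: x; exact: lt_nbhsr.
have Fle0 (y : R) : 0 < y -> F y <= 0.
  move=> y0; rewrite -oppr_ge0 -lee_fin -FE'//; apply: integral_ge0 => t; exact: gpos.
split => // [y y0|e e0].
  have yy : y < y + 1 by rewrite ltrDl.
  have [c [ac _]] := mvt_pos y0 yy dF.
  rewrite addrAC subrr add0r mulr1 => ec.
  apply: lt_le_trans (Fle0 (y + 1) _); last by rewrite addr_gt0.
  by rewrite -subr_gt0 ec g0// (lt_trans y0).
have cv : (\int[mu]_(x in `]1%R, (1 + n%:R)%R]) (g x)%:E)%E @[n --> \oo] --> (- F 1)%:E.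
  rewrite -FE'// itv_bndy_bigcup_BRight; apply: ge0_nondecreasing_set_cvg_integral => //.
  - move=> m n mn; rewrite subsetEset; apply: subset_itvl.
    by rewrite bnd_simp lerD2l ler_nat.
  - by move=> n; apply: measurable_funS (mg 1 ltr01) => //; exact: subset_itvl.
  - by move=> n x /= h; apply: (gpos 1) => //; move: h; apply: subset_itvl.
have cv' : (fun n : nat => \int[mu]_(x in `]1, 1 + n%:R]) g x) @ \oo --> - F 1.
  exact: fine_cvg cv.
move/cvgrPdist_lt : cv' => /(_ e e0) [n _ Hn].
exists (1 + n.+1%:R); first by rewrite addr_gt0.
have h1 : (1 : R) < 1 + n.+1%:R by rewrite ltrDl.
have := Hn n.+1 (leqnSn n).
rewrite (FB _ _ ltr01 h1) opprD /=; apply: le_lt_trans; exact: ler_norm.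
Unshelve. all: by end_near. Qed.

End TailPrimitive.

(** * Monotonicity from the sign of derivatives *)

Section MonotoneRules.
Context {R : realType}.
Implicit Types (F dF : R -> R) (a b y : R).

Lemma deriv_neg_decr F dF : (forall t : R, 0 < t -> is_derive t 1 F (dF t)) ->
  (forall t : R, 0 < t -> dF t < 0) -> forall a b, 0 < a -> a < b -> F b < F a.
Proof.
move=> H dn a b a0 ab; have [c [ac _ e]] := mvt_pos a0 ab H.
by rewrite -subr_lt0 e nmulr_rlt0 ?subr_gt0// dn// (lt_trans a0).
Qed.

Lemma deriv_npos_ninc F dF : (forall t : R, 0 < t -> is_derive t 1 F (dF t)) ->
  (forall t : R, 0 < t -> dF t <= 0) -> forall a b, 0 < a -> a < b -> F b <= F a.
Proof.
move=> H dn a b a0 ab; have [c [ac _ e]] := mvt_pos a0 ab H.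
by rewrite -subr_le0 e mulr_le0_ge0 ?subr_ge0 ?(ltW ab)// dn// (lt_trans a0).
Qed.

(** Otherwise the graph would lie below a line of negative slope. *)
Lemma concave_gt0_deriv_ge0 F dF ddF : (forall t : R, 0 < t -> is_derive t 1 F (dF t)) ->
  (forall t : R, 0 < t -> is_derive t 1 dF (ddF t)) ->
  (forall t : R, 0 < t -> ddF t <= 0) -> (forall t : R, 0 < t -> 0 < F t) ->
  forall y, 0 < y -> 0 <= dF y.
Proof.
move=> H1 H2 d2 F0 y y0; rewrite leNgt; apply/negP => dn.
pose T := F y / - dF y.
have T0 : 0 < T by rewrite divr_gt0 ?oppr_gt0 ?F0.
have yT : y < y + T by rewrite ltrDl.
have [c [yc _ e]] := mvt_pos y0 yT H1.
have dc : dF c <= dF y by exact: deriv_npos_ninc H2 d2 _ _ y0 yc.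
have : F (y + T) - F y <= dF y * T.
  by rewrite e addrAC subrr add0r ler_wpM2r// ltW.
have -> : dF y * T = - F y by rewrite /T; field; rewrite lt_eqF.
rewrite lerBlDr addNr leNgt F0//; exact: addr_gt0.
Qed.

End MonotoneRules.

(** * The quotient of two primitives *)

Section Quotient.
Context {R : realType}.
Variables (phi d1 d2 d3 h M m1 m2 : R -> R).
Hypotheses (Dphi : forall t : R, 0 < t -> is_derive t 1 phi (d1 t))
  (Dd1 : forall t : R, 0 < t -> is_derive t 1 d1 (d2 t))
  (Dd2 : forall t : R, 0 < t -> is_derive t 1 d2 (d3 t))
  (DM : forall t : R, 0 < t -> is_derive t 1 M (m1 t))
  (Dm1 : forall t : R, 0 < t -> is_derive t 1 m1 (m2 t))
  (Dh : forall t : R, 0 < t -> is_derive t 1 h (d1 t * M t)).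
Hypotheses (d1_gt0 : forall t : R, 0 < t -> 0 < d1 t)
  (d_ineq : forall t : R, 0 < t ->
    d1 t ^+ 2 * d2 t + phi t * d1 t * d3 t - 2 * phi t * d2 t ^+ 2 <= 0)
  (M_gt0 : forall t : R, 0 < t -> 0 < M t)
  (m1_lt0 : forall t : R, 0 < t -> m1 t < 0)
  (M_lnconvex : forall t : R, 0 < t -> m1 t ^+ 2 < M t * m2 t)
  (phi_lt0 : forall t : R, 0 < t -> phi t < 0)
  (h_lt0 : forall t : R, 0 < t -> h t < 0)
  (phi_to0 : forall e : R, 0 < e -> exists2 y : R, 0 < y & - phi y < e)
  (h_to0 : forall e : R, 0 < e -> exists2 y : R, 0 < y & - h y < e).

Let A t := - phi t.
Let H t := - h t.
Let A_gt0 (t : R) : 0 < t -> 0 < A t. Proof. by move=> t0; rewrite oppr_gt0 phi_lt0. Qed.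
Let H_gt0 (t : R) : 0 < t -> 0 < H t. Proof. by move=> t0; rewrite oppr_gt0 h_lt0. Qed.
Let DA (t : R) : 0 < t -> is_derive t 1 A (- d1 t).
Proof. by move=> t0; exact: deriv_opp (Dphi t0). Qed.
Let DH (t : R) : 0 < t -> is_derive t 1 H (- (d1 t * M t)).
Proof. by move=> t0; exact: deriv_opp (Dh t0). Qed.

Let G t := A t * M t - H t.

(** The two terms [phi' * M] cancel. *)
Lemma deriv_gap (t : R) : 0 < t -> is_derive t 1 G (A t * m1 t).
Proof.
move=> t0; apply: is_derive_eq (deriv_sub (deriv_mul (DA t0) (DM t0)) (DH t0)) _.
by ring.
Qed.

(** [G] decreases, and it is at least [- H], which tends to zero. *)
Lemma gap_gt0 t : 0 < t -> 0 < G t.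
Proof.
have dn (u : R) : 0 < u -> A u * m1 u < 0.
  by move=> u0; rewrite pmulr_rlt0 ?A_gt0 ?m1_lt0.
have decr := deriv_neg_decr deriv_gap dn.
have G_ge0 (u : R) : 0 < u -> 0 <= G u.
  move=> u0; apply/ler_addgt0Pr => e e0; rewrite -lerBlDr sub0r.
  have [z z0 ze] := h_to0 e0.
  (* A point beyond u at which H is at most e. *)
  pose w := Num.max u z + 1.
  have w0 : 0 < w by rewrite addr_gt0// lt_max u0.
  have uw : u < w by rewrite ltr_pwDr// le_max lexx.
  have zw : z < w by rewrite ltr_pwDr// le_max lexx orbT.
  apply: le_trans (ltW (decr _ _ u0 uw)).
  have Hzw : H w <= H z.
    apply: deriv_npos_ninc DH _ _ _ z0 zw => v v0.
    by rewrite oppr_le0 mulr_ge0// ltW ?d1_gt0 ?M_gt0.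
  have He : H w <= e by apply: le_trans Hzw (ltW ze).
  rewrite /G -[leLHS]add0r lerD ?lerN2//.
  by rewrite mulr_ge0// ltW ?A_gt0 ?M_gt0.
move=> t0; have tt : t < t + 1 by rewrite ltrDl.
by apply: le_lt_trans (G_ge0 (t + 1) _) (decr _ _ t0 tt); rewrite addr_gt0.
Qed.

Definition quotient_deriv t := (d1 t * M t * phi t - h t * d1 t) / phi t ^+ 2.
Definition ln_quotient_deriv t := d1 t * M t / h t - d1 t / phi t.
Definition ln_quotient_deriv2 t := ((d2 t * M t + d1 t * m1 t) * h t - d1 t * M t * (d1 t * M t)) / h t ^+ 2
  - (d2 t * phi t - d1 t * d1 t) / phi t ^+ 2.

Let phi_neq0 t : 0 < t -> phi t != 0. Proof. by move=> t0; rewrite lt_eqF ?phi_lt0. Qed.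
Let h_neq0 t : 0 < t -> h t != 0. Proof. by move=> t0; rewrite lt_eqF ?h_lt0. Qed.
Let d1_neq0 t : 0 < t -> d1 t != 0. Proof. by move=> t0; rewrite gt_eqF ?d1_gt0. Qed.
Let H_neq0 t : 0 < t -> H t != 0. Proof. by move=> t0; rewrite gt_eqF ?H_gt0. Qed.

Lemma quotient_gt0 t : 0 < t -> 0 < h t / phi t.
Proof. by move=> t0; rewrite -[h t]opprK -[phi t]opprK invrN mulrNN divr_gt0 ?A_gt0 ?H_gt0. Qed.

Lemma deriv_quotient (t : R) : 0 < t -> is_derive t 1 (fun t => h t / phi t) (quotient_deriv t).
Proof. by move=> t0; exact: deriv_div (Dh t0) (Dphi t0) (phi_neq0 t0). Qed.

Lemma derivable_quotient_deriv (t : R) : 0 < t -> derivable quotient_deriv t 1.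
Proof.
move=> t0.
have D1 := deriv_mul (deriv_mul (Dd1 t0) (DM t0)) (Dphi t0).
have D2 := deriv_mul (Dh t0) (Dd1 t0).
have D3 := deriv_mul (Dphi t0) (Dphi t0).
have nz : phi t * phi t != 0 by rewrite mulf_neq0 ?phi_neq0.
have D := deriv_div (deriv_sub D1 D2) D3 nz.
have [D' _] := D.
exact: D'.
Qed.

Lemma quotient_deriv_lt0 t : 0 < t -> quotient_deriv t < 0.
Proof.
move=> t0; have -> : quotient_deriv t = - (d1 t * G t / A t ^+ 2).
  by rewrite /quotient_deriv /G /H /A; field; rewrite phi_neq0.
by rewrite oppr_lt0 divr_gt0 ?mulr_gt0 ?exprn_gt0 ?d1_gt0 ?gap_gt0 ?A_gt0.
Qed.

Lemma deriv_ln_quotient (t : R) : 0 < t -> is_derive t 1 (fun t => ln (h t / phi t)) (ln_quotient_deriv t).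
Proof.
move=> t0; apply: is_derive_eq (deriv_ln (deriv_quotient t0) (quotient_gt0 t0)) _.
by rewrite /quotient_deriv /ln_quotient_deriv; field; rewrite phi_neq0// h_neq0.
Qed.

Lemma deriv_ln_quotient_deriv (t : R) : 0 < t -> is_derive t 1 ln_quotient_deriv (ln_quotient_deriv2 t).
Proof.
move=> t0.
have D1 := deriv_div (deriv_mul (Dd1 t0) (DM t0)) (Dh t0) (h_neq0 t0).
exact: deriv_sub D1 (deriv_div (Dd1 t0) (Dphi t0) (phi_neq0 t0)).
Qed.

(** The inequality assumed on [d1], [d2], [d3] is the concavity of [v]: its
    left-hand side is the numerator of the second derivative [w1]. *)
Let v t := A t / d1 t.
Let w t := -1 - A t * d2 t / d1 t ^+ 2.
Let w1 t := (d1 t ^+ 2 * d2 t + phi t * d1 t * d3 t - 2 * phi t * d2 t ^+ 2) / d1 t ^+ 3.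

Let v_gt0 t : 0 < t -> 0 < v t. Proof. by move=> t0; rewrite divr_gt0 ?A_gt0 ?d1_gt0. Qed.

Let Dv (t : R) : 0 < t -> is_derive t 1 v (w t).
Proof.
move=> t0; apply: is_derive_eq (deriv_div (DA t0) (Dd1 t0) (d1_neq0 t0)) _.
by rewrite /w; field; rewrite d1_neq0.
Qed.

Let Dw (t : R) : 0 < t -> is_derive t 1 w (w1 t).
Proof.
move=> t0; have nz : d1 t * d1 t != 0 by rewrite mulf_neq0 ?d1_neq0.
have D := deriv_sub (deriv_cst (-1) t) (deriv_div (deriv_mul (DA t0) (Dd2 t0))
  (deriv_mul (Dd1 t0) (Dd1 t0)) nz).
apply: is_derive_eq D _.
by rewrite /w1 /A; field; rewrite d1_neq0.
Qed.

Let w1_le0 t : 0 < t -> w1 t <= 0.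
Proof. by move=> t0; rewrite pmulr_lle0 ?d_ineq// invr_gt0 exprn_gt0 ?d1_gt0. Qed.

Let w_ge0 t : 0 < t -> 0 <= w t.
Proof. by move=> t0; exact: concave_gt0_deriv_ge0 Dv Dw w1_le0 v_gt0 _ t0. Qed.

(** [H * v ^+ 2] times the second derivative of [ln (h / phi)]; its
    derivative has a constant sign. *)
Let K t := - (v t * A t * m1 t) - A t * M t / H t * G t + G t * w t.

Let K1 t := G t * w1 t - (A t ^+ 2 * m2 t / d1 t
  + 2 * (G t / H t) * (A t * m1 t) + (G t / H t) ^+ 2 * (d1 t * M t)).

Let DK (t : R) : 0 < t -> is_derive t 1 K (K1 t).
Proof.
move=> t0.
have D1 := deriv_opp (deriv_mul (deriv_mul (Dv t0) (DA t0)) (Dm1 t0)).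
have D2 := deriv_mul (deriv_div (deriv_mul (DA t0) (DM t0)) (DH t0) (H_neq0 t0)) (deriv_gap t0).
have D3 := deriv_mul (deriv_gap t0) (Dw t0).
apply: is_derive_eq (deriv_add (deriv_sub D1 D2) D3) _.
rewrite /K1 /w /v /G; move: (w1 t) => w1t.
by field; rewrite d1_neq0// H_neq0.
Qed.

(** Multiplied by [d1 * M], the bracket exceeds the square of [A * m1 + (G
    / H) * (d1 * M)], by strict logarithmic convexity of [M]. *)
Let K1_lt0 t : 0 < t -> K1 t < 0.
Proof.
move=> t0; rewrite subr_lt0; apply: (@le_lt_trans _ _ 0).
  by rewrite mulr_ge0_le0 ?w1_le0// ltW ?gap_gt0.
set s := G t / H t.
have c0 : 0 < d1 t * M t by rewrite mulr_gt0 ?d1_gt0 ?M_gt0.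
rewrite -(pmulr_lgt0 _ c0).
have -> : (A t ^+ 2 * m2 t / d1 t + 2 * s * (A t * m1 t) + s ^+ 2 * (d1 t * M t)) * (d1 t * M t)
   = A t ^+ 2 * (M t * m2 t - m1 t ^+ 2) + (A t * m1 t + s * (d1 t * M t)) ^+ 2.
  by field; rewrite d1_neq0.
by rewrite ltr_wpDr ?sqr_ge0// mulr_gt0 ?exprn_gt0 ?A_gt0// subr_gt0 M_lnconvex.
Qed.

(** [K] is decreasing; if it were not positive somewhere, it would be at
    most some [- c < 0] from [a] on, which makes [sqrt H - (s / 2) ln A]
    nonincreasing there, for [s = sqrt c]. But [ln A] tends to minus
    infinity. *)
Let K_gt0 (t : R) : 0 < t -> 0 < K t.
Proof.
move=> t0; rewrite ltNge; apply/negP => Kt.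
have decr := deriv_neg_decr DK K1_lt0.
pose a := t + 1; have ta : t < a by rewrite ltrDl.
have a0 : 0 < a by exact: lt_trans ta.
pose c := - K a; have c0 : 0 < c by rewrite oppr_gt0 (lt_le_trans (decr _ _ t0 ta)).
pose s := Num.sqrt c; have s0 : 0 < s by rewrite sqrtr_gt0.
(* K <= - c gives c <= A M G / H <= (A M)^2 / H, the other terms of K being
   nonnegative. *)
have bound u : a < u -> s * Num.sqrt (H u) <= A u * M u.
  move=> au; have u0 : 0 < u by exact: lt_trans au.
  have AM0 : 0 <= A u * M u by rewrite mulr_ge0// ltW ?A_gt0 ?M_gt0.
  rewrite -sqrtrM ?(ltW c0)// -[leRHS]ger0_norm// -sqrtr_sqr ler_sqrt ?sqr_ge0//.
  have Ku : c <= - K u by rewrite lerN2 ltW// decr.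
  have rG : c <= A u * M u / H u * G u.
    have -> : A u * M u / H u * G u = - K u + - (v u * A u * m1 u) + G u * w u.
      by rewrite /K; ring.
    apply: ler_wpDr; first by rewrite mulr_ge0 ?w_ge0// ltW ?gap_gt0.
    apply: ler_wpDr => //.
    have vA : 0 < v u * A u by rewrite mulr_gt0 ?v_gt0 ?A_gt0.
    by rewrite oppr_ge0 (pmulr_rle0 _ vA) ltW ?m1_lt0.
  rewrite mulrAC ler_pdivlMr ?H_gt0// in rG; apply: le_trans rG _.
  by rewrite expr2 ler_wpM2l// /G lerBlDr lerDl ltW ?H_gt0.
(* F' has the sign of s * sqrt H - A M. *)
pose F (u : R) := Num.sqrt (H u) - s / 2 * ln (A u).
pose dF (u : R) := (2 * Num.sqrt (H u))^-1 * - (d1 u * M u) - s / 2 * (- d1 u / A u).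
have DF (u : R) : 0 < u -> is_derive u 1 F (dF u).
  move=> u0.
  have D1 := is_derive1_comp (is_derive1_sqrt (H_gt0 u0)) (DH u0).
  have D3 := deriv_ln (DA u0) (A_gt0 u0).
  have D2 := deriv_mul (deriv_cst (s / 2) u) D3.
  by apply: is_derive_eq (deriv_sub D1 D2) _; rewrite mul0r add0r.
have Fa b : a < b -> F b <= F a.
  move=> ab; have [u [au _ e]] := mvt_pos a0 ab DF.
  have u0 : 0 < u by exact: lt_trans au.
  rewrite -subr_le0 e mulr_le0_ge0 ?subr_ge0 ?(ltW ab)//.
  have S0 : 0 < Num.sqrt (H u) by rewrite sqrtr_gt0 H_gt0.
  have -> : dF u = - (d1 u * (A u * M u - s * Num.sqrt (H u)) / (2 * Num.sqrt (H u) * A u)).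
    by rewrite /dF; field; rewrite gt_eqF ?A_gt0// gt_eqF.
  rewrite oppr_le0 mulr_ge0 ?invr_ge0//; last by rewrite !mulr_ge0// ltW ?A_gt0.
  by rewrite mulr_ge0 ?(ltW (d1_gt0 u0))// subr_ge0 bound.
(* F b <= F a bounds ln (A b) from below, uniformly in b. *)
have [z z0 ze] := phi_to0 (expR_gt0 (- (2 * F a / s))).
pose b := Num.max a z + 1.
have ab : a < b by rewrite ltr_pwDr// le_max lexx.
have zb : z < b by rewrite ltr_pwDr// le_max lexx orbT.
have b0 : 0 < b by exact: lt_trans ab.
have Azb : A b < A z.
  apply: deriv_neg_decr DA _ _ _ z0 zb => u u0.
  by rewrite oppr_lt0 d1_gt0.
have : ln (A b) < - (2 * F a / s).
  by rewrite -ltr_expR lnK ?posrE ?A_gt0//; exact: lt_trans Azb ze.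
apply/negP; rewrite -leNgt.
have lnb : - (s / 2 * ln (A b)) <= F a.
  by apply: le_trans (Fa b ab); rewrite /F lerDr sqrtr_ge0.
have -> : ln (A b) = - (2 * - (s / 2 * ln (A b)) / s) by field; rewrite gt_eqF.
by rewrite lerN2 ler_pM2r ?invr_gt0// ler_pM2l.
Qed.

Lemma ln_quotient_deriv2_gt0 t : 0 < t -> 0 < ln_quotient_deriv2 t.
Proof.
move=> t0; have -> : ln_quotient_deriv2 t = K t / (H t * v t ^+ 2).
  rewrite /ln_quotient_deriv2 /K /w /G /v /H /A; field.
  by rewrite phi_neq0// h_neq0// d1_neq0.
by rewrite divr_gt0 ?K_gt0// mulr_gt0 ?exprn_gt0 ?v_gt0 ?H_gt0.
Qed.

End Quotient.

(** * Iterated derivatives on the positive half-line *)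

Section DerivedFunctions.
Context {R : realType}.
Implicit Types (F dF : R -> R).

Lemma near_gt0 (t : R) : 0 < t -> \forall u \near t, 0 < u.
Proof. exact: lt_nbhsr. Qed.

(** Only the values on the half-line are prescribed, so equalities between
    derived functions hold there only; differentiating them once more uses
    that the half-line is open. *)
Lemma derive1_gt0E F dF : (forall t : R, 0 < t -> is_derive t 1 F (dF t)) ->
  forall t, 0 < t -> F^`()%classic t = dF t.
Proof. by move=> H t t0; have [_ <-] := H t t0; rewrite derive1E. Qed.

Lemma Dclass2_gt0 F dF : (forall t : R, 0 < t -> is_derive t 1 F (dF t)) ->
  (forall t : R, 0 < t -> derivable dF t 1) -> Dclass 2 `]0, +oo[ F.
Proof.
move=> H1 H2 [|[|//]] _ x /=; rewrite in_itv/= andbT => x0.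
  by have [] := H1 x x0.
apply: near_eq_derivable (H2 x x0).
by apply: filterS (near_gt0 x0) => u u0; rewrite (derive1_gt0E H1 u0).
Qed.

Lemma derive1n2_gt0E F dF ddF : (forall t : R, 0 < t -> is_derive t 1 F (dF t)) ->
  (forall t : R, 0 < t -> is_derive t 1 dF (ddF t)) ->
  forall t, 0 < t -> F^`(2)%classic t = ddF t.
Proof.
move=> H1 H2 t t0; have [_ <-] := H2 t t0; rewrite /= derive1E.
apply: near_eq_derive.
by apply: filterS (near_gt0 t0) => u u0; rewrite (derive1_gt0E H1 u0).
Qed.

Lemma Dclass_is_derive n F (k : nat) (t : R) : Dclass n `]0, +oo[ F -> (k < n)%N -> 0 < t ->
  is_derive t 1 F^`(k)%classic (F^`(k.+1)%classic t).
Proof.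
move=> HF kn t0.
by apply: DeriveDef; [apply: HF => //=; rewrite in_itv/= andbT|rewrite -derive1E].
Qed.

End DerivedFunctions.

(** * Hardy spaces *)

Section HardyMean.
Context {R : realType}.
Local Notation mu := (@lebesgue_measure R).

Lemma hardy_space_cderiv (p : R) (f : R[i] -> R[i]) : hardy_space p f ->
  exists f', cderiv f f'.
Proof.
move=> [hol _]; apply: holo_cderiv => z z0; exact: holomorphic_wirtinger (hol z z0).
Qed.

Lemma hardy_mean_bound (p : R) (f f' : R[i] -> R[i]) : 2 <= p -> hardy_space p f -> cderiv f f' ->
  exists K, forall y : R, 0 < y ->
    [/\ mu.-integrable [set: R] (EFin \o (fun x => Mass f p (x +i* y))),
        hardy_mean p f y = (\int[mu]_x Mass f p (x +i* y))%:E &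
        \int[mu]_x Mass f p (x +i* y) <= K].
Proof.
move=> p2 [_ supf] hf; set S := [set _ | _ in _] in supf.
have Sy (y : R) : 0 < y -> (hardy_mean p f y <= ereal_sup S)%E.
  by move=> y0; apply: ereal_sup_ubound; exists y => //=; rewrite in_itv/= andbT.
have hm0 (y : R) : (0 <= hardy_mean p f y)%E.
  by apply: integral_ge0 => x _; rewrite lee_fin powR_ge0.
have Sfin : ereal_sup S \is a fin_num.
  by rewrite ge0_fin_numE//; exact: le_trans (hm0 1) (Sy 1 ltr01).
exists (fine (ereal_sup S)) => y y0.
have mfin : hardy_mean p f y \is a fin_num.
  by rewrite ge0_fin_numE//; exact: le_lt_trans (Sy y y0) supf.
have iM : mu.-integrable [set: R] (EFin \o (fun x => Mass f p (x +i* y))).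
  apply/integrableP; split.
    apply/measurable_EFinP; apply: cts_measurable => x.
    exact: cont2_x y0 (Mass_cont2 hf p2).
  have -> : (\int[mu]_x `|(EFin \o (fun x => Mass f p (x +i* y))) x| = hardy_mean p f y)%E.
    by apply: eq_integral => x _ /=; rewrite ger0_norm// powR_ge0.
  exact: le_lt_trans (Sy y y0) supf.
have e : hardy_mean p f y = (\int[mu]_x Mass f p (x +i* y))%:E.
  by rewrite EFin_Rintegral.
by split => //; rewrite -lee_fin -e fineK// Sy.
Qed.

End HardyMean.

(** * Logarithmic convexity of the quotient *)

Theorem theorem14 (R : realType) (p : R) (f : R[i] -> R[i])
    (phi h : R -> R)
    (p_ge2 : 2 <= p)
    (f_hardy : hardy_space p f)
    (f_neq0 : exists2 z, upper_half_plane z & f z != 0)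
    (phi_D3 : Dclass 3 `]0, +oo[ phi)
    (phi_int : forall y : R, 0 < y ->
       ((phi y)%:E =
          - \int[lebesgue_measure]_(t in `]y, +oo[) (phi^`()%classic t)%:E)%E)
    (phi'_gt0 : forall y : R, 0 < y -> 0 < phi^`()%classic y)
    (phi_ineq : forall y : R, 0 < y ->
       phi^`()%classic y ^+ 2 * phi^`(2)%classic y
         + phi y * phi^`()%classic y * phi^`(3)%classic y
         - 2 * phi y * phi^`(2)%classic y ^+ 2 <= 0)
    (h_int : forall y : R, 0 < y ->
       ((h y)%:E =
          - \int[lebesgue_measure]_(t in `]y, +oo[)
              ((phi^`()%classic t)%:E * hardy_mean p f t))%E) :
  let q : R -> R := fun y => h y / phi y in
  let lq : R -> R := fun y => ln (q y) in
  [/\ (forall y : R, 0 < y -> phi y != 0 /\ 0 < q y),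
      Dclass 2 `]0, +oo[ q,
      Dclass 2 `]0, +oo[ lq,
      (forall y : R, 0 < y -> q^`()%classic y < 0) &
      (forall y : R, 0 < y -> 0 < lq^`(2)%classic y)].

Proof.
have [f' hf] := hardy_space_cderiv f_hardy.
have [K HK] := hardy_mean_bound p_ge2 f_hardy hf.
have Kint y (y0 : 0 < y) := let: And3 a _ _ := HK y y0 in a.
have meanE y (y0 : 0 < y) : hardy_mean p f y = (line_mass f p y)%:E := let: And3 _ a _ := HK y y0 in a.
have Kbound y (y0 : 0 < y) := let: And3 _ _ a := HK y y0 in a.
have M0 := line_mass_gt0 hf p_ge2 Kint Kbound f_neq0.
have DM := is_derive_line_mass hf p_ge2 Kint Kbound.
have DV := is_derive_line_flux hf p_ge2 Kint Kbound.
have V0 := line_flux_lt0 hf p_ge2 Kint Kbound f_neq0.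
have CS := cauchy_schwarz_strict hf p_ge2 Kint Kbound.
have Dphi (t : R) : 0 < t -> is_derive t 1 phi (phi^`()%classic t).
  by move=> t0; exact: (Dclass_is_derive phi_D3 (isT : 0 < 3)%N t0).
have Dd1 (t : R) : 0 < t -> is_derive t 1 phi^`()%classic (phi^`(2)%classic t).
  by move=> t0; exact: (Dclass_is_derive phi_D3 (isT : 1 < 3)%N t0).
have Dd2 (t : R) : 0 < t -> is_derive t 1 phi^`(2)%classic (phi^`(3)%classic t).
  by move=> t0; exact: (Dclass_is_derive phi_D3 (isT : 2 < 3)%N t0).
have cphi' (t : R) (t0 : 0 < t) := deriv_continuous (Dd1 t t0).
have [_ phi0 phi_lim] := tail_primitive cphi' phi'_gt0 phi_int.
have [Dh h0 h_lim] : [/\ forall y : R, 0 < y -> is_derive y 1 h (phi^`()%classic y * line_mass f p y),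
    forall y : R, 0 < y -> h y < 0 & forall e : R, 0 < e -> exists2 y : R, 0 < y & - h y < e].
  apply: tail_primitive => [t t0|t t0|y y0].
  - by apply: cvgM; [exact: cphi'|exact: deriv_continuous (DM t t0)].
  - by rewrite mulr_gt0 ?phi'_gt0 ?M0.
  - rewrite (h_int y y0); congr (- _)%E; apply: eq_integral => t.
    by rewrite inE/= in_itv/= andbT => yt; rewrite meanE ?(lt_trans y0)// EFinM.
have p0 : 0 < p by exact: lt_le_trans p_ge2.
pose m1 y := p * line_flux f f' p y; pose m2 y := p * (p * line_energy f f' p y).
have Dm1 (t : R) : 0 < t -> is_derive t 1 m1 (m2 t).
  move=> t0; apply: is_derive_eq (deriv_mul (deriv_cst p t) (DV t t0)) _.
  by rewrite mul0r add0r.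
have m1_lt0 (t : R) : 0 < t -> m1 t < 0 by move=> t0; rewrite pmulr_rlt0 ?V0.
have lc (t : R) : 0 < t -> m1 t ^+ 2 < line_mass f p t * m2 t.
  move=> t0; have -> : line_mass f p t * m2 t = p ^+ 2 * (line_energy f f' p t * line_mass f p t).
    by rewrite /m2 expr2 mulrC !mulrA.
  by rewrite exprMn ltr_pM2l ?exprn_gt0// CS ?M0.
move=> q lq.
have Dq := deriv_quotient Dphi Dh phi0.
have Dlq := deriv_ln_quotient Dphi Dh phi0 h0.
have Dl1 := deriv_ln_quotient_deriv Dphi Dd1 DM Dh phi0 h0.
split.
- by move=> y y0; rewrite lt_eqF ?phi0//; split => //; exact: quotient_gt0 phi0 h0 _ y0.
- apply: Dclass2_gt0 Dq _; exact: derivable_quotient_deriv Dphi Dd1 DM Dh phi0.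
- apply: Dclass2_gt0 Dlq _ => t t0; by have [] := Dl1 t t0.
- move=> y y0; rewrite (derive1_gt0E Dq y0).
  exact: (quotient_deriv_lt0 Dphi DM Dh phi'_gt0 M0 m1_lt0 phi0 h_lim y0).
- move=> y y0; rewrite (derive1n2_gt0E Dlq Dl1 y0).
  exact: (ln_quotient_deriv2_gt0 Dphi Dd1 Dd2 DM Dm1 Dh phi'_gt0 phi_ineq M0 m1_lt0 lc phi0 h0 phi_lim h_lim y0).
Qed.
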